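(* As $\varepsilon\to0$, the family $\{E_\varepsilon\}$ $\Gamma$-converges to $E_0$ in $L^2\big((0,1);\mathbb{R}^2\big)$.
   Context: Fix a constant $L>0$, a positive integer $N$ and $\alpha\in[0,2\pi)$. Identify $\mathbb{R}^2$ with $\mathbb{C}$ when convenient. Let $$\mathcal{A}_\alpha=\{u\in H^1((0,1);\mathbb{R}^2): u(0)=1,\ u(1)=e^{i\alpha}\}.$$ For $\varepsilon>0$ and $u=(u_1,u_2)\in\mathcal{A}_\alpha$ set $$E_\varepsilon(u)=\int_0^1 \frac{\varepsilon}{2}|u'|^2+\frac{1}{4\varepsilon}(|u|^2-1)^2+\frac{L}{2}(u_1u_2'-u_2u_1'-2\pi N)^2\,dx,$$ and set $E_\varepsilon(u)=+\infty$ for $u\in L^2((0,1);\mathbb{R}^2)\setminus\mathcal{A}_\alpha$. The limiting functional $E_0$ on $L^2((0,1);\mathbb{R}^2)$ is $$E_0(u)=\begin{cases}\displaystyle\frac{L}{2}\int_0^1(u_1u_2'-u_2u_1'-2\pi N)^2\,dx+\frac{2\sqrt2}{3}\mathcal{H}^0(J)&\text{if }u\in H^1((0,1)\setminus J;S^1),\\ +\infty&\text{otherwise,}\end{cases}$$ where $\mathcal{H}^0$ is counting measure, and $J$ is a finite (possibly empty) collection of points consisting of points $0<x_1<\dots<x_k<1$ together with possibly $0$ and/or $1$: the point $0$ is included in $J$ only if the trace $u(0^+)\neq1$, and the point $1$ is included in $J$ only if the trace $u(1^-)\neq e^{i\alpha}$ (and they are included in those cases). $J$ is taken to be the minimal such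 set, meaning that if any point of $J\cap(0,1)$ were removed, $u$ would no longer be an $H^1$ function on the complement of the smaller set. The case ''otherwise'' means that no such finite set exists. Derivatives in $E_0$ are taken on $(0,1)\setminus J$. $\Gamma$-convergence in $L^2$ means: (1) whenever $u_\varepsilon\to u$ in $L^2$, $\liminf_{\varepsilon\to0}E_\varepsilon(u_\varepsilon)\ge E_0(u)$; (2) for every $u\in L^2$ there is a family $v_\varepsilon\to u$ in $L^2$ with $\lim_{\varepsilon\to0}E_\varepsilon(v_\varepsilon)=E_0(u)$. *)

(* Defs.v *)
From HB Require Import structures.
From mathcomp Require Import all_boot all_order all_algebra.
From mathcomp Require Import all_classical all_reals all_analysis.

Set Implicit Arguments.
Unset Strict Implicit.
Unset Printing Implicit Defensive.

Import Order.TTheory GRing.Theory Num.Theory.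
Import numFieldNormedType.Exports.

Local Open Scope classical_set_scope.
Local Open Scope ring_scope.

(* Elements of L^2 and H^1 are represented by functions defined on all of R;
   every notion below only depends on their classes modulo equality almost
   everywhere on the relevant open set.  The product norm of R * R is the sup
   norm, hence the explicit Euclidean one. *)

Definition sqnorm2 {R : realType} (z : R * R) : R := z.1 ^+ 2 + z.2 ^+ 2.

(* L^2(D): the extension by zero is in L^2(R). *)
Definition L2 {R : realType} (D : set R) (f : R -> R) : Prop :=
  f \_ D \in Lfun (@lebesgue_measure R) 2%:E.

Definition L2vec {R : realType} (D : set R) (u : R -> R * R) : Prop :=
  L2 D (fst \o u) /\ L2 D (snd \o u).

Definition norm2 {R : realType} (z : R * R) : R := Num.sqrt (sqnorm2 z).

Definition L2dist {R : realType} (D : set R) (u v : R -> R * R) : \bar R :=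
  'N[@lebesgue_measure R]_2%:E[EFin \o ((fun x => norm2 (u x - v x)%R) \_ D)]%E.

(* Test functions are C^1 with compact support in D; for L^2 data this gives
   the same weak derivatives as smooth test functions. *)
Definition test_fun {R : realType} (D : set R) (phi : R -> R) : Prop :=
  [/\ forall x : R, derivable phi x 1, continuous (derive1 phi),
      compact (closure [set x | phi x != 0]) &
      closure [set x | phi x != 0] `<=` D].

(* g in L^2(D) is the weak derivative of f on the open set D. *)
Definition is_weak_deriv {R : realType} (D : set R) (f g : R -> R) : Prop :=
  L2 D g /\
  forall phi, test_fun D phi ->
    \int[lebesgue_measure]_(x in D) (f x * derive1 phi x) =
    - \int[lebesgue_measure]_(x in D) (g x * phi x).

Definition H1 {R : realType} (D : set R) (f : R -> R) : Prop :=
  L2 D f /\ exists g, is_weak_deriv D f g.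

Definition H1vec {R : realType} (D : set R) (u : R -> R * R) : Prop :=
  H1 D (fst \o u) /\ H1 D (snd \o u).

Definition H1circle {R : realType} (D : set R) (u : R -> R * R) : Prop :=
  H1vec D u /\ {ae lebesgue_measure, forall x, D x -> sqnorm2 (u x) = 1}.

(* A representative of the weak derivative on D, zero if there is none. *)
Definition wderiv {R : realType} (D : set R) (f : R -> R) : R -> R :=
  xget (fun=> 0) [set g | is_weak_deriv D f g].

Definition wderiv_vec {R : realType} (D : set R) (u : R -> R * R) (x : R) :
    R * R :=
  (wderiv D (fst \o u) x, wderiv D (snd \o u) x).

Definition twist {R : realType} (D : set R) (u : R -> R * R) (x : R) : R :=
  (u x).1 * (wderiv_vec D u x).2 - (u x).2 * (wderiv_vec D u x).1.

(* One-sided traces u(a^+) = l and u(a^-) = l: the value at a of a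
   representative of u that is continuous up to a. *)
Definition right_trace {R : realType} (u : R -> R * R) (a : R) (l : R * R) :
    Prop :=
  exists d : R, 0 < d /\ exists v : R -> R * R,
    [/\ {within `[a, a + d], continuous v},
        {ae lebesgue_measure, forall x, `]a, a + d[%classic x -> u x = v x} &
        v a = l].

Definition left_trace {R : realType} (u : R -> R * R) (a : R) (l : R * R) :
    Prop :=
  exists d : R, 0 < d /\ exists v : R -> R * R,
    [/\ {within `[a - d, a], continuous v},
        {ae lebesgue_measure, forall x, `]a - d, a[%classic x -> u x = v x} &
        v a = l].

Definition unit_interval {R : realType} : set R := `]0, 1[%classic.

Definition cis {R : realType} (alpha : R) : R * R := (cos alpha, sin alpha).

Definition admissible {R : realType} (alpha : R) (u : R -> R * R) : Prop :=
  [/\ H1vec unit_interval u, right_trace u 0 (1, 0) &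
      left_trace u 1 (cis alpha)].

Definition energy {R : realType} (L : R) (N : nat) (alpha eps : R)
    (u : R -> R * R) : \bar R :=
  if `[< admissible alpha u >] then
    (\int[lebesgue_measure]_(x in unit_interval)
       (eps / 2 * sqnorm2 (wderiv_vec unit_interval u x)
        + (4 * eps)^-1 * (sqnorm2 (u x) - 1) ^+ 2
        + L / 2 * (twist unit_interval u x - 2 * pi * N%:R) ^+ 2)%:E)%E
  else +oo%E.

(* J is the minimal jump set of u; the endpoints belong to J exactly when the
   traces of u miss the boundary values. *)
Definition is_jump_set {R : realType} (alpha : R) (u : R -> R * R)
    (J : set R) : Prop :=
  [/\ finite_set J /\ J `<=` `[0, 1]%classic,
      H1circle (unit_interval `\` J) u,
      (forall x, (J `&` unit_interval) x ->
         ~ H1vec (unit_interval `\` (J `\ x)) u),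
      (J 0 <-> exists2 l, right_trace u 0 l & l <> (1, 0)) &
      (J 1 <-> exists2 l, left_trace u 1 l & l <> cis alpha)].

Definition jump_set {R : realType} (alpha : R) (u : R -> R * R) : set R :=
  xget set0 [set J | is_jump_set alpha u J].

Definition limit_energy {R : realType} (L : R) (N : nat) (alpha : R)
    (u : R -> R * R) : \bar R :=
  if `[< exists J, is_jump_set alpha u J >] then
    let J := jump_set alpha u in
    let D := unit_interval `\` J in
    ((L / 2)%:E * \int[lebesgue_measure]_(x in D)
                    ((twist D u x - 2 * pi * N%:R) ^+ 2)%:E
     + (2 * Num.sqrt 2 / 3)%:E * counting J)%E
  else +oo%E.

Definition L2_cvg {R : realType} (D : set R) (u_ : R -> R -> R * R)
    (u : R -> R * R) : Prop :=
  L2dist D (u_ eps) u @[eps --> 0^'+] --> 0%E.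

(* Gamma-convergence in L^2(D; R^2), as eps -> 0^+, of the functionals F eps. *)
Definition Gamma_cvg_L2 {R : realType} (D : set R)
    (F : R -> (R -> R * R) -> \bar R) (F0 : (R -> R * R) -> \bar R) : Prop :=
  (forall (u_ : R -> R -> R * R) (u : R -> R * R),
     (forall eps : R, 0 < eps -> L2vec D (u_ eps)) -> L2vec D u ->
     L2_cvg D u_ u ->
     (F0 u <= limf_einf (fun eps => F eps (u_ eps)) (0 : R)^'+)%E) /\
  (forall u : R -> R * R, L2vec D u ->
     exists v_ : R -> R -> R * R,
       [/\ (forall eps : R, 0 < eps -> L2vec D (v_ eps)), L2_cvg D v_ u &
           F eps (v_ eps) @[eps --> 0^'+] --> F0 u]).

(* Main.v *)
Require Import Defs.
From mathcomp Require Import all_boot all_order all_algebra.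
From mathcomp Require Import all_classical all_reals all_analysis.
From mathcomp Require Import measurable_realfun.
From mathcomp Require Import ring lra.

Set Implicit Arguments.
Unset Strict Implicit.
Unset Printing Implicit Defensive.

Import Order.TTheory GRing.Theory Num.Theory.
Import numFieldNormedType.Exports.

Local Open Scope classical_set_scope.
Local Open Scope ring_scope.

(** Lower bound. Curves are extended by their boundary values beyond 0 and 1, so
    that jumps at the end points become interior ones, and limits are taken along
    an ultrafilter on the parameters eps with energy at most M.  Let a dip be a
    point near which |u_eps| falls below d.  Near each dip |u_eps| comes back close
    to 1 on both sides, so the Modica-Mortola part of the energy is at least
    2 sqrt 2 / 3 - 2 sqrt 2 d per dip and dips are finite in number.  Away from
    them w = u_eps / |u_eps| satisfies w' = i (torque / |u_eps|^2) w; torques are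
    bounded in L^2 and converge weakly to some g, whence u' = i g u for the limit.
    Thus every jump of u is a dip, the twist of u is g, and the twist energy is
    weakly lower semicontinuous; finally d tends to 0.

    Upper bound.  With t = sqrt eps, the jumps at 0 and 1 are moved to t and 1 - t
    and u is multiplied by a modulus rho with an optimal (hyperbolic tangent)
    profile of half-width t at each jump.  Where the phase jumps rho vanishes, and
    the torque rho^2 (u x u') does not involve rho', so that only the
    Modica-Mortola part sees the profiles. *)

(** The constant [2 * Num.sqrt 2 / 3] is twice the integral of [(1 - r^2) / sqrt 2] over [[0, 1]]:
    at a jump the modulus has to go from 1 to 0 and back. The obstacle is that no derivative is
    bounded uniformly: the gradient carries the factor eps, and the twist term controls modulus
    squared times phase derivative, which says nothing about the phase where the modulus is small.
    No angle is ever chosen; the equation of the unit vector is passed to the limit in weak form, as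
    a product of a weakly convergent torque and a strongly convergent curve. An ultrafilter replaces
    the extraction of subsequences: every bounded quantity converges along it at once, and being a
    dip is a decided property. The modulus need not be differentiable at the zeros of the curve,
    where it matters most, so the inequalities are verified on short intervals and added up instead
    of being integrated by a chain rule. The half-width [sqrt eps] lies between the natural width
    eps of the profile and 1: the truncated profile almost reaches its limit 1, while the set on
    which [u] is modified still shrinks to nothing. *)

Section CousinLemma.
Context {R : realType}.

(** Compactness of [[a, b]] in the form used to glue local estimates. The supremum [c] of the points
    reachable from [a] is itself reached through a short interval ending at [c], and a short
    interval starting at [c] would lead past it unless [c = b]. Only intervals having [x] as an end
    point are treated locally, so estimates may be linearised there. *)
Lemma cousin (a b : R) (P : R -> R -> Prop) : a <= b ->
  (forall s r t, a <= s -> s <= r -> r <= t -> t <= b ->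
     P s r -> P r t -> P s t) ->
  (forall x, a <= x <= b -> exists2 d, 0 < d &
     (forall t, x <= t < x + d -> t <= b -> P x t) /\
     (forall s, x - d < s <= x -> a <= s -> P s x)) ->
  P a b.
Proof.
move=> ab cat loc.
pose S := [set t | a <= t <= b /\ P a t].
have Sa : S a.
  split; first by rewrite lexx ab.
  have [|d d0 [H _]] := loc a; first by rewrite lexx ab.
  by apply: H => //; rewrite lexx ltrDl.
have supS : has_sup S.
  by split; [exists a | exists b => t [/andP[]]].
set c := sup S.
have ac : a <= c by apply: ub_le_sup => //; case: supS.
have cb : c <= b by apply: ge_sup; [exists a|move=> t [/andP[]]].
have [|d d0 [Hr Hl]] := loc c; first by rewrite ac.
have [s [/andP[as_ sb] Ps] cs] : exists2 s, S s & c - d < s.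
  exact: (sup_adherent d0 supS).
have sc : s <= c by apply: ub_le_sup; [case: supS|split=> //; rewrite as_].
have Pac : P a c.
  by apply: (cat a s c) => //; apply: Hl => //; rewrite cs.
move: cb; rewrite le_eqVlt => /predU1P[<-//|cb].
pose t := Num.min b (c + d / 2).
have ct : c < t by rewrite lt_min cb/= ltrDl divr_gt0.
have tb : t <= b by rewrite ge_min lexx.
have : S t.
  split; first by rewrite tb (le_trans ac) // ltW.
  apply: (cat a c t) => //; first exact: ltW.
  apply: Hr => //; rewrite ltW//= gt_min ltrD2l.
  by apply/orP; right; rewrite ltr_pdivrMr// ltr_pMr// ltr1n.
move=> /(ub_le_sup (proj2 supS)); rewrite -/c leNgt.
by rewrite ct.
Qed.

End CousinLemma.

(** * Integrals on intervals and indefinite integrals *)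

(* The Borel structure is given explicitly: on [set R], unification may pick the
   semiring of half-open intervals instead. *)
Notation mset := (@measurable _ (measurableTypeR _)).
Notation mfun_on := (@measurable_fun _ _ (measurableTypeR _) _).

Section RealIntegrals.
Context {R : realType}.
Notation mu := (@lebesgue_measure R).
Implicit Types (D : set R) (f g h : R -> R).

Lemma aeS (P Q : R -> Prop) : (forall x, P x -> Q x) ->
  {ae mu, forall x, P x} -> {ae mu, forall x, Q x}.
Proof. by move=> PQ; apply: (@filterS _ _ (ae_filter_ringOfSetsType mu)). Qed.

Lemma aeS2 (P Q S : R -> Prop) : (forall x, P x -> Q x -> S x) ->
  {ae mu, forall x, P x} -> {ae mu, forall x, Q x} -> {ae mu, forall x, S x}.
Proof. by move=> PQ; apply: (@filterS2 _ _ (ae_filter_ringOfSetsType mu)). Qed.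

Definition itg (D : set R) (f : R -> R) : Prop := mu.-integrable D (EFin \o f).

Lemma itg_measurable D f : mset D -> itg D f -> mfun_on D f.
Proof. by move=> mD /measurable_int /measurable_EFinP. Qed.

Lemma itgD D f g : mset D -> itg D f -> itg D g -> itg D (fun x => f x + g x).
Proof. by move=> mD fi gi; apply: (eq_integrable mD _ _ _ (integrableD mD fi gi)). Qed.

Lemma itgB D f g : mset D -> itg D f -> itg D g -> itg D (fun x => f x - g x).
Proof. by move=> mD fi gi; apply: (eq_integrable mD _ _ _ (integrableB mD fi gi)). Qed.

Lemma itgZ D k f : mset D -> itg D f -> itg D (fun x => k * f x).
Proof. by move=> mD fi; apply: (eq_integrable mD _ _ _ (integrableZl mD k fi)). Qed.

Lemma itg_norm D f : mset D -> itg D f -> itg D (fun x => `|f x|).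
Proof. by move=> mD fi; apply: eq_integrable (integrable_norm fi). Qed.

Lemma itgS D E f : mset D -> mset E -> D `<=` E -> itg E f -> itg D f.
Proof. by move=> mD mE DE; exact: integrableS. Qed.

Lemma eq_itg D f g : mset D -> (forall x, D x -> f x = g x) -> itg D f -> itg D g.
Proof.
move=> mD fg; apply: (eq_integrable mD) => x /set_mem Dx /=.
by rewrite fg.
Qed.

Lemma itg_le D f g : mset D -> mfun_on D f ->
  (forall x, D x -> `|f x| <= g x) -> itg D g -> itg D f.
Proof.
move=> mD mf fg; apply: le_integrable => //; first exact/measurable_EFinP.
move=> x Dx /=; rewrite lee_fin (le_trans (fg _ Dx))//.
exact: ler_norm.
Qed.

Lemma itgM D f g (M : R) : mset D -> mfun_on D f ->
  (forall x, D x -> `|f x| <= M) -> itg D g -> itg D (fun x => f x * g x).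
Proof.
move=> mD mf fM gi; apply: (@itg_le _ _ (fun x => M * `|g x|)) => //.
- by apply: measurable_funM => //; exact: itg_measurable gi.
- by move=> x Dx; rewrite normrM ler_wpM2r// fM.
- by apply: itgZ => //; exact: itg_norm.
Qed.

Lemma itg_cst D (k : R) : mset D -> (mu D < +oo)%E -> itg D (fun=> k).
Proof.
move=> mD Dy; apply: measurable_bounded_integrable => //.
exists `|k|; split; first exact: num_real.
by move=> M kM x _ /=; exact: ltW.
Qed.

Lemma itg_bounded D f (M : R) : mset D -> (mu D < +oo)%E ->
  mfun_on D f -> (forall x, D x -> `|f x| <= M) -> itg D f.
Proof.
by move=> mD Dy mf fM; apply: itg_le fM _ => //; exact: itg_cst.
Qed.

Lemma mu_itv_lty (i : interval R) (a b : R) :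
  [set` i] `<=` `[a, b] -> (mu [set` i] < +oo)%E.
Proof.
move=> iab; apply: (@le_lt_trans _ _ (mu `[a, b]%classic)).
  by apply: le_measure => //; rewrite inE.
by rewrite lebesgue_measure_itv/=; case: ifPn => // _; rewrite -EFinD ltry.
Qed.

(** Absolute continuity of the integral, brought from the whole line by extending [f] by zero. *)
Lemma itg_small D f (e : R) : mset D -> itg D f -> 0 < e ->
  exists2 d : R, 0 < d & forall A, mset A -> A `<=` D ->
    (mu A < d%:E)%E -> \int[mu]_(x in A) `|f x| < e.
Proof.
move=> mD fi e0.
have fDi : mu.-integrable setT (EFin \o (f \_ D)).
  by rewrite -restrict_EFin; apply/integrable_restrict => //=; rewrite setTI.
have [d [d0 H]] := integral_normr_continuous fDi e0.
exists d => // A mA AD Ad; have := H A mA Ad.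
rewrite (_ : \int[mu]_(x in A) `|(f \_ D) x| = \int[mu]_(x in A) `|f x|)//.
by apply: eq_Rintegral => x /set_mem/AD Dx; rewrite patchE mem_set.
Qed.

Lemma RintegralN D f : mset D -> itg D f ->
  \int[mu]_(x in D) (- f x) = - \int[mu]_(x in D) f x.
Proof.
move=> mD fi; rewrite -mulN1r -RintegralZl//.
by apply: eq_Rintegral => x _; rewrite mulN1r.
Qed.

Lemma Rintegral_sub0 D E f : mset D -> mset E -> D `<=` E ->
  (forall x, E x -> ~ D x -> f x = 0) ->
  \int[mu]_(x in E) f x = \int[mu]_(x in D) f x.
Proof.
move=> mD mE DE f0; rewrite [LHS]Rintegral_mkcond [RHS]Rintegral_mkcond.
congr (Rintegral _ _ _); apply/funext => x; rewrite !patchE.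
have [/set_mem Dx|/negP Dx] := boolP (x \in D).
  by rewrite mem_set//; exact: DE.
case: ifPn => // /set_mem Ex; apply: f0 => // Dx'.
by apply: Dx; rewrite inE.
Qed.

Lemma itg_sub0 D E f : mset D -> mset E -> D `<=` E ->
  (forall x, E x -> ~ D x -> f x = 0) -> itg D f -> itg E f.
Proof.
move=> mD mE DE f0 fi.
have : itg E (f \_ D).
  rewrite /itg -restrict_EFin.
  by apply/integrable_restrict => //; rewrite setIidr.
apply: (eq_itg mE) => x Ex; rewrite patchE; case: ifPn => // /negP xD.
by rewrite f0// => Dx; apply: xD; rewrite inE.
Qed.

Lemma itgU D E f : mset D -> mset E -> itg D f -> itg E f -> itg (D `|` E) f.
Proof.
move=> mD mE fD fE; have mDE : mset (D `|` E) by exact: measurableU.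
have patch A : mset A -> A `<=` D `|` E -> itg A f -> itg (D `|` E) (f \_ A).
  move=> mA AS fA; have fA' : itg A (f \_ A).
    by apply: eq_itg fA => // x Ax; rewrite patchE mem_set.
  apply: itg_sub0 fA' => // x _ nA.
  by rewrite patchE; case: ifPn => // /set_mem.
apply: (@itg_le _ _ (fun x => `|(f \_ D) x| + `|(f \_ E) x|)) => //.
- by apply/measurable_funU => //; split; exact: itg_measurable.
- move=> x DEx; rewrite !patchE; case: ifPn => [_|/negP xD].
    by rewrite lerDl.
  rewrite normr0 add0r mem_set//; case: DEx => // Dx.
  by exfalso; apply: xD; rewrite inE.
- by apply: itgD => //; apply: itg_norm => //; apply: patch.
Qed.

Lemma Rintegral_ae_eq D f g : mset D -> mfun_on D f ->
  mfun_on D g -> {ae mu, forall x, D x -> f x = g x} ->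
  \int[mu]_(x in D) f x = \int[mu]_(x in D) g x.
Proof.
move=> mD mf mg fg; congr fine; apply: ae_eq_integral => //.
- exact/measurable_EFinP.
- exact/measurable_EFinP.
- by apply: aeS fg => x + Dx /= => ->.
Qed.

Lemma itg_ae_eq D f g : mset D ->
  mfun_on D g -> {ae mu, forall x, D x -> f x = g x} ->
  itg D f -> itg D g.
Proof.
move=> mD mg fg fi; apply/integrableP; split; first exact/measurable_EFinP.
move/integrableP : (fi) => [mf].
apply: le_lt_trans; rewrite le_eqVlt; apply/orP; left; apply/eqP.
apply: ae_eq_integral => //.
- by apply: measurableT_comp => //; exact/measurable_EFinP.
- exact: measurableT_comp.
- by apply: aeS fg => x + Dx /= => ->.
Qed.

Lemma le_Rintegral_set D E f : mset D -> mset E -> D `<=` E ->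
  (forall x, E x -> 0 <= f x) -> itg E f ->
  \int[mu]_(x in D) f x <= \int[mu]_(x in E) f x.
Proof.
move=> mD mE DE f0 fi; rewrite /Rintegral fine_le//.
- by apply: integrable_fin_num => //; exact: itgS fi.
- exact: integrable_fin_num.
- apply: ge0_subset_integral => //; first exact: measurable_int fi.
Qed.

Lemma Rintegral_ge0_eq0 D f : mset D -> itg D f ->
  (forall x, D x -> 0 <= f x) -> \int[mu]_(x in D) f x <= 0 ->
  {ae mu, forall x, D x -> f x = 0}.
Proof.
move=> mD fi f0 If.
have : (\int[mu]_(x in D) `|(f x)%:E| = 0)%E.
  have E : ((\int[mu]_(x in D) f x)%:E = \int[mu]_(x in D) (f x)%:E)%E.
    by rewrite fineK//; exact: (integrable_fin_num mD fi).
  under eq_integral => x /set_mem Dx do rewrite gee0_abs ?lee_fin ?f0//.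
  rewrite -E; congr EFin; apply/eqP; rewrite eq_le If/=.
  exact: Rintegral_ge0.
move/(ae_eq_integral_abs mu mD (measurable_int mu fi)).
by apply: aeS => x H Dx; exact: EFin_inj (H Dx).
Qed.

End RealIntegrals.

Notation ig s t f := (Rintegral (@lebesgue_measure _) `[s, t]%classic f).

Section IntervalIntegrals.
Context {R : realType}.
Notation mu := (@lebesgue_measure R).
Implicit Types (a b s t r x : R) (f g h : R -> R).

Definition itgi a b f := itg `[a, b] f.

Lemma itgiS a b s t f : a <= s -> t <= b -> itgi a b f -> itgi s t f.
Proof.
move=> sa tb; apply: itgS => //.
by apply: subset_itv; rewrite bnd_simp.
Qed.

Lemma ig_pt s f : ig s s f = 0.
Proof. by rewrite set_itv1 Rintegral_set1. Qed.

Lemma ig_cat s r t f : s <= r -> r <= t -> itgi s t f ->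
  ig s t f = ig s r f + ig r t f.
Proof.
move=> sr rt fi.
have H : itg `]r, t] f by apply: itgS fi => //; apply: subset_itvr; rewrite bnd_simp.
rewrite -(Rintegral_itv_obnd_cbnd H).
rewrite -(@Rintegral_itvB _ f (BLeft s) (BRight t) r fi) ?bnd_simp//; ring.
Qed.

Lemma mu_cc s t : s <= t -> mu `[s, t]%classic = (t - s)%:E.
Proof.
move=> st; rewrite lebesgue_measure_itv/= lte_fin.
by move: st; rewrite le_eqVlt => /predU1P[->|->]; rewrite ?ltxx ?subrr// EFinD.
Qed.

Lemma ig_cst s t k : s <= t -> ig s t (fun=> k) = k * (t - s).
Proof. by move=> st; rewrite Rintegral_cst//= mu_cc. Qed.

Lemma itgi_cst s t (k : R) : itgi s t (fun=> k).
Proof. by apply: itg_cst => //; exact: (@mu_itv_lty _ _ s t). Qed.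

Lemma ig_small a b f (e : R) : itgi a b f -> 0 < e ->
  exists2 d : R, 0 < d & forall s t, a <= s -> s <= t -> t <= b ->
    t - s < d -> ig s t (fun x => `|f x|) < e.
Proof.
move=> fi e0; have [//|d d0 H] := itg_small _ fi e0; exists d => // s t as_ st tb tsd.
apply: H => //; first by apply: subset_itv; rewrite bnd_simp.
by rewrite mu_cc// lte_fin.
Qed.

(** Continuity relative to [[a, b]], hence one-sided at the end points; [cntP] identifies it with
    the topological notion. The explicit radii are what the arguments with [cousin] consume. *)
Definition cnt a b f := forall x, a <= x <= b -> forall e : R, 0 < e ->
  exists2 d : R, 0 < d & forall y, a <= y <= b -> `|y - x| < d -> `|f y - f x| <= e.

Lemma cntP a b f : cnt a b f <-> {within `[a, b], continuous f}.
Proof.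
split.
  move=> fc; apply/subspace_continuousP => x; rewrite /= in_itv/= => xab.
  apply/cvgrPdist_le => /= e e0; have [d d0 H] := fc _ xab _ e0.
  rewrite near_withinE; apply/nbhs_ballP; exists d => //= y xy.
  rewrite /= in_itv/= => yab; rewrite /from_subspace/= distrC; apply: H => //.
  by rewrite distrC.
move=> /subspace_continuousP fc x xab e e0.
have /cvgrPdist_le/(_ _ e0) := fc x xab.
rewrite near_withinE => /nbhs_ballP[d /= d0 H].
exists d => // y yab yx; rewrite distrC; apply: H; last by rewrite /= in_itv.
by rewrite /ball/= distrC.
Qed.

Lemma cntS a b s t f : a <= s -> t <= b -> cnt a b f -> cnt s t f.
Proof.
move=> as_ tb fc x /andP[sx xt] e e0.
have [|d d0 H] := fc x _ e e0.
  by rewrite (le_trans as_)//= (le_trans xt).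
exists d => // y /andP[sy yt]; apply: H.
by rewrite (le_trans as_)//= (le_trans yt).
Qed.

Lemma cnt_measurable a b f : cnt a b f -> mfun_on `[a, b] f.
Proof. by move=> /cntP fc; apply: subspace_continuous_measurable_fun. Qed.

Lemma cnt_bounded a b f : cnt a b f ->
  exists M : R, forall x, a <= x <= b -> `|f x| <= M.
Proof.
move=> /cntP fc.
have /compact_bounded[M [_ H]] := continuous_compact fc (@segment_compact _ a b).
exists (M + 1) => x xab; apply: (H (M + 1)); first by rewrite ltrDl.
by exists x => //=; rewrite in_itv.
Qed.

Lemma cnt_itg a b f : cnt a b f -> itgi a b f.
Proof.
move=> /cntP fc; apply: continuous_compact_integrable => //.
exact: segment_compact.
Qed.

Lemma cntM_itg a b f g : cnt a b f -> itgi a b g -> itgi a b (fun x => f x * g x).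
Proof.
move=> fc gi; have [M H] := cnt_bounded fc.
apply: itgM gi => //; first exact: cnt_measurable.
by move=> x /=; rewrite in_itv/=; exact: H.
Qed.

Lemma cntD a b f g : cnt a b f -> cnt a b g -> cnt a b (fun x => f x + g x).
Proof.
move=> fc gc x xab e e0.
have e20 : 0 < e / 2 by rewrite divr_gt0.
have [d1 d10 H1] := fc x xab _ e20; have [d2 d20 H2] := gc x xab _ e20.
exists (Num.min d1 d2) => [|y yab]; first by rewrite lt_min d10.
rewrite lt_min => /andP[/(H1 _ yab) h1 /(H2 _ yab) h2].
rewrite (_ : _ - _ = (f y - f x) + (g y - g x)); last by ring.
by rewrite (le_trans (ler_normD _ _))// [leRHS]splitr lerD.
Qed.

Lemma cnt_cst a b k : cnt a b (fun=> k).
Proof. by move=> x _ e e0; exists 1 => // y _ _; rewrite subrr normr0 ltW. Qed.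

Lemma cntM a b f g : cnt a b f -> cnt a b g -> cnt a b (fun x => f x * g x).
Proof.
move=> fc gc x xab e e0.
have [M HM] := cnt_bounded fc; have [N HN] := cnt_bounded gc.
have M0 : 0 <= M by apply: le_trans (HM _ xab).
have N0 : 0 <= N by apply: le_trans (HN _ xab).
have K0 : 0 < M + N + 1 by rewrite ltr_wpDl// addr_ge0.
have e20 : 0 < e / (M + N + 1) by rewrite divr_gt0.
have [d1 d10 H1] := fc x xab _ e20; have [d2 d20 H2] := gc x xab _ e20.
exists (Num.min d1 d2) => [|y yab]; first by rewrite lt_min d10.
rewrite lt_min => /andP[/(H1 _ yab) h1 /(H2 _ yab) h2].
rewrite (_ : _ - _ = f y * (g y - g x) + (f y - f x) * g x); last by ring.
rewrite (le_trans (ler_normD _ _))// !normrM.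
apply: (@le_trans _ _ (M * (e / (M + N + 1)) + (e / (M + N + 1)) * N)).
  by rewrite lerD// ler_pM// ?HM ?HN.
rewrite mulrC -mulrDr -mulrA ler_piMr ?(ltW e0)//.
by rewrite mulrC ler_pdivrMr// mul1r lerDl.
Qed.

Lemma continuous_cnt a b f : continuous f -> cnt a b f.
Proof. by move=> fc; apply/cntP; exact: continuous_subspaceT. Qed.

Lemma cnt_comp a b f (F : R -> R) : cnt a b f ->
  (forall x, a <= x <= b -> {for f x, continuous F}) -> cnt a b (F \o f).
Proof.
move=> fc Fc x xab e e0.
have /cvgrPdist_le/(_ _ e0)/nbhs_ballP[d /= d0 H] := Fc x xab.
have [d' d'0 H'] := fc x xab (d / 2) (divr_gt0 d0 (ltr0n _ 2)).
exists d' => // y yab yx; rewrite distrC; apply: H; rewrite /ball/= distrC.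
by rewrite (le_lt_trans (H' _ yab yx))// ltr_pdivrMr// ltr_pMr// ltr1n.
Qed.

End IntervalIntegrals.

(** * Absolutely continuous functions: product and chain rule *)

Section Primitives.
Context {R : realType}.
Notation mu := (@lebesgue_measure R).
Implicit Types (a b s t r x : R) (f g h : R -> R).

Lemma igD s t f g : itgi s t f -> itgi s t g ->
  ig s t (fun x => f x + g x) = ig s t f + ig s t g.
Proof. by move=> fi gi; rewrite RintegralD. Qed.

Lemma igB s t f g : itgi s t f -> itgi s t g ->
  ig s t (fun x => f x - g x) = ig s t f - ig s t g.
Proof. by move=> fi gi; rewrite RintegralB. Qed.

Lemma igZ s t k f : itgi s t f -> ig s t (fun x => k * f x) = k * ig s t f.
Proof. by move=> fi; rewrite RintegralZl. Qed.

Lemma ig_le s t f g : itgi s t f -> itgi s t g ->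
  (forall x, s <= x <= t -> f x <= g x) -> ig s t f <= ig s t g.
Proof.
by move=> fi gi fg; apply: le_Rintegral => // x; rewrite /= in_itv/=; exact: fg.
Qed.

Lemma ig_norm s t f : itgi s t f -> `|ig s t f| <= ig s t (fun x => `|f x|).
Proof. by move=> fi; exact: le_normr_Rintegral. Qed.

Lemma ig_ge0 s t f : (forall x, s <= x <= t -> 0 <= f x) -> 0 <= ig s t f.
Proof. by move=> f0; apply: Rintegral_ge0 => x; rewrite /= in_itv/=; exact: f0. Qed.

Lemma eq_ig s t f g : (forall x, s <= x <= t -> f x = g x) -> ig s t f = ig s t g.
Proof.
by move=> fg; apply: eq_Rintegral => x; rewrite inE/= in_itv/=; exact: fg.
Qed.

Lemma eq_itgi s t f g : (forall x, s <= x <= t -> f x = g x) ->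
  itgi s t f -> itgi s t g.
Proof.
by move=> fg; apply: eq_itg => // x; rewrite /= in_itv/=; exact: fg.
Qed.

Lemma itgi_cat a c b f : a <= c -> c <= b ->
  itgi a c f -> itgi c b f -> itgi a b f.
Proof.
move=> ac cb f1 f2.
have E : `[a, b]%classic `<=` `[a, c]%classic `|` `[c, b]%classic.
  by move=> x /=; rewrite !in_itv/= => /andP[-> ->]; rewrite andbT/=;
    case: (leP x c) => [|/ltW]; [left|right].
by apply: itgS E _ => //; [exact: measurableU | exact: itgU].
Qed.

(** Absolute continuity with a prescribed density. It constrains [f] at every point of [[a, b]] but
    [g] only up to null sets: an H^1 class becomes a function with values at points and end points,
    while the density may be any version of the weak derivative. *)
Definition prim a b f g :=
  itgi a b g /\ forall s t, a <= s -> s <= t -> t <= b -> f t - f s = ig s t g.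

Lemma primS a b s t f g : a <= s -> t <= b -> prim a b f g -> prim s t f g.
Proof.
move=> sa tb [gi H]; split; first exact: itgiS gi.
by move=> p q sp pq qt; rewrite H// ?(le_trans sa)// (le_trans _ tb).
Qed.

Lemma prim_cat a c b f g : a <= c -> c <= b ->
  prim a c f g -> prim c b f g -> prim a b f g.
Proof.
move=> ac cb [gi1 H1] [gi2 H2]; have gi : itgi a b g by exact: itgi_cat gi1 gi2.
split=> // s t as_ st tb.
have [tc|/ltW ct] := leP t c; first exact: H1.
have [cs|/ltW sc] := leP c s; first exact: H2.
rewrite (@ig_cat _ _ c)//; last exact: itgiS gi.
by rewrite -H1// -H2//; ring.
Qed.

Lemma eq_prim a b f f' g g' : (forall x, a <= x <= b -> f x = f' x) ->
  (forall x, a <= x <= b -> g x = g' x) -> prim a b f g -> prim a b f' g'.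
Proof.
move=> ff gg [gi H]; split; first exact: eq_itgi gi.
move=> s t sa st tb; rewrite -!ff ?sa ?tb ?(le_trans sa st) ?(le_trans st tb)// H//.
by apply: eq_ig => x /andP[sx xt]; rewrite gg// (le_trans sa)//= (le_trans xt).
Qed.

Lemma prim_ae a b f g g' : mfun_on `[a, b] g' ->
  {ae mu, forall x, a <= x <= b -> g x = g' x} -> prim a b f g -> prim a b f g'.
Proof.
move=> mg gg [gi H]; split.
  exact: itg_ae_eq gi.
move=> s t sa st tb; rewrite H//.
have S : `[s, t] `<=` `[a, b] by apply: subset_itv; rewrite bnd_simp.
apply: Rintegral_ae_eq => //.
- by apply: itg_measurable => //; exact: itgiS gi.
- by apply: measurable_funS mg.
- apply: aeS gg => x + /=; rewrite ?in_itv/= => ggx /andP[sx xt].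
  by rewrite ggx// (le_trans sa)//= (le_trans xt).
Qed.

Lemma prim_cnt a b f g : prim a b f g -> cnt a b f.
Proof.
move=> [gi H] x /andP[ax xb] e e0.
have [d d0 D] := ig_small gi e0; exists d => // y /andP[ay yb] yx.
have [xy|/ltW yx'] := leP x y.
  rewrite H//; apply: (le_trans (ig_norm _)); first exact: itgiS gi.
  by apply/ltW/D => //; rewrite (le_lt_trans _ yx)// ler_norm.
rewrite distrC H//; apply: (le_trans (ig_norm _)); first exact: itgiS gi.
by apply/ltW/D => //; rewrite (le_lt_trans _ yx)// distrC ler_norm.
Qed.

Lemma prim_cst a b (k : R) : prim a b (fun=> k) (fun=> 0).
Proof.
split; first exact: itgi_cst.
by move=> s t _ st _; rewrite ig_cst// mul0r subrr.
Qed.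

Lemma prim_C1 a b (f f' : R -> R) : (forall x, a <= x <= b -> is_derive x 1 f (f' x)) ->
  cnt a b f' -> prim a b f f'.
Proof.
move=> df f'c; split; first exact: cnt_itg.
move=> s t as_; rewrite le_eqVlt => /predU1P[->|st] tb.
  by rewrite ig_pt subrr.
have df' x : s <= x <= t -> is_derive x 1 f (f' x).
  by move=> /andP[sx xt]; apply: df; rewrite (le_trans as_)//= (le_trans xt).
have fc : {in `[s, t], forall x, {for x, continuous f}}.
  move=> x; rewrite ?in_itv/= => /df' [dfx _].
  by apply: differentiable_continuous; apply/derivable1_diffP.
rewrite /Rintegral (@continuous_FTC2 _ f' f s t)//=.
- by apply/cntP; exact: cntS f'c.
- split.
  + by move=> x; rewrite ?in_itv/= => /andP[/ltW sx /ltW xt]; case: (df' x); rewrite ?sx.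
  + by apply: cvg_at_right_filter; apply: fc; rewrite ?in_itv/= lexx ltW.
  + by apply: cvg_at_left_filter; apply: fc; rewrite ?in_itv/= lexx ltW.
- move=> x; rewrite ?in_itv/= => /andP[/ltW sx /ltW xt].
  by case: (df' x); rewrite ?sx// derive1E.
Qed.

(* Tagging the Cousin partition at the point of linearisation makes pointwise
   differentiability enough for the chain rule. *)
Lemma prim_local a b f1 g1 f2 g2 h G1 G2 : a <= b ->
  prim a b f1 g1 -> prim a b f2 g2 -> cnt a b G1 -> cnt a b G2 ->
  (forall x, a <= x <= b -> forall e : R, 0 < e -> exists2 d : R, 0 < d &
     forall y, a <= y <= b -> `|y - x| < d ->
     `|h y - h x - G1 x * (f1 y - f1 x) - G2 x * (f2 y - f2 x)|
       <= e * (`|f1 y - f1 x| + `|f2 y - f2 x|)) ->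
  prim a b h (fun x => G1 x * g1 x + G2 x * g2 x).
Proof.
move=> ab [g1i P1] [g2i P2] G1c G2c lin.
pose k x := `|g1 x| + `|g2 x|.
have ki : itgi a b k by apply: itgD => //; exact: itg_norm.
have G1i : itgi a b (fun x => G1 x * g1 x) by exact: cntM_itg.
have G2i : itgi a b (fun x => G2 x * g2 x) by exact: cntM_itg.
have Gi : itgi a b (fun x => G1 x * g1 x + G2 x * g2 x) by exact: itgD.
split=> // s t as_ st tb.
(* The error is compared with the integral of [k], which is additive over adjacent intervals; the
   factor [e] is arbitrary, so the error is zero. *)
suff H (e : R) : 0 < e ->
    `|h t - h s - ig s t (fun x => G1 x * g1 x + G2 x * g2 x)| <= e * ig s t k.
  apply/eqP; rewrite -subr_eq0 -normr_le0; apply/ler_addgt0Pr => e e0.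
  have k0 : 0 <= ig s t k by apply: ig_ge0 => x _; exact: addr_ge0.
  have k1 : 0 < ig s t k + 1 by rewrite ltr_wpDl.
  rewrite add0r (le_trans (H (e / (ig s t k + 1)) _)) ?divr_gt0//.
  by rewrite mulrAC ler_pdivrMr// ler_wpM2l ?(ltW e0)// lerDl.
move=> e0.
have S f p q : s <= p -> q <= t -> itgi a b f -> itgi p q f.
  by move=> sp qt; apply: itgiS; [exact: le_trans sp|exact: le_trans tb].
pose P p q := `|h q - h p - ig p q (fun x => G1 x * g1 x + G2 x * g2 x)|
  <= e * ig p q k.
have loc x : s <= x <= t -> exists2 d : R, 0 < d & forall p q, s <= p -> p <= q ->
    q <= t -> p = x \/ q = x -> q - p < d -> P p q.
  move=> /andP[sx xt]; have e2 : 0 < e / 2 by exact: divr_gt0.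
  have xab : a <= x <= b by rewrite (le_trans as_)//= (le_trans xt).
  have [d0 d00 D0] := lin x xab _ e2.
  have [d1 d10 D1] := G1c x xab _ e2.
  have [d2 d20 D2] := G2c x xab _ e2.
  exists (Num.min d0 (Num.min d1 d2)); first by rewrite !lt_min d00 d10.
  move=> p q sp pq qt pqx; rewrite !lt_min => /and3P[qpd0 qpd1 qpd2].
  have ap : a <= p by exact: le_trans sp.
  have qb : q <= b by exact: le_trans tb.
  have near y : p <= y <= q -> `|y - x| <= q - p.
    by move=> /andP[py yq]; rewrite ler_norml; case: pqx => <-; lra.
  have Sb y : p <= y <= q -> a <= y <= b.
    by move=> /andP[py yq]; rewrite (le_trans ap)//= (le_trans yq).
  have A : `|h q - h p - G1 x * (f1 q - f1 p) - G2 x * (f2 q - f2 p)|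
      <= e / 2 * (`|f1 q - f1 p| + `|f2 q - f2 p|).
    have pab : a <= p <= b by apply: Sb; rewrite lexx.
    have qab : a <= q <= b by apply: Sb; rewrite lexx pq.
    case: pqx => E.
      rewrite E; apply: D0 => //.
      by apply: le_lt_trans qpd0; apply: near; rewrite lexx pq.
    rewrite E (_ : h x - h p - G1 x * (f1 x - f1 p) - G2 x * (f2 x - f2 p) =
      - (h p - h x - G1 x * (f1 p - f1 x) - G2 x * (f2 p - f2 x))); last by ring.
    rewrite normrN (distrC (f1 x)) (distrC (f2 x)); apply: D0 => //.
    by apply: le_lt_trans qpd0; apply: near; rewrite lexx pq.
  (* Freezing the coefficients at the tag [x] costs half of the allowed error, by continuity of [G1]
     and [G2]; the linearisation takes the other half. *)
  have B y : p <= y <= q -> `|(G1 x - G1 y) * g1 y + (G2 x - G2 y) * g2 y| <= e / 2 * k y.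
    move=> ypq; have yx := near y ypq.
    rewrite mulrDr (le_trans (ler_normD _ _))// !normrM lerD// ler_wpM2r//.
      by rewrite distrC; apply: D1; [exact: Sb|exact: le_lt_trans qpd1].
    by rewrite distrC; apply: D2; [exact: Sb|exact: le_lt_trans qpd2].
  have Gxi : itgi p q (fun y => G1 x * g1 y + G2 x * g2 y).
    by apply: itgD => //; apply: itgZ => //; apply: S.
  rewrite /P; have -> : h q - h p - ig p q (fun y => G1 y * g1 y + G2 y * g2 y) =
      (h q - h p - G1 x * (f1 q - f1 p) - G2 x * (f2 q - f2 p)) +
      ig p q (fun y => (G1 x - G1 y) * g1 y + (G2 x - G2 y) * g2 y).
    have g1pq := S _ _ _ sp qt g1i; have g2pq := S _ _ _ sp qt g2i.
    rewrite (@eq_ig _ _ (fun y => (G1 x - G1 y) * g1 y + _) (fun y =>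
      (G1 x * g1 y + G2 x * g2 y) - (G1 y * g1 y + G2 y * g2 y))); last by move=> y _; ring.
    rewrite igB//; last exact: S.
    rewrite [X in _ = _ + (X - _)]igD; try exact: itgZ.
    by rewrite !igZ// P1// P2//; ring.
  have ki' : itgi p q k by exact: S.
  have Gi' : itgi p q (fun y => (G1 x - G1 y) * g1 y + (G2 x - G2 y) * g2 y).
    apply: eq_itgi (itgB _ Gxi (S _ _ _ sp qt Gi)) => // y _; ring.
  rewrite (le_trans (ler_normD _ _))// (splitr e) mulrDl lerD//.
    rewrite (le_trans A)// ler_wpM2l ?(ltW e2)//.
    have -> : ig p q k = ig p q (fun y => `|g1 y|) + ig p q (fun y => `|g2 y|).
      by apply: igD; apply: itg_norm => //; exact: S.
    by rewrite P1// P2//; apply: lerD; apply: ig_norm; exact: S.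
  rewrite (le_trans (ig_norm _))// -igZ//; apply: ig_le => //; first exact: itg_norm.
  exact: itgZ.
apply: (cousin st (P := P)).
  move=> p r q sp pr rq qt.
  have kpq : itgi p q k by exact: S.
  have Gpq : itgi p q (fun x => G1 x * g1 x + G2 x * g2 x) by exact: S.
  rewrite /P (ig_cat pr rq)// [ig p q k](ig_cat pr rq)// mulrDr => H1 H2.
  rewrite (le_trans _ (lerD H1 H2))// (le_trans _ (ler_normD _ _))//.
  rewrite le_eqVlt; apply/orP; left; apply/eqP; congr (`| _ |); ring.
move=> x sxt; have [d d0 D] := loc x sxt; move: sxt => /andP[sx xt].
exists d => //; split => [y /andP[xy yx] yt|y /andP[yx xy] sy].
  by apply: D => //; [left|rewrite ltrBlDl].
by apply: D => //; [right|rewrite ltrBlDr -ltrBlDl].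
Qed.

Lemma primD a b f1 g1 f2 g2 : prim a b f1 g1 -> prim a b f2 g2 ->
  prim a b (fun x => f1 x + f2 x) (fun x => g1 x + g2 x).
Proof.
move=> [g1i P1] [g2i P2]; split; first exact: itgD.
move=> s t sa st tb; rewrite igD; [|exact: itgiS sa tb g1i|exact: itgiS sa tb g2i].
by rewrite -P1// -P2//; ring.
Qed.

Lemma primZ a b k f g : prim a b f g -> prim a b (fun x => k * f x) (fun x => k * g x).
Proof.
move=> [gi P]; split; first exact: itgZ.
by move=> s t sa st tb; rewrite igZ -?P//; [ring|exact: itgiS sa tb gi].
Qed.

(** The linearisation error of a product is exactly the product of the two increments, and
    continuity of [f2] makes it small compared with the increment of [f1]. *)
Lemma primM a b f1 g1 f2 g2 : a <= b -> prim a b f1 g1 -> prim a b f2 g2 ->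
  prim a b (fun x => f1 x * f2 x) (fun x => f2 x * g1 x + f1 x * g2 x).
Proof.
move=> ab p1 p2; have c1 := prim_cnt p1; have c2 := prim_cnt p2.
apply: (prim_local ab p1 p2) => // x xab e e0.
have [d d0 D] := c2 x xab e e0; exists d => // y yab /(D _ yab) H.
rewrite (_ : _ - _ = (f1 y - f1 x) * (f2 y - f2 x)); last by ring.
rewrite normrM mulrC mulrDr (le_trans (ler_wpM2r _ H))// lerDl.
by rewrite mulr_ge0// ltW.
Qed.

(** Division-free form of differentiability, ready to be matched with the hypothesis of [prim_local]
    and easy to restrict to a neighbourhood. *)
Lemma is_derive_linear_approx (F : R -> R) (y l : R) : is_derive y 1 F l <->
  forall e : R, 0 < e -> exists2 d : R, 0 < d &
    forall z, `|z - y| < d -> `|F z - F y - l * (z - y)| <= e * `|z - y|.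
Proof.
have E (h : R) : h != 0 -> l - h^-1 *: ((F \o shift y) (h *: 1) - F y) =
    - (h^-1 * (F (h + y) - F y - l * h)).
  by move=> h0; rewrite /= [h *: 1]mulr1 /GRing.scale/=; field.
split=> [[dF DF] e e0|H].
  have : h^-1 *: ((F \o shift y) (h *: 1) - F y) @[h --> 0^'] --> l by rewrite -DF.
  move=> /cvgrPdist_le/(_ _ e0)/nbhs_ballP[d /= d0 D].
  exists d => // z zy; have [->|zy0] := eqVneq z y.
    by rewrite !subrr mulr0 subrr normr0 mulr0.
  have h0 : z - y != 0 by rewrite subr_eq0.
  have := D (z - y); rewrite /ball/= sub0r normrN => /(_ zy h0).
  rewrite E// subrK normrN normrM normfV.
  by rewrite ler_pdivrMl ?normr_gt0// [e * _]mulrC.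
have C : h^-1 *: ((F \o shift y) (h *: 1) - F y) @[h --> 0^'] --> l.
  apply/cvgrPdist_le => /= e e0; have [d d0 D] := H _ e0.
  apply/nbhs_ballP; exists d => //= h; rewrite /ball/= sub0r normrN => hd h0.
  rewrite E// normrN normrM normfV ler_pdivrMl ?normr_gt0// [_ * e]mulrC.
  by have := D (h + y); rewrite addrK; apply.
split; first by apply/cvg_ex; exists l.
exact/cvg_lim.
Qed.

Lemma prim_comp a b f g (F F' : R -> R) : a <= b -> prim a b f g ->
  (forall x, a <= x <= b -> is_derive (f x) 1 F (F' (f x))) ->
  cnt a b (F' \o f) ->
  prim a b (F \o f) (fun x => F' (f x) * g x).
Proof.
move=> ab p dF F'c; have c := prim_cnt p.
(* [prim_local] speaks of two functions; the second slot is filled with the zero function, which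
   contributes nothing. *)
have : prim a b (F \o f) (fun x => (F' \o f) x * g x + (fun=> 0) x * 0).
  apply: (prim_local ab p (prim_cst a b 0)) => //; first exact: cnt_cst.
  move=> x xab e e0.
  have /is_derive_linear_approx/(_ e e0)[d d0 D] := dF x xab.
  have [d' d'0 D'] := c x xab (d / 2) (divr_gt0 d0 (ltr0n _ 2)).
  exists d' => // y yab /(D' _ yab) H; rewrite subrr mulr0 subr0 normr0 addr0.
  by apply: D; rewrite (le_lt_trans H)// ltr_pdivrMr// ltr_pMr// ltr1n.
by apply: eq_prim => // x _ /=; rewrite mulr0 addr0.
Qed.

End Primitives.

(** * Almost everywhere differentiation of primitives *)

Section Differentiation.
Context {R : realType}.
Notation mu := (@lebesgue_measure R).
Implicit Types (a b s t r x : R) (f g h : R -> R).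

Lemma ig_oo a b f : itgi a b f -> \int[mu]_(x in `]a, b[) f x = ig a b f.
Proof.
move=> fi; rewrite /Rintegral [in RHS]integral_itv_bndoo//.
have fo : itg `]a, b[ f by apply: itgS fi => //; apply: subset_itv; rewrite bnd_simp.
by apply/measurable_EFinP; exact: itg_measurable fo.
Qed.

Lemma itg_oo a b f : itg `]a, b[ f -> itgi a b f.
Proof.
(* For [b <= a] the closed interval is contained in the point [b], a null set; otherwise only the
   two end points are added. *)
move=> fi; have [ab|ba] := ltP a b; last first.
  apply: (@itgS _ _ [set b]) => //.
  - move=> x /=; rewrite in_itv/= => /andP[ax xb]; apply/eqP; rewrite eq_le xb.
    by rewrite (le_trans ba).
  - by apply: (@itg_bounded _ _ _ `|f b|) => //;
      [rewrite lebesgue_measure_set1 ltry|exact: measurable_fun_set1|move=> x ->].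
have S c : itg [set c] f.
  apply: (@itg_bounded _ _ _ `|f c|) => //; last by move=> x ->.
  - by rewrite lebesgue_measure_set1 ltry.
  - exact: measurable_fun_set1.
have : itg (`]a, b[%classic `|` ([set a] `|` [set b])) f.
  by apply: itgU => //; [exact: measurableU|exact: itgU].
apply: itgS => //; first by apply: measurableU => //; exact: measurableU.
move=> x /=; rewrite !in_itv/= !le_eqVlt => /andP[/orP[/eqP ->|ax] /orP[/eqP ->|xb]].
- by right; left.
- by right; left.
- by right; right.
- by left; rewrite ax.
Qed.

Lemma ae_ex a b (P : R -> Prop) : a < b -> {ae mu, forall x, P x} ->
  exists x, a < x < b /\ P x.
Proof.
move=> ab aP; apply: contrapT => nex.
case: aP => N [mN N0 sN].
have : (mu `]a, b[ <= mu N)%E.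
  apply: le_measure; rewrite ?inE// => x /= xab; apply: sN => /= Px.
  by apply: nex; exists x; split=> //; move: xab; rewrite in_itv.
by rewrite N0 lebesgue_measure_itv/= lte_fin ab -EFinD lee_fin subr_le0 leNgt ab.
Qed.

(** Lebesgue differentiation. The density is extended by zero to the line, where the primitive from
    minus infinity differs from [f] by a constant on [[a, b]]. *)
Lemma prim_derive a b f g : prim a b f g ->
  {ae mu, forall x, a < x < b -> is_derive x 1 f (g x)}.
Proof.
move=> [gi H]; pose g' := g \_ `[a, b].
have g'i : itg [set: R] g'.
  by rewrite /itg -restrict_EFin; apply/integrable_restrict => //=; rewrite setTI.
have g'y y : mu.-integrable `]-oo, y] (EFin \o g') by exact: itgS g'i.
have loc : locally_integrable [set: R] g'.
  by apply: open_integrable_locally => //; exact: openT.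
have := FTC1Ny g'y loc; pose F x := \int[mu]_(t in `]-oo, x]) g' t.
have FE y : a <= y <= b -> F y = ig a y g.
  move=> /andP[ay yb]; rewrite /F (@Rintegral_sub0 _ `[a, y])//; last 2 first.
  - by apply: subset_itvr; rewrite bnd_simp.
  - move=> x /=; rewrite !in_itv/= => xy /negP; rewrite xy andbT -ltNge => xa.
    rewrite /g' patchE; case: ifPn => //; rewrite inE/= in_itv/= => /andP[].
    by rewrite leNgt xa.
  apply: eq_ig => x /andP[ax xy]; rewrite /g' patchE mem_set//= in_itv/= ax.
  exact: le_trans yb.
apply: aeS => x; rewrite -/F => -[dF DF] /andP[ax xb].
have g'x : g' x = g x by rewrite /g' patchE mem_set//= in_itv/= !ltW.
have : is_derive x 1 F (g x).
  by split=> //; rewrite -g'x -DF derive1E.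
move=> /is_derive_linear_approx D; apply/is_derive_linear_approx => e e0.
have [d d0 {}D] := D e e0.
exists (Num.min d (Num.min (x - a) (b - x))).
  by rewrite !lt_min d0 !subr_gt0 ax.
move=> z; rewrite !lt_min => /and3P[zd zx1 zx2].
have az : a <= z.
  by move: zx1; rewrite ltr_norml => /andP[+ _]; lra.
have zb : z <= b.
  by move: zx2; rewrite ltr_norml => /andP[_]; lra.
have := D z zd; rewrite !FE ?az// ?(ltW ax) ?(ltW xb)//.
rewrite -!H ?(ltW ax) ?(ltW xb)//.
by rewrite (_ : f z - f a - (f x - f a) = f z - f x)//; ring.
Qed.

Lemma is_derive_unique f x (l l' : R) :
  is_derive x 1 f l -> is_derive x 1 f l' -> l = l'.
Proof. by move=> [_ <-] [_ <-]. Qed.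

Lemma prim_inj a b f g g' : prim a b f g -> prim a b f g' ->
  {ae mu, forall x, a < x < b -> g x = g' x}.
Proof.
move=> /prim_derive p /prim_derive; apply: aeS2 p => x H H' xab.
exact: is_derive_unique (H xab) (H' xab).
Qed.

(** The measure-theoretic half of the du Bois-Reymond lemma. Equal window integrals give equal
    difference quotients of the primitive [K] at any two points, hence equal derivatives, and these
    are almost everywhere the values of [k]. *)
Lemma ae_cst_of_shift a b k : a < b -> itgi a b k ->
  (forall s s' d, a < s -> a < s' -> 0 < d -> s + d < b -> s' + d < b ->
     ig s (s + d) k = ig s' (s' + d) k) ->
  exists c, {ae mu, forall x, a < x < b -> k x = c}.
Proof.
move=> ab ki H; pose K x := ig a x k.
have pK : prim a b K k.
  split=> // s t as_ st tb; rewrite /K (@ig_cat _ _ s t)//; first by rewrite addrAC subrr add0r.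
  exact: itgiS ki.
have dK := prim_derive pK.
have [s0 [s0ab /(_ s0ab) D0]] := ae_ex ab dK.
exists (k s0); apply: aeS dK => s D sab; move/(_ sab) : D => D.
apply/eqP; rewrite -subr_eq0 -normr_le0; apply/ler_addgt0Pr => e e0; rewrite add0r.
have e2 : 0 < e / 2 by exact: divr_gt0.
have /is_derive_linear_approx/(_ _ e2)[d1 d10 D1] := D.
have /is_derive_linear_approx/(_ _ e2)[d2 d20 D2] := D0.
move/andP: sab => [as_ sb]; move/andP: s0ab => [as0 s0b].
(* A window length within both radii of differentiability and short enough for both windows to end
   before [b]; halving the minimum makes the inequalities strict. *)
pose d := Num.min (Num.min d1 d2) (Num.min (b - s) (b - s0)) / 2.
have m0 : 0 < Num.min (Num.min d1 d2) (Num.min (b - s) (b - s0)).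
  by rewrite !lt_min d10 d20 !subr_gt0 sb.
have d0 : 0 < d by exact: divr_gt0.
have : d < Num.min (Num.min d1 d2) (Num.min (b - s) (b - s0)).
  by rewrite /d ltr_pdivrMr// ltr_pMr// ltr1n.
rewrite !lt_min => /andP[/andP[dd1 dd2] /andP[ds ds0]].
have := D1 (s + d); have := D2 (s0 + d).
rewrite ![_ + d - _]addrAC !subrr !add0r gtr0_norm// => /(_ dd2) A2 /(_ dd1) A1.
have KE u : a < u -> d < b - u -> K (u + d) - K u = ig u (u + d) k.
  by move=> au du; case: pK => _ -> //; rewrite ?lerDl ltW//; lra.
have [sd s0d] : s + d < b /\ s0 + d < b by split; lra.
move: A1 A2; rewrite (KE s as_ ds) (KE s0 as0 ds0).
rewrite (H s s0 d as_ as0 d0 sd s0d).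
set I := ig _ _ _ => A1 A2.
rewrite -(ler_pM2r d0) -{1}(gtr0_norm d0) -normrM.
rewrite (_ : _ * d = (I - k s0 * d) - (I - k s * d)); last by ring.
rewrite (le_trans (ler_normB _ _))// [in leRHS](splitr e) mulrDl.
by rewrite lerD.
Qed.

End Differentiation.

(** * Test functions and weak derivatives *)

Section TestFunctions.
Context {R : realType}.
Notation mu := (@lebesgue_measure R).
Implicit Types (a b s t r x d : R) (f g h phi : R -> R).

(** A point outside [D] has positive distance to the closed support, so the function and its
    derivative vanish on a whole neighbourhood of it. This makes boundary points and removed jump
    points harmless. *)
Lemma test_funE (D : set R) phi : test_fun D phi ->
  [/\ forall x, is_derive x 1 phi (derive1 phi x), continuous phi,
      forall x, ~ D x -> exists2 d, 0 < d &
        forall y, `|y - x| < d -> phi y = 0 /\ derive1 phi y = 0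
    & continuous (derive1 phi)].
Proof.
move=> [dphi cphi _ suppD].
split=> //.
- by move=> x; split=> //; rewrite derive1E.
- by move=> x; apply: differentiable_continuous; exact/derivable1_diffP.
- move=> x nDx; have : ~ closure [set x | phi x != 0] x by move=> /suppD.
  move=> /existsNP[B /not_implyP[/nbhs_ballP[d /= d0 dB] BS]].
  have phi0 y : `|y - x| < d -> phi y = 0.
    move=> yx; apply/eqP/negPn/negP => phiy; apply: BS; exists y; split=> //.
    by apply: dB; rewrite /ball/= distrC.
  exists d => // y yx; split; first exact: phi0.
  rewrite derive1E; suff [_ ->] : is_derive y 1 phi 0 by [].
  apply/is_derive_linear_approx => e e0; exists (d - `|y - x|); first by rewrite subr_gt0.
  move=> z zy; rewrite !phi0//; last first.
    rewrite (_ : z - x = (z - y) + (y - x)); last by ring.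
    by rewrite (le_lt_trans (ler_normD _ _))// -ltrBrDr.
  by rewrite mul0r !subr0 normr0 mulr_ge0// ltW.
Qed.

Lemma test_fun_supp (D : set R) (m M : R) phi phi' :
  (forall x, is_derive x 1 phi (phi' x)) -> continuous phi' ->
  (forall x, ~ (m <= x <= M) -> phi x = 0) -> `[m, M] `<=` D -> test_fun D phi.
Proof.
move=> dphi cphi' phi0 mMD.
have E : derive1 phi = phi' by apply/funext => x; rewrite derive1E; case: (dphi x).
have S : closure [set x | phi x != 0] `<=` `[m, M].
  have /closure_id -> : closed `[m, M]%classic by exact: itv_closed.
  apply: closure_subset => x /= px; rewrite in_itv/=; apply: contrapT => nx.
  by move/eqP: px; apply; exact: phi0.
split=> //.
- by rewrite E.
- by apply: subclosed_compact S; [exact: closed_closure|exact: segment_compact].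
- exact: subset_trans mMD.
Qed.

(** The positive part and, below, its primitive [max(x, 0)^2 / 2]. Test functions need only be C^1,
    so quadratic splines built from these suffice. *)
Definition relu x : R := (x + `|x|) / 2.
Definition qrelu x : R := (x ^+ 2 + x * `|x|) / 4.

Lemma reluP x : (0 <= x /\ relu x = x) \/ (x <= 0 /\ relu x = 0).
Proof.
rewrite /relu; have [x0|x0] := leP 0 x; [left|right].
  by rewrite ger0_norm//; split=> //; field.
by rewrite ltr0_norm// subrr mul0r ltW.
Qed.

Lemma qrelu_le0 x : x <= 0 -> qrelu x = 0.
Proof. by move=> x0; rewrite /qrelu ler0_norm//; ring. Qed.

Lemma qrelu_ge0 x : 0 <= x -> qrelu x = x ^+ 2 / 2.
Proof. by move=> x0; rewrite /qrelu ger0_norm//; field. Qed.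

Lemma lipschitz_continuous f (K : R) : (forall x y, `|f y - f x| <= K * `|y - x|) ->
  continuous f.
Proof.
move=> lip x; apply/cvgrPdist_le => /= e e0.
apply/nbhs_ballP; exists (e / (`|K| + 1)) => /=; first by rewrite divr_gt0// ltr_wpDl.
move=> y; rewrite /ball/= distrC => yx; rewrite distrC (le_trans (lip x y))//.
apply: (@le_trans _ _ ((`|K| + 1) * `|y - x|)).
  by rewrite ler_wpM2r// (le_trans (ler_norm _))// lerDl.
by rewrite mulrC -ler_pdivlMr ?ltW// ltr_wpDl.
Qed.

Lemma relu_lip x y : `|relu y - relu x| <= `|y - x|.
Proof.
have [H|H] := leP 0 (y - x); [rewrite (ger0_norm H)|rewrite (ltr0_norm H)];
  rewrite ler_norml;
  by case: (reluP x) => -[? ->]; case: (reluP y) => -[? ->]; apply/andP; split; lra.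
Qed.

Lemma qrelu_derive x : is_derive x 1 qrelu (relu x).
Proof.
apply/is_derive_linear_approx => e e0; exists e => // z zx.
apply: (@le_trans _ _ (`|z - x| * `|z - x|)); last by rewrite ler_wpM2r// ltW.
rewrite -normrM -expr2 [X in _ <= X]ger0_norm ?sqr_ge0// ler_norml.
have P y : (0 <= y /\ (relu y = y /\ qrelu y = y ^+ 2 / 2)) \/
    (y <= 0 /\ (relu y = 0 /\ qrelu y = 0)).
  rewrite /relu /qrelu; have [y0|y0] := leP 0 y; [left|right].
    by rewrite ger0_norm//; do !split => //; field.
  by rewrite ltr0_norm// subrr mul0r ltW//; do !split => //; ring.
have S := sqr_ge0 (z - x); have Sz := sqr_ge0 z; have Sx := sqr_ge0 x.
case: (P z) => -[z0 [_ ->]]; case: (P x) => -[x0 [-> ->]].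
- by rewrite (_ : _ / 2 - _ - _ = (z - x) ^+ 2 / 2); [apply/andP; split; lra|field].
- by have := mulr_ge0_le0 z0 x0 => ?; apply/andP; split; lra.
- by have := mulr_le0_ge0 z0 x0 => ?; apply/andP; split; lra.
- by apply/andP; split; lra.
Qed.

(* The trapezoid equal to 1 on [0, d] and to 0 off [-h, d + h], and its
   primitive; both are second differences. *)
Definition trap (h d x : R) : R :=
  (relu (x + h) - relu x - relu (x - d) + relu (x - d - h)) / h.
Definition ramp (h d x : R) : R :=
  (qrelu (x + h) - qrelu x - qrelu (x - d) + qrelu (x - d - h)) / h.

Lemma trap_ge0_le1 (h d x : R) : 0 < h -> 0 < d -> 0 <= trap h d x <= 1.
Proof.
move=> h0 d0; rewrite /trap divr_ge0 ?(ltW h0)//= ?ler_pdivrMr// ?mul1r;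
by case: (reluP (x + h)) => -[? ->]; case: (reluP x) => -[? ->];
   case: (reluP (x - d)) => -[? ->]; case: (reluP (x - d - h)) => -[? ->]; lra.
Qed.

Lemma trap_eq1 (h d x : R) : 0 < h -> 0 <= x <= d -> trap h d x = 1.
Proof.
move=> h0 /andP[x0 xd]; rewrite /trap (_ : _ + relu (x - d - h) = h) ?divff ?gt_eqF//.
by case: (reluP (x + h)) => -[? ->]; case: (reluP x) => -[? ->];
   case: (reluP (x - d)) => -[? ->]; case: (reluP (x - d - h)) => -[? ->]; lra.
Qed.

Lemma trap_eq0 (h d x : R) : 0 < h -> 0 < d -> x <= - h \/ d + h <= x -> trap h d x = 0.
Proof.
move=> h0 d0 H; rewrite /trap (_ : _ + relu (x - d - h) = 0) ?mul0r//.
by case: H => H;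
   case: (reluP (x + h)) => -[? ->]; case: (reluP x) => -[? ->];
   case: (reluP (x - d)) => -[? ->]; case: (reluP (x - d - h)) => -[? ->]; lra.
Qed.

Lemma trap_lip (h d x y : R) : 0 < h -> `|trap h d y - trap h d x| <= 4 / h * `|y - x|.
Proof.
move=> h0.
rewrite /trap -mulrBl normrM mulrAC [X in _ * X]gtr0_norm ?invr_gt0// ler_pM2r ?invr_gt0//.
have L c : `|relu (y + c) - relu (x + c)| <= `|y - x|.
  by rewrite (le_trans (relu_lip _ _))// (_ : y + c - (x + c) = y - x)//; ring.
have := L h; have := L 0; have := L (- d); have := L (- d - h); rewrite !addr0 !addrA.
rewrite !ler_norml => /andP[? ?] /andP[? ?] /andP[? ?] /andP[? ?].
by apply/andP; split; lra.
Qed.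

Lemma ramp_left (h d x : R) : 0 < h -> 0 < d -> x <= - h -> ramp h d x = 0.
Proof.
move=> h0 d0 H; rewrite /ramp (_ : _ + qrelu (x - d - h) = 0) ?mul0r//.
by rewrite !qrelu_le0; [ring|lra..].
Qed.

Lemma ramp_right (h d x : R) : 0 < h -> 0 < d -> d + h <= x -> ramp h d x = d + h.
Proof.
move=> h0 d0 H; rewrite /ramp (_ : _ + qrelu (x - d - h) = (d + h) * h) ?mulfK ?gt_eqF//.
by rewrite !qrelu_ge0; [field|lra..].
Qed.

Lemma is_derive_shift f (f' c x : R) : is_derive (x + c) 1 f f' ->
  is_derive x 1 (fun y => f (y + c)) f'.
Proof.
move=> /is_derive_linear_approx D; apply/is_derive_linear_approx => e e0.
have [d d0 {}D] := D e e0; exists d => // z zx.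
have E : z + c - (x + c) = z - x by ring.
by have := D (z + c); rewrite E; exact.
Qed.

Lemma ramp_derive (h d x : R) : is_derive x 1 (ramp h d) (trap h d x).
Proof.
have Q (c y : R) : is_derive y 1 (fun z => qrelu (z + c)) (relu (y + c)).
  exact/is_derive_shift/qrelu_derive.
have Q' (y : R) : is_derive y 1 (fun z => qrelu (z - d - h)) (relu (y - d - h)).
  have -> : (fun z => qrelu (z - d - h)) = (fun z => qrelu (z + (- d - h))).
    by apply/funext => z; rewrite addrA.
  by rewrite -addrA; exact: Q.
have := is_deriveM (is_deriveD (is_deriveB (is_deriveB (Q h x) (qrelu_derive x)) (Q (- d) x)) (Q' x)) (is_derive_cst h^-1 x 1).
rewrite /trap; set l := (X in is_derive _ _ _ X -> _).
suff -> : l = trap h d x by [].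
by rewrite /l /trap /GRing.scale/=; ring.
Qed.

End TestFunctions.

(** * Square-integrable functions and the Cauchy-Schwarz inequality *)

Section SquareIntegrable.
Context {R : realType}.
Notation mu := (@lebesgue_measure R).
Implicit Types (D E : set R) (f g h : R -> R).

Lemma sqr_normr (x : R) : `|x| ^+ 2 = x ^+ 2.
Proof. by rewrite real_normK ?num_real. Qed.

Definition sqint D f := mfun_on D f /\ itg D (fun x => f x ^+ 2).

Lemma L2P D f : mset D -> L2 D f <-> sqint D f.
Proof.
move=> mD; rewrite /L2; split.
  move=> /[dup] /Lfun2_integrable_sqr fi; rewrite inE => /andP[/[!inE]/= mf _].
  split.
    by apply/(measurable_restrictT _ mD).
  have : mu.-integrable setT ((EFin \o (fun x => f x ^+ 2)) \_ D).
    apply: eq_integrable fi => // x _ /=; rewrite !patchE.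
    by case: ifPn => // _; rewrite expr0n.
  by move/integrable_restrict => -/(_ mD measurableT); rewrite setTI.
move=> [mf fi].
have fi' : itg setT (fun x => ((f \_ D) x) ^+ 2).
  have fi1 : itg D (fun x => ((f \_ D) x) ^+ 2).
    by apply: eq_itg fi => // x Dx; rewrite patchE mem_set.
  apply: itg_sub0 fi1 => // x _ nD.
  by rewrite patchE; case: ifPn => [/set_mem//|_]; rewrite expr0n.
rewrite inE; apply/andP; split; rewrite inE/=.
  by apply/(measurable_restrictT _ mD).
rewrite /finite_norm unlock /Lnorm poweR_lty//.
move/integrableP : fi' => [_]; apply: le_lt_trans.
rewrite le_eqVlt; apply/orP; left; apply/eqP; apply: eq_integral => x _ /=.
by rewrite powR_mulrn// -normrX.
Qed.

Lemma sqint_itgM D f g : mset D -> sqint D f -> sqint D g ->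
  itg D (fun x => f x * g x).
Proof.
move=> mD [mf fi] [mg gi].
apply: (@itg_le _ _ _ (fun x => f x ^+ 2 + g x ^+ 2)) => //.
- exact: measurable_funM.
- move=> x _; rewrite normrM -(sqr_normr (f x)) -(sqr_normr (g x)).
  have := sqr_ge0 (`|f x| - `|g x|); have := sqr_ge0 `|f x|; have := sqr_ge0 `|g x|.
  by move=> ? ? ?; lra.
- exact: itgD.
Qed.

Lemma sqintD D f g : mset D -> sqint D f -> sqint D g -> sqint D (fun x => f x + g x).
Proof.
move=> mD sf sg; have fgi := sqint_itgM mD sf sg.
case: sf sg => [mf fi] [mg gi]; split; first exact: measurable_funD.
apply: (@eq_itg _ _ (fun x => (f x ^+ 2 + 2 * (f x * g x)) + g x ^+ 2)) => //.
  by move=> x _; ring.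
by apply: itgD => //; apply: itgD => //; exact: itgZ.
Qed.

Lemma sqintM D f g (M : R) : mset D -> mfun_on D f ->
  (forall x, D x -> `|f x| <= M) -> sqint D g -> sqint D (fun x => f x * g x).
Proof.
move=> mD mf fM [mg gi]; split; first exact: measurable_funM.
apply: (@eq_itg _ _ (fun x => f x ^+ 2 * g x ^+ 2)) => // [x _|].
  by rewrite exprMn.
apply: (@itgM _ _ _ _ (M ^+ 2)) => //; first exact: measurable_funX.
by move=> x Dx; rewrite normrX lerXn2r ?nnegrE ?fM// (le_trans _ (fM x Dx)).
Qed.

Lemma sqintZ D k f : mset D -> sqint D f -> sqint D (fun x => k * f x).
Proof. by move=> mD; apply: (@sqintM _ _ _ `|k|). Qed.

Lemma sqintN D f : mset D -> sqint D f -> sqint D (fun x => - f x).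
Proof.
move=> mD sf; have [m i] := sqintZ (-1) mD sf; split.
  by apply: eq_measurable_fun m => x _; rewrite mulN1r.
by apply: eq_itg i => // x _; rewrite mulN1r.
Qed.

Lemma sqintB D f g : mset D -> sqint D f -> sqint D g -> sqint D (fun x => f x - g x).
Proof. by move=> mD sf sg; apply: sqintD => //; exact: sqintN. Qed.

Lemma sqintS D E f : mset D -> mset E -> D `<=` E -> sqint E f -> sqint D f.
Proof.
move=> mD mE DE [mf fi]; split; first exact: measurable_funS mf.
exact: itgS fi.
Qed.

Lemma eq_sqint D f g : mset D -> (forall x, D x -> f x = g x) -> sqint D f -> sqint D g.
Proof.
move=> mD fg [mf fi]; split.
  by apply: eq_measurable_fun mf => x /set_mem; exact: fg.
by apply: eq_itg fi => // x Dx; rewrite fg.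
Qed.

Lemma sqint_sub0 D E f : mset D -> mset E -> D `<=` E ->
  (forall x, E x -> ~ D x -> f x = 0) -> sqint D f -> sqint E f.
Proof.
move=> mD mE DE f0 [mf fi]; split; last first.
  by apply: itg_sub0 fi => // x Ex nDx; rewrite f0// expr0n.
have : mfun_on E (f \_ D).
  by apply/(measurable_restrict _ mD mE); rewrite setIidr.
apply: eq_measurable_fun => x /set_mem Ex; rewrite patchE.
by case: ifPn => // /negP nD; rewrite f0// => Dx; apply: nD; rewrite inE.
Qed.

Lemma sqint_bounded D f (M : R) : mset D -> (mu D < +oo)%E -> mfun_on D f ->
  (forall x, D x -> `|f x| <= M) -> sqint D f.
Proof.
move=> mD Dy mf fM; split => //; apply: (@itg_bounded _ _ _ (M ^+ 2)) => //.
  exact: measurable_funX.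
by move=> x Dx; rewrite normrX lerXn2r ?nnegrE ?fM// (le_trans _ (fM x Dx)).
Qed.

Lemma sqint_cst D k : mset D -> (mu D < +oo)%E -> sqint D (fun=> k).
Proof. by move=> mD Dy; apply: (@sqint_bounded _ _ `|k|). Qed.

Lemma sqint_itg D f : mset D -> (mu D < +oo)%E -> sqint D f -> itg D f.
Proof.
move=> mD Dy sf; have := sqint_itgM mD sf (sqint_cst 1 mD Dy).
by apply: eq_itg => // x _; rewrite mulr1.
Qed.

Definition nrm D f : R := Num.sqrt (\int[mu]_(x in D) (f x ^+ 2)).

Lemma nrm_ge0 D f : 0 <= nrm D f. Proof. exact: sqrtr_ge0. Qed.

Lemma sqr_nrm D f : nrm D f ^+ 2 = \int[mu]_(x in D) (f x ^+ 2).
Proof. by rewrite sqr_sqrtr// Rintegral_ge0// => x _; exact: sqr_ge0. Qed.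

Lemma sqr_int_add D f g (k : R) : mset D -> sqint D f -> sqint D g ->
  \int[mu]_(x in D) ((f x + k * g x) ^+ 2) =
  \int[mu]_(x in D) (f x ^+ 2) + 2 * k * \int[mu]_(x in D) (f x * g x)
   + k ^+ 2 * \int[mu]_(x in D) (g x ^+ 2).
Proof.
move=> mD sf sg; have fgi := sqint_itgM mD sf sg.
case: sf sg => [mf fi] [mg gi].
rewrite -!RintegralZl// -RintegralD//; last exact: itgZ.
rewrite -RintegralD//; [|by apply: itgD => //; exact: itgZ|exact: itgZ].
by apply: eq_Rintegral => x _; ring.
Qed.

Lemma cauchy_schwarz D f g : mset D -> sqint D f -> sqint D g ->
  `|\int[mu]_(x in D) (f x * g x)| <= nrm D f * nrm D g.
Proof.
move=> mD sf sg.
set B := \int[mu]_(x in D) (f x * g x).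
rewrite -sqrtrM; last by rewrite Rintegral_ge0// => x _; exact: sqr_ge0.
rewrite -sqrtr_sqr ler_wsqrtr//.
set A := (X in _ <= X * _); set C := (X in _ <= _ * X).
have H k : 0 <= A + 2 * k * B + k ^+ 2 * C.
  by rewrite -sqr_int_add// Rintegral_ge0// => x _; exact: sqr_ge0.
have C0 : 0 <= C by rewrite Rintegral_ge0// => x _; exact: sqr_ge0.
move: C0; rewrite le_eqVlt => /predU1P[C0|C0].
  rewrite -C0 mulr0; have [->|B0] := eqVneq B 0; first by rewrite expr0n.
  (* With [C = 0] the nonnegative polynomial in [k] is affine; at this [k] it would equal -1. *)
  have := H (- (A + 1) / (2 * B)); rewrite -C0 mulr0 addr0.
  rewrite (_ : 2 * _ * B = - (A + 1)); last by field.
  by rewrite leNgt => /negP []; lra.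
have := H (- B / C); rewrite (_ : _ + _ = A - B ^+ 2 / C); last by field; rewrite gt_eqF.
by rewrite subr_ge0 ler_pdivrMr.
Qed.

Lemma nrmD D f g : mset D -> sqint D f -> sqint D g ->
  nrm D (fun x => f x + g x) <= nrm D f + nrm D g.
Proof.
move=> mD sf sg; rewrite -ler_sqr ?nnegrE ?addr_ge0 ?nrm_ge0// sqrrD !sqr_nrm.
have := sqr_int_add 1 mD sf sg; rewrite mulr1 expr1n mul1r.
under eq_Rintegral do rewrite mul1r.
move=> ->; rewrite lerD2r lerD2l -[leRHS]mulr_natl ler_wpM2l//.
by rewrite (le_trans (ler_norm _))// cauchy_schwarz.
Qed.

Lemma eq_nrm D f g : (forall x, D x -> f x = g x) -> nrm D f = nrm D g.
Proof.
by move=> fg; congr Num.sqrt; apply: eq_Rintegral => x /set_mem Dx; rewrite fg.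
Qed.

Lemma nrm_le D f g : mset D -> sqint D f -> sqint D g ->
  (forall x, D x -> `|f x| <= `|g x|) -> nrm D f <= nrm D g.
Proof.
move=> mD [_ fi] [_ gi] fg; rewrite ler_wsqrtr// le_Rintegral// => x Dx.
by rewrite -(sqr_normr (f x)) -(sqr_normr (g x)) lerXn2r ?nnegrE ?fg.
Qed.

Lemma nrmZ D k f : mset D -> sqint D f -> nrm D (fun x => k * f x) = `|k| * nrm D f.
Proof.
move=> mD [mf fi]; rewrite /nrm -sqrtr_sqr -sqrtrM ?sqr_ge0// -RintegralZl//.
by congr Num.sqrt; apply: eq_Rintegral => x _; rewrite exprMn.
Qed.

Lemma sqint_norm D f : mset D -> sqint D f -> sqint D (fun x => `|f x|).
Proof.
move=> mD [mf fi]; split; first exact: measurableT_comp.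
by apply: eq_itg fi => // x _; rewrite sqr_normr.
Qed.

Lemma nrm_norm D f : nrm D (fun x => `|f x|) = nrm D f.
Proof. by congr Num.sqrt; apply: eq_Rintegral => x _; rewrite sqr_normr. Qed.

Lemma cauchy_schwarz_norm D f g : mset D -> sqint D f -> sqint D g ->
  \int[mu]_(x in D) (`|f x| * `|g x|) <= nrm D f * nrm D g.
Proof.
move=> mD sf sg; rewrite -(nrm_norm D f) -(nrm_norm D g).
by rewrite (le_trans (ler_norm _))// cauchy_schwarz//; exact: sqint_norm.
Qed.

End SquareIntegrable.

Section DuBoisReymond.
Context {R : realType}.
Notation mu := (@lebesgue_measure R).
Implicit Types (a b s t r x d : R) (f g h k : R -> R) (D : set R).

(** One ramp stays equal to [d + h] on the right, so its support is not compact; for the difference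
    of two translates it is, and the derivative compares the windows at [s] and [s']. *)
Lemma ramp_test_fun a b s s' d (h : R) : 0 < h -> 0 < d ->
  a < s - h -> a < s' - h -> s + d + h < b -> s' + d + h < b ->
  let phi x := ramp h d (x - s) - ramp h d (x - s') in
  test_fun `]a, b[ phi /\
  derive1 phi = (fun x => trap h d (x - s) - trap h d (x - s')).
Proof.
move=> h0 d0 as_ as' sb s'b phi.
have dphi x : is_derive x 1 phi (trap h d (x - s) - trap h d (x - s')).
  by apply: is_deriveB; exact: is_derive_shift (ramp_derive _ _ _).
split; last by apply/funext => x; rewrite derive1E; case: (dphi x).
apply: (@test_fun_supp _ _ (Num.min s s' - h) (Num.max s s' + d + h) _ _ dphi).
- apply: (@lipschitz_continuous _ _ (8 / h)) => x y.
  have L u : `|trap h d (y - u) - trap h d (x - u)| <= 4 / h * `|y - x|.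
    have E : y - u - (x - u) = y - x by ring.
    by rewrite -E; exact: trap_lip.
  have := L s; have := L s'; rewrite !ler_norml => /andP[? ?] /andP[? ?].
  by apply/andP; split; lra.
- move=> x /negP; rewrite negb_and -!ltNge => /orP[H|H].
    have : x < s - h /\ x < s' - h.
      by split; rewrite (lt_le_trans H)// lerD2r ge_min lexx ?orbT.
    by move=> [? ?]; rewrite /phi !ramp_left ?subrr//; lra.
  have : s + d + h < x /\ s' + d + h < x.
    by split; rewrite (le_lt_trans _ H)// !lerD2r le_max lexx ?orbT.
  by move=> [? ?]; rewrite /phi !ramp_right ?subrr//; lra.
- move=> x /=; rewrite !in_itv/= => /andP[mx xM].
  have : (Num.min s s' = s \/ Num.min s s' = s') /\
         (Num.max s s' = s \/ Num.max s s' = s').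
    by rewrite /Num.min /Num.max; case: ifP => _; split; [left|right|right|left].
  by move=> [[E1|E1] [E2|E2]]; rewrite E1 in mx; rewrite E2 in xM;
    apply/andP; split; lra.
Qed.

(** The trapezoid is 1 on the window and 0 beyond its two shoulders, so only the shoulders
    contribute to the error. *)
Lemma trap_approx a b s d (h : R) k : 0 < h -> 0 < d -> a <= s - h -> s + d + h <= b ->
  itgi a b k ->
  `|ig a b (fun x => k x * trap h d (x - s)) - ig s (s + d) k|
    <= ig (s - h) s (fun x => `|k x|) + ig (s + d) (s + d + h) (fun x => `|k x|).
Proof.
move=> h0 d0 as_ sb ki.
set w := fun x => k x * trap h d (x - s).
have wc : cnt a b (fun x => trap h d (x - s)).
  apply: continuous_cnt; apply: (@lipschitz_continuous _ _ (4 / h)) => x y.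
  have E : y - s - (x - s) = y - x by ring.
  by rewrite -E; exact: trap_lip.
have wi : itgi a b w.
  by apply: eq_itgi (cntM_itg wc ki) => x _; rewrite mulrC.
have S (f : R -> R) p q : itgi a b f -> a <= p -> q <= b -> itgi p q f.
  by move=> fi ap qb; exact: itgiS fi.
have w1 x : `|w x| <= `|k x|.
  rewrite normrM ler_piMr//; have /andP[t0 t1] := trap_ge0_le1 (x - s) h0 d0.
  by rewrite ger0_norm.
have w0 p q : (forall x, p <= x <= q -> x <= s - h \/ s + d + h <= x) -> p <= q ->
    ig p q w = 0.
  move=> H pq; rewrite (@eq_ig _ _ _ _ (fun=> 0)); first by rewrite ig_cst// mul0r.
  move=> x /H xH; rewrite /w trap_eq0 ?mulr0//.
  by case: xH; [left|right]; lra.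
have wE : ig s (s + d) w = ig s (s + d) k.
  by apply: eq_ig => x /andP[sx xs]; rewrite /w trap_eq1 ?mulr1//; lra.
rewrite (@ig_cat _ _ (s - h))//; [|lra].
rewrite (@ig_cat _ (s - h) s)//; [|lra|lra|apply: S => //; lra].
rewrite (@ig_cat _ s (s + d))//; [|lra|lra|apply: S => //; lra].
rewrite (@ig_cat _ (s + d) (s + d + h))//; [|lra|apply: S => //; lra].
rewrite (w0 a) //; last by move=> x /andP[_]; left.
rewrite (w0 (s + d + h)) //; last by move=> x /andP[]; right.
rewrite wE add0r addr0 (_ : _ - _ = ig (s - h) s w + ig (s + d) (s + d + h) w); last by ring.
rewrite (le_trans (ler_normD _ _))// lerD//.
  have wi' : itgi (s - h) s w by apply: S => //; lra.
  rewrite (le_trans (ig_norm wi'))// ig_le//; first exact: itg_norm.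
  by apply: itg_norm => //; apply: S => //; lra.
have wi' : itgi (s + d) (s + d + h) w by apply: S => //; lra.
rewrite (le_trans (ig_norm wi'))// ig_le//; first exact: itg_norm.
by apply: itg_norm => //; apply: S => //; lra.
Qed.

(** Testing with a difference of ramps equates the smoothed windows at [s] and [s']; as the shoulder
    width [h] shrinks, absolute continuity of the integral turns this into equality of the sharp
    windows, and [ae_cst_of_shift] concludes. *)
Lemma du_bois_reymond a b k : a < b -> itgi a b k ->
  (forall phi, test_fun `]a, b[ phi -> ig a b (fun x => k x * derive1 phi x) = 0) ->
  exists c, {ae mu, forall x, a < x < b -> k x = c}.
Proof.
move=> ab ki H; apply: ae_cst_of_shift => // s s' d as_ as' d0 sb s'b.
apply/eqP; rewrite -subr_eq0 -normr_le0; apply/ler_addgt0Pr => e e0; rewrite add0r.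
have e4 : 0 < e / 4 by exact: divr_gt0.
have [h0 h00 small] := ig_small ki e4.
(* [h] keeps all shoulders inside []a, b[] and makes the integral of the absolute value of [k] over
   each of the four at most [e / 4]. *)
pose h := Num.min (Num.min h0 (Num.min (s - a) (s' - a)))
  (Num.min (b - (s + d)) (b - (s' + d))) / 2.
have m0 : 0 < Num.min (Num.min h0 (Num.min (s - a) (s' - a)))
  (Num.min (b - (s + d)) (b - (s' + d))).
  by rewrite !lt_min h00 !subr_gt0 as_ as' sb.
have hgt0 : 0 < h by exact: divr_gt0.
have : h < Num.min (Num.min h0 (Num.min (s - a) (s' - a)))
  (Num.min (b - (s + d)) (b - (s' + d))).
  by rewrite /h ltr_pdivrMr// ltr_pMr// ltr1n.
rewrite !lt_min => /andP[/and3P[hh0 hsa hsa'] /andP[hb hb']].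
have [| | | |] := @ramp_test_fun a b s s' d h hgt0 d0; try lra.
set phi := (fun x => _) => tphi dphi.
have := H _ tphi; rewrite dphi.
have Ti u : a < u - h -> itgi a b (fun x => k x * trap h d (x - u)).
  move=> _; have wc : cnt a b (fun x => trap h d (x - u)).
    apply: continuous_cnt; apply: (@lipschitz_continuous _ _ (4 / h)) => x y.
    have E : y - u - (x - u) = y - x by ring.
    by rewrite -E; exact: trap_lip.
  by apply: eq_itgi (cntM_itg wc ki) => x _; rewrite mulrC.
rewrite (@eq_ig _ _ _ _ (fun x => k x * trap h d (x - s) - k x * trap h d (x - s'))); last first.
  by move=> x _; rewrite mulrBr.
rewrite igB; [|by apply: Ti; lra|by apply: Ti; lra].
move=> /eqP; rewrite subr_eq0 => /eqP E.
have A u : a < u - h -> u + d + h < b ->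
    `|ig a b (fun x => k x * trap h d (x - u)) - ig u (u + d) k| <= e / 4 + e / 4.
  move=> au ub; apply: (le_trans (trap_approx hgt0 d0 _ _ ki)); [lra|lra|].
  by apply: lerD; apply/ltW/small; lra.
have A1 : `|ig a b (fun x => k x * trap h d (x - s)) - ig s (s + d) k| <= e / 4 + e / 4.
  by apply: A; lra.
have A2 : `|ig a b (fun x => k x * trap h d (x - s')) - ig s' (s' + d) k| <= e / 4 + e / 4.
  by apply: A; lra.
move: A1 A2; rewrite E; set I := ig a b _; rewrite !ler_norml => /andP[? ?] /andP[? ?].
by apply/andP; split; lra.
Qed.

End DuBoisReymond.

Section WeakDerivatives.
Context {R : realType}.
Notation mu := (@lebesgue_measure R).
Implicit Types (a b s t r x d : R) (f g h k : R -> R) (D : set R).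

(** By the product rule for the primitive [G] of [g] and a test function, [f - G] has zero weak
    derivative, so it is constant almost everywhere. *)
Lemma weak_prim a b f g : a < b -> itgi a b f -> itgi a b g ->
  (forall phi, test_fun `]a, b[ phi ->
     ig a b (fun x => f x * derive1 phi x) = - ig a b (fun x => g x * phi x)) ->
  exists2 F, prim a b F g & {ae mu, forall x, a < x < b -> f x = F x}.
Proof.
move=> ab fi gi H; pose G x := ig a x g.
have pG : prim a b G g.
  split=> // s t as_ st tb; rewrite /G (@ig_cat _ _ s t)//.
    by rewrite addrAC subrr add0r.
  exact: itgiS gi.
have Gc := prim_cnt pG.
have [] := @du_bois_reymond _ a b (fun x => f x - G x) ab.
- by apply: itgB => //; exact: cnt_itg.
- move=> phi tphi; have [dphi cphi phi0 cphi'] := test_funE tphi.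
  have out x : ~ (a < x < b) -> phi x = 0.
    move=> nx; have [|d d0 D] := phi0 x; first by rewrite /= in_itv.
    by have [] := D x; first by rewrite subrr normr0.
  have fpi : itgi a b (fun x => f x * derive1 phi x).
    by apply: eq_itgi (cntM_itg (continuous_cnt cphi') fi) => x _; rewrite mulrC.
  have Gpi : itgi a b (fun x => G x * derive1 phi x).
    by apply: cnt_itg; apply: cntM => //; exact: continuous_cnt.
  have gpi : itgi a b (fun x => g x * phi x).
    by apply: eq_itgi (cntM_itg (continuous_cnt cphi) gi) => x _; rewrite mulrC.
  rewrite (@eq_ig _ _ _ _ (fun x => f x * derive1 phi x - G x * derive1 phi x)); last first.
    by move=> x _; rewrite mulrBl.
  rewrite igB// H//.
  have pphi : prim a b phi (derive1 phi).
    by apply: prim_C1 => //; exact: continuous_cnt.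
  have [_ /(_ a b)] := primM (ltW ab) pG pphi.
  rewrite !lexx (ltW ab) => /(_ isT isT isT).
  rewrite !out ?mulr0 ?subrr; try by rewrite ?ltxx ?andbF.
  rewrite igD// => [/esym/eqP|]; last by apply: eq_itgi gpi => x _; rewrite mulrC.
  rewrite (@eq_ig _ _ _ (fun x => phi x * g x) (fun x => g x * phi x)); last first.
    by move=> x _; rewrite mulrC.
  by rewrite addrC addr_eq0 => /eqP ->; rewrite subrr.
- move=> c ae_c; exists (fun x => G x + c).
    by apply: eq_prim (primD pG (prim_cst a b c)) => // x _; rewrite addr0.
  by apply: aeS ae_c => x Hx /Hx <-; rewrite addrC subrK.
Qed.

(** The end points are included, which is how one-sided traces get identified later. *)
Lemma cnt_ae_eq a b f h : a < b -> cnt a b f -> cnt a b h ->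
  {ae mu, forall x, a < x < b -> f x = h x} -> forall x, a <= x <= b -> f x = h x.
Proof.
move=> ab fc hc fh x xab; apply/eqP; rewrite -subr_eq0 -normr_le0.
apply/ler_addgt0Pr => e e0; rewrite add0r.
have [d1 d10 D1] := fc x xab _ (divr_gt0 e0 (ltr0n _ 2)).
have [d2 d20 D2] := hc x xab _ (divr_gt0 e0 (ltr0n _ 2)).
move/andP: xab => [ax xb].
pose p := Num.max a (x - Num.min d1 d2); pose q := Num.min b (x + Num.min d1 d2).
have m0 : 0 < Num.min d1 d2 by rewrite lt_min d10.
have pq : p < q.
  rewrite gt_max !lt_min ab/=; apply/and3P; split.
  - by move: m0; lra.
  - by move: m0; lra.
  - by move: m0; lra.
have [y [/andP[py yq] Hy]] := ae_ex pq fh.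
move: py yq; rewrite gt_max lt_min => /andP[ay xy] /andP[yb yx].
have yab : a <= y <= b by rewrite !ltW.
have : `|y - x| < Num.min d1 d2.
  by rewrite ltr_norml; apply/andP; split; lra.
rewrite lt_min => /andP[/(D1 _ yab) H1 /(D2 _ yab) H2].
rewrite (_ : f x - h x = (h y - h x) - (f y - f x)); last by rewrite Hy ?ay ?yb//; ring.
by rewrite (le_trans (ler_normB _ _))// (splitr e) lerD.
Qed.

(* The value at x of a representative of f continuous near x. *)
Definition cval f x : R := xget 0 [set l | exists2 d, 0 < d & exists h,
  [/\ cnt (x - d) (x + d) h,
      {ae mu, forall y, x - d < y < x + d -> f y = h y} & h x = l]].

(** Two continuous representatives agree wherever both are available, so the choice made in [cval]
    is immaterial. One global function thus serves all intervals inside an open set that need not be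
    connected. *)
Lemma cvalE a b f h : cnt a b h -> {ae mu, forall x, a < x < b -> f x = h x} ->
  forall x, a < x < b -> cval f x = h x.
Proof.
move=> hc fh x /andP[ax xb]; rewrite /cval; case: xgetP => [l _ [d d0 [k [kc fk kx]]]|].
  pose p := Num.max a (x - d); pose q := Num.min b (x + d).
  have px : p < x by rewrite gt_max ax/= ltrBlDr ltrDl.
  have xq : x < q by rewrite lt_min xb/= ltrDl.
  have ap : a <= p by rewrite le_max lexx.
  have qb : q <= b by rewrite ge_min lexx.
  have xdp : x - d <= p by rewrite le_max lexx orbT.
  have qxd : q <= x + d by rewrite ge_min lexx orbT.
  rewrite -kx; apply: (@cnt_ae_eq p q _ _ (lt_trans px xq)); last by rewrite !ltW.
  - exact: cntS kc.
  - exact: cntS hc.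
  - apply: aeS2 fh fk => y fhy fky /andP[py yq].
    rewrite -fhy ?fky//; last by rewrite (le_lt_trans ap)//= (lt_le_trans yq).
    by rewrite (le_lt_trans xdp)//= (lt_le_trans yq).
move=> /(_ (h x)) []; exists (Num.min (x - a) (b - x)).
  by rewrite lt_min !subr_gt0 ax.
exists h; split => //.
  apply: cntS hc; first by rewrite lerBrDl -lerBrDr ge_min lexx.
  by rewrite -lerBrDl ge_min lexx orbT.
apply: aeS fh => y fhy /andP[xy yx]; apply: fhy; move: xy yx.
rewrite ltrBlDl -ltrBlDr -ltrBlDl !lt_min => /andP[? ?] /andP[? ?].
by apply/andP; split; lra.
Qed.

Lemma open_ball_itv D x : open D -> D x -> exists2 d, 0 < d &
  forall y, x - d <= y <= x + d -> D y.
Proof.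
move=> oD Dx; have /nbhs_ballP[d /= d0 dD] := open_nbhs_nbhs (conj oD Dx).
exists (d / 2); first exact: divr_gt0.
move=> y /andP[xy yx]; apply: dD; rewrite /ball/= ltr_norml.
by apply/andP; split; lra.
Qed.

Lemma open_itv_extend D s t : open D -> s <= t -> `[s, t] `<=` D ->
  exists2 d, 0 < d & `[s - d, t + d] `<=` D.
Proof.
move=> oD st stD.
have [|d1 d10 D1] := @open_ball_itv D s oD; first by apply: stD; rewrite /= in_itv/= lexx.
have [|d2 d20 D2] := @open_ball_itv D t oD; first by apply: stD; rewrite /= in_itv/= lexx st.
exists (Num.min d1 d2); first by rewrite lt_min d10.
have m1 : Num.min d1 d2 <= d1 by rewrite ge_min lexx.
have m2 : Num.min d1 d2 <= d2 by rewrite ge_min lexx orbT.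
move=> y /=; rewrite in_itv/= => /andP[sy yt].
have [ys|sy'] := leP y s; first by apply: D1; apply/andP; split; lra.
have [ty|yt'] := leP t y; first by apply: D2; apply/andP; split; lra.
by apply: stD; rewrite /= in_itv/= !ltW.
Qed.

(** The rational closed intervals inside [D] cover it with their interiors, so only countably many
    null sets are united. *)
Lemma ae_open_cover D (P : R -> Prop) : open D ->
  (forall p q, p < q -> `[p, q] `<=` D -> {ae mu, forall x, p < x < q -> P x}) ->
  {ae mu, forall x, D x -> P x}.
Proof.
move=> oD H.
pose Q (n : nat) x := if (unpickle n : option (rat * rat)) is Some pq
  then `[ratr pq.1, ratr pq.2] `<=` D -> ratr pq.1 < x < ratr pq.2 -> P x else True.
have : {ae mu, forall x, forall n, Q n x}.
  apply: ae_foralln => n; rewrite /Q; case: (unpickle n) => [[p q]/=|]; last exact: aeW.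
  have [pqD|npqD] := pselect (`[ratr p, ratr q]%classic `<=` D); last exact: aeW.
  have [pq|qp] := ltP (ratr p : R) (ratr q).
    by apply: aeS (H _ _ pq pqD) => x Hx _; exact: Hx.
  by apply: aeW => x _ /andP[px xq]; move: (lt_le_trans (lt_trans px xq) qp); rewrite ltxx.
apply: aeS => x Hx Dx.
have [d d0 dD] := open_ball_itv oD Dx.
have [p /[!in_itv]/= /andP[p1 p2]] := @rat_in_itvoo R (x - d) x ltac:(lra).
have [q /[!in_itv]/= /andP[q1 q2]] := @rat_in_itvoo R x (x + d) ltac:(lra).
have := Hx (pickle (p, q)); rewrite /Q pickleK/=; apply; last by rewrite p2.
move=> y /=; rewrite in_itv/= => /andP[py yq]; apply: dD.
by apply/andP; split; lra.
Qed.

Lemma test_funS D E phi : D `<=` E -> test_fun D phi -> test_fun E phi.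
Proof. by move=> DE [? ? ? H]; split=> //; exact: subset_trans DE. Qed.

Lemma weak_derivS D E f g : mset D -> mset E -> D `<=` E ->
  is_weak_deriv E f g -> is_weak_deriv D f g.
Proof.
move=> mD mE DE [/(L2P _ mE) sg H]; split; first exact/(L2P _ mD)/(sqintS mD mE DE).
move=> phi tphi; have := H phi (test_funS DE tphi).
have [_ _ phi0 _] := test_funE tphi.
have out x : ~ D x -> phi x = 0 /\ derive1 phi x = 0.
  by move=> /phi0[d d0]; apply; rewrite subrr normr0.
rewrite (Rintegral_sub0 mD mE DE); last by move=> x _ /out[_ ->]; rewrite mulr0.
by rewrite (Rintegral_sub0 mD mE DE)// => x _ /out[-> _]; rewrite mulr0.
Qed.

Lemma weak_deriv_itv a b f g : a < b -> L2 `]a, b[ f -> is_weak_deriv `]a, b[ f g ->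
  exists2 F, prim a b F g & {ae mu, forall x, a < x < b -> f x = F x}.
Proof.
move=> ab sf [sg H].
have moo : mset `]a, b[ by exact: measurable_itv.
have lty : (mu `]a, b[ < +oo)%E.
  by apply: (@mu_itv_lty _ _ a b); apply: subset_itv; rewrite bnd_simp.
have fi : itgi a b f by apply: itg_oo; apply: sqint_itg => //; exact/L2P.
have gi : itgi a b g by apply: itg_oo; apply: sqint_itg => //; exact/L2P.
apply: weak_prim => // phi tphi; have [_ cphi _ cphi'] := test_funE tphi.
rewrite -!ig_oo; last 2 first.
  by apply: eq_itgi (cntM_itg (continuous_cnt cphi) gi) => x _; rewrite mulrC.
  by apply: eq_itgi (cntM_itg (continuous_cnt cphi') fi) => x _; rewrite mulrC.
exact: H.
Qed.

(** The primitives found interval by interval are all restrictions of [cval f], so they fit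
    together. *)
Lemma weak_deriv_cval D f g : open D -> mset D -> L2 D f -> is_weak_deriv D f g ->
  {ae mu, forall x, D x -> f x = cval f x} /\
  forall s t, s <= t -> `[s, t] `<=` D -> prim s t (cval f) g.
Proof.
move=> oD mD sf wfg.
have loc s t : s < t -> `[s, t] `<=` D -> exists2 F, prim s t F g &
    {ae mu, forall x, s < x < t -> f x = F x}.
  move=> st stD; have S : `]s, t[ `<=` D.
    by apply: subset_trans stD; apply: subset_itv; rewrite bnd_simp.
  apply: weak_deriv_itv => //; last exact: weak_derivS wfg.
  by apply/L2P => //; apply: sqintS S _ => //; exact/L2P.
split.
  apply: (ae_open_cover oD) => p q pq pqD; have [F pF fF] := loc p q pq pqD.
  by apply: aeS (fF) => x Hx xpq; rewrite Hx// (cvalE (prim_cnt pF) fF).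
(* [cvalE] covers interior points only; enlarging the interval inside [D] gives the equality at [s]
   and [t] as well. *)
move=> s t st stD; have [d d0 dD] := open_itv_extend oD st stD.
have [|F pF fF] := loc (s - d) (t + d) _ dD; first by lra.
have pst : prim s t F g by apply: primS pF; lra.
apply: eq_prim pst => // x /andP[sx xt].
by rewrite (cvalE (prim_cnt pF) fF)//; apply/andP; split; lra.
Qed.

Lemma weak_deriv_unique D f g g' : open D -> mset D -> L2 D f ->
  is_weak_deriv D f g -> is_weak_deriv D f g' ->
  {ae mu, forall x, D x -> g x = g' x}.
Proof.
move=> oD mD sf /(weak_deriv_cval oD mD sf)[_ H] /(weak_deriv_cval oD mD sf)[_ H'].
apply: (ae_open_cover oD) => p q pq pqD.
exact: prim_inj (H _ _ (ltW pq) pqD) (H' _ _ (ltW pq) pqD).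
Qed.

(** Integration by parts on a bounded open set. The product of [F] with a test function, put to zero
    off [D], is examined locally: inside [D] by the product rule, and near a point outside [D]
    because the test function vanishes there, whatever [F] does. [cousin] adds up over [[A, B]], and
    the product is zero at both ends. *)
Lemma prim_weak_deriv D A B f g F : open D -> mset D -> A <= B -> D `<=` `]A, B[ ->
  L2 D f -> L2 D g -> {ae mu, forall x, D x -> f x = F x} ->
  (forall x, D x -> exists2 d, 0 < d & prim (x - d) (x + d) F g) ->
  is_weak_deriv D f g.
Proof.
move=> oD mD AB DAB sf sg fF pF; split=> // phi tphi.
have [dphi cphi phi0 cphi'] := test_funE tphi.
have out x : ~ D x -> phi x = 0 /\ derive1 phi x = 0.
  by move=> /phi0[d d0]; apply; rewrite subrr normr0.
have lty : (mu D < +oo)%E.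
  have mAB : mset `[A, B] by exact: measurable_itv.
  apply: (@le_lt_trans _ _ (mu `[A, B]%classic)); last exact: (@mu_itv_lty _ _ A B).
  apply: le_measure; rewrite ?inE//; apply: subset_trans DAB _.
  by apply: subset_itv; rewrite bnd_simp.
have DAB' x : D x -> A <= x <= B.
  by move=> /DAB; rewrite /= in_itv/= => /andP[/ltW -> /ltW ->].
have bnd psi (h : R -> R) : continuous psi -> sqint D h -> itg D (fun x => h x * psi x).
  move=> cpsi sh; have [M HM] := cnt_bounded (@continuous_cnt _ A B _ cpsi).
  apply: (@eq_itg _ _ (fun x => psi x * h x)) => // [x _|]; first by rewrite mulrC.
  apply: (@itgM _ _ _ _ M) => //; last exact: sqint_itg.
  - exact: measurable_funTS (continuous_measurable_fun cpsi).
  - by move=> x /DAB'; exact: HM.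
have fpi : itg D (fun x => f x * derive1 phi x) by apply: bnd => //; exact/L2P.
have gpi : itg D (fun x => g x * phi x) by apply: bnd => //; exact/L2P.
pose k := (fun x => f x * derive1 phi x + g x * phi x) \_ D.
pose H x := (if x \in D then F x else 0) * phi x.
have ki : itgi A B k.
  have kD : itg D k by apply: eq_itg (itgD mD fpi gpi) => // x Dx; rewrite /k patchE mem_set.
  by apply: itg_sub0 kD => // x _ nD; rewrite /k patchE; case: ifPn => // /set_mem.
have loc x : A <= x <= B -> exists2 d, 0 < d & forall s t, A <= s -> t <= B ->
    x - d < s -> s <= t -> t < x + d -> H t - H s = ig s t k.
  move=> xAB; have [Dx|nDx] := pselect (D x); last first.
    have [d d0 D0] := phi0 x nDx; exists d => // s t As tB xs st tx.
    rewrite (@eq_ig _ _ _ _ (fun=> 0)).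
      rewrite /H; have [-> _] : phi s = 0 /\ derive1 phi s = 0.
        by apply: D0; rewrite ltr_norml; apply/andP; split; lra.
      have [-> _] : phi t = 0 /\ derive1 phi t = 0.
        by apply: D0; rewrite ltr_norml; apply/andP; split; lra.
      by rewrite ig_cst// !mulr0 mul0r subrr.
    move=> y /andP[sy yt]; rewrite /k patchE; case: ifPn => // _.
    have [-> ->] : phi y = 0 /\ derive1 phi y = 0.
      by apply: D0; rewrite ltr_norml; apply/andP; split; lra.
    by rewrite !mulr0 addr0.
  have [d1 d10 dD] := open_ball_itv oD Dx.
  have [d2 d20 pFx] := pF x Dx.
  exists (Num.min d1 d2) => [|s t As tB]; first by rewrite lt_min d10.
  have m1 : Num.min d1 d2 <= d1 by rewrite ge_min lexx.
  have m2 : Num.min d1 d2 <= d2 by rewrite ge_min lexx orbT.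
  move=> xs st tx.
  have stD y : s <= y <= t -> D y.
    by move=> /andP[sy yt]; apply: dD; apply/andP; split; lra.
  have pst : prim s t F g by apply: primS pFx; lra.
  have pphi : prim s t phi (derive1 phi).
    by apply: prim_C1 => //; exact: continuous_cnt.
  have [ip Hp] := primM st pst pphi.
  have Ds : D s by apply: stD; rewrite lexx.
  have Dt : D t by apply: stD; rewrite lexx st.
  rewrite /H (mem_set Ds) (mem_set Dt) (Hp s t)//; apply: Rintegral_ae_eq => //.
  - exact: itg_measurable ip.
  - by apply: itg_measurable => //; exact: itgiS ki.
  - apply: aeS fF => y fFy yst; have Dy : D y by apply: stD; move: yst; rewrite /= in_itv.
    by rewrite /k ?patchE mem_set// -fFy//; ring.
have HAB : H B - H A = ig A B k.
  apply: (cousin AB (P := fun s t => H t - H s = ig s t k)).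
    move=> s r t As sr rt tB H1 H2.
    by rewrite (@ig_cat _ s r t)// -?H1 -?H2; [ring|exact: itgiS ki].
  move=> x xAB; have [d d0 D0] := loc x xAB; move/andP: xAB => [Ax xB].
  exists d => //; split => [t /andP[xt tx] tB|s /andP[xs sx] As].
    by apply: D0 => //; lra.
  by apply: D0 => //; lra.
have nA : ~ D A by move=> /DAB; rewrite /= in_itv/= ltxx.
have nB : ~ D B by move=> /DAB; rewrite /= in_itv/= ltxx andbF.
move: HAB; rewrite /H (out _ nA).1 (out _ nB).1 !mulr0 subrr.
have E : ig A B k = \int[mu]_(x in D) (f x * derive1 phi x + g x * phi x).
  rewrite (@Rintegral_sub0 _ D)//; last first.
    by move=> x _ nD; rewrite /k ?patchE; case: ifPn => // /set_mem.
  by apply: eq_Rintegral => x xD; rewrite /k ?patchE xD.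
by rewrite E RintegralD// => /esym/eqP; rewrite addr_eq0 => /eqP.
Qed.

End WeakDerivatives.

(** * Weak limits in L^2 *)

Section Completeness.
Context {R : realType}.
Notation mu := (@lebesgue_measure R).
Implicit Types (D : set R) (f g h : R -> R).

Lemma nrm_telescope D (f : nat -> R -> R) : mset D -> (forall n, sqint D (f n)) ->
  (forall n, nrm D (fun x => f n.+1 x - f n x) <= 2^-1 ^+ n) ->
  forall n m, (n <= m)%N -> nrm D (fun x => f m x - f n x) <= 2 * 2^-1 ^+ n.
Proof.
move=> mD sf H n m /subnKC <-; set k := (m - n)%N.
apply: (@le_trans _ _ (2 * 2^-1 ^+ n - 2 * 2^-1 ^+ (n + k))); last first.
  by rewrite gerBl mulr_ge0// exprn_ge0// invr_ge0.
elim: k => [|k IH].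
  rewrite addn0 subrr (@eq_nrm _ _ _ (fun x => 0 * f n x)) => [|x _]; last by ring.
  by rewrite nrmZ// normr0 mul0r.
rewrite (@eq_nrm _ _ _ (fun x => (f (n + k).+1 x - f (n + k)%N x) + (f (n + k)%N x - f n x))).
  rewrite (le_trans (nrmD _ _ _))//; try exact: sqintB.
  rewrite (le_trans (lerD (H _) IH))// addnS exprS.
  by rewrite le_eqVlt; apply/orP; left; apply/eqP; field.
by move=> x _; rewrite addnS; ring.
Qed.

(** The integrals of the partial sums stay below [2 * K]; by monotone convergence the sum is
    integrable, hence finite almost everywhere. *)
Lemma ae_summable D (h : nat -> R -> R) (K : R) : mset D ->
  (forall n, itg D (h n)) -> (forall n x, 0 <= h n x) ->
  (forall n, \int[mu]_(x in D) h n x <= K * 2^-1 ^+ n) ->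
  {ae mu, forall x, D x -> cvgn (series (fun n => h n x))}.
Proof.
move=> mD hi h0 hK.
have K0 : 0 <= K.
  by have := hK 0%N; rewrite expr0 mulr1; apply: le_trans; exact: Rintegral_ge0.
pose G x := (\sum_(n <oo) (h n x)%:E)%E.
have mG : measurable_fun (D : set (measurableTypeR R)) G.
  apply: ge0_emeasurable_sum => // [n x _ _|n _]; first by rewrite lee_fin.
  by apply/measurable_EFinP; exact: itg_measurable (hi n).
have iG : (\int[mu]_(x in D) G x < +oo)%E.
  rewrite integral_nneseries//; last 2 first.
    by move=> n; apply/measurable_EFinP; exact: itg_measurable (hi n).
    by move=> n x _; rewrite lee_fin.
  apply: (@le_lt_trans _ _ (2 * K)%:E); last by rewrite ltry.
  apply: lime_le.
    by apply: is_cvg_ereal_nneg_natsum => n _; apply: integral_ge0 => x _; rewrite lee_fin.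
  apply: nearW => n.
  apply: (@le_trans _ _ (2 * K - 2 * K * 2^-1 ^+ n)%:E); last first.
    by rewrite lee_fin gerBl !mulr_ge0// exprn_ge0// invr_ge0.
  elim: n => [|n IH]; first by rewrite big_geq// expr0 mulr1 subrr.
  rewrite big_nat_recr//=.
  have -> : (\int[mu]_(x in D) (h n x)%:E = (\int[mu]_(x in D) h n x)%:E)%E.
    by rewrite fineK//; exact: (integrable_fin_num mD (hi n)).
  apply: (@le_trans _ _ ((2 * K - 2 * K * 2^-1 ^+ n)%:E + (K * 2^-1 ^+ n)%:E)%E).
    by apply: leeD => //; rewrite lee_fin.
  by rewrite -EFinD lee_fin exprS le_eqVlt; apply/orP; left; apply/eqP; field.
have Gi : mu.-integrable D G.
  apply/integrableP; split=> //; under eq_integral => x _.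
    by rewrite gee0_abs; [over|apply: nneseries_ge0 => n _ _; rewrite lee_fin].
  exact: iG.
have := integrable_ae mD Gi; apply: aeS => x H Dx; have {H} Gx := H Dx.
apply: nondecreasing_is_cvgn.
  by move=> n m nm; rewrite !seriesEnat/= (big_cat_nat (leq0n n) nm)//= lerDl sumr_ge0.
exists (fine (G x)) => _ [n _ <-]; rewrite -lee_fin fineK// seriesEnat/= -sumEFin.
by apply: nneseries_lim_ge => i _ _; rewrite lee_fin.
Qed.

Lemma limn_einf_le (u : nat -> \bar R) n (c : \bar R) :
  (forall m, (n <= m)%N -> (u m <= c)%E) -> (limn_einf u <= c)%E.
Proof.
move=> uc; rewrite limn_einf_lim; apply: lime_le; first exact: is_cvg_einfs.
apply: nearW => k; apply: (@le_trans _ _ (u (maxn n k))).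
  by apply: ereal_inf_lbound; exists (maxn n k) => //=; rewrite leq_maxr.
by apply: uc; rewrite leq_maxl.
Qed.

Lemma measurable_limn_einf D (u : nat -> R -> \bar R) :
  (forall n, measurable_fun (D : set (measurableTypeR R)) (u n)) ->
  measurable_fun (D : set (measurableTypeR R)) (fun x => limn_einf (u^~ x)).
Proof.
move=> mu_; rewrite (_ : (fun x => _) = (fun x => - limn_esup (fun n => - u n x))%E).
  apply: measurableT_comp => //; apply: measurable_fun_limn_esup => n.
  exact: measurableT_comp.
apply/funext => x; rewrite -limn_einfN; congr (limn_einf _).
by apply/funext => n /=; rewrite oppeK.
Qed.

(** Riesz-Fischer for a fast Cauchy sequence. On a set of finite measure the increments are summable
    in L^1, so the sequence converges almost everywhere; Fatou transfers the L^2 estimates to the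
    limit. *)
Lemma sqint_complete D (f : nat -> R -> R) : mset D -> (mu D < +oo)%E ->
  (forall n, sqint D (f n)) ->
  (forall n, nrm D (fun x => f n.+1 x - f n x) <= 2^-1 ^+ n) ->
  exists2 g, sqint D g & forall n, nrm D (fun x => g x - f n x) <= 2 * 2^-1 ^+ n.
Proof.
move=> mD Dy sf fn.
have sfB n m : sqint D (fun x => f m x - f n x) by exact: sqintB.
have fcv : {ae mu, forall x, D x -> cvgn (fun n => f n x)}.
  have := @ae_summable D (fun n x => `|f n.+1 x - f n x|) (nrm D (fun=> 1)) mD.
  have hi n : itg D (fun x => `|f n.+1 x - f n x|).
    by apply: itg_norm => //; exact: sqint_itg.
  move=> /(_ hi (fun _ _ => normr_ge0 _)); have HK n :
      \int[mu]_(x in D) `|f n.+1 x - f n x| <= nrm D (fun=> 1) * 2^-1 ^+ n.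
    have := cauchy_schwarz_norm mD (sqint_cst 1 mD Dy) (sfB n n.+1).
    under eq_Rintegral do rewrite normr1 mul1r.
    by move=> /le_trans; apply; rewrite ler_wpM2l ?nrm_ge0.
  move=> /(_ HK); apply: aeS => x H Dx; have {}H := H Dx.
  have : cvgn (series (telescope (fun n => f n x))).
    apply: (@normed_cvg _ R^o); exact: H.
  move=> /cvg_ex[l Hl]; apply/cvg_ex; exists (f 0%N x + l).
  rewrite (_ : (fun n => f n x) = (fun n => f 0%N x + series (telescope (f ^~ x)) n)).
    by apply: cvgD => //; exact: cvg_cst.
  by apply/funext => n; exact: (eq_sum_telescope (f ^~ x)).
(* The upper limit is measurable and defined everywhere; [fine] makes it real-valued also where it
   is infinite. *)
pose g x := fine (limn_esup (fun n => (f n x)%:E)).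
have mg : mfun_on D g.
  apply: (@measurableT_comp _ _ _ _ _ _ fine); first exact: fine_measurable.
  by apply: measurable_fun_limn_esup => n; apply/measurable_EFinP; case: (sf n).
have gcv : {ae mu, forall x, D x -> f n x @[n --> \oo] --> g x}.
  apply: aeS fcv => x H Dx; have /cvg_ex[l fl] := H Dx.
  have E : (fun n => (f n x)%:E) @ \oo --> l%:E.
    by apply: cvg_EFin; [exact: nearW|exact: fl].
  rewrite (_ : g x = l)//= /g is_cvg_limn_esupE; last by apply/cvg_ex; exists l%:E.
  by rewrite (cvg_lim _ E).
have fat n : (\int[mu]_(x in D) ((g x - f n x) ^+ 2)%:E <= ((2 * 2^-1 ^+ n) ^+ 2)%:E)%E.
  apply: (@le_trans _ _ (\int[mu]_(x in D) limn_einf (fun m => ((f m x - f n x) ^+ 2)%:E))%E).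
    rewrite le_eqVlt; apply/orP; left; apply/eqP; apply: ae_eq_integral => //.
    - apply/measurable_EFinP/measurable_funX/measurable_funB => //; by case: (sf n).
    - apply: measurable_limn_einf => m.
       apply/measurable_EFinP/measurable_funX; by case: (sfB n m).
    - apply: aeS gcv => x H Dx; have {}H := H Dx.
      have E : (fun m => ((f m x - f n x) ^+ 2)%:E) @ \oo --> ((g x - f n x) ^+ 2)%:E.
        apply: cvg_EFin; first exact: nearW.
        have fg : f m x - f n x @[m --> \oo] --> g x - f n x.
          by apply: cvgB => //; exact: cvg_cst.
        rewrite expr2 (_ : _ \o _ = fun m => (f m x - f n x) * (f m x - f n x)).
          exact: cvgM.
        by apply/funext => m /=; rewrite expr2.
      rewrite is_cvg_limn_einfE; last by apply/cvg_ex; eexists; exact: E.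
      by rewrite (cvg_lim _ E).
  apply: (le_trans (fatou mu mD _ _)).
  - by move=> m; apply/measurable_EFinP/measurable_funX; case: (sfB n m).
  - by move=> m x _; rewrite lee_fin sqr_ge0.
  apply: (limn_einf_le (n := n)) => m nm.
  have -> : (\int[mu]_(x in D) ((f m x - f n x) ^+ 2)%:E =
             (nrm D (fun x => f m x - f n x) ^+ 2)%:E)%E.
    rewrite sqr_nrm fineK//.
    by have [_ i] := sfB n m; exact: (integrable_fin_num mD i).
  rewrite lee_fin lerXn2r ?nnegrE ?nrm_ge0 ?mulr_ge0 ?exprn_ge0 ?invr_ge0//.
  exact: nrm_telescope.
have sg n : sqint D (fun x => g x - f n x).
  split; first by apply: measurable_funB => //; case: (sf n).
  apply/integrableP; split.
    by apply/measurable_EFinP/measurable_funX/measurable_funB => //; case: (sf n).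
  under eq_integral do rewrite /= ger0_norm ?sqr_ge0//.
  by rewrite (le_lt_trans (fat n))// ltry.
exists g => [|n].
  by apply: eq_sqint (sqintD mD (sg 0%N) (sf 0%N)) => // x _; rewrite subrK.
rewrite -ler_sqr ?nnegrE ?nrm_ge0 ?mulr_ge0 ?exprn_ge0 ?invr_ge0//.
rewrite sqr_nrm -lee_fin fineK//.
by have [_ i] := sg n; exact: (integrable_fin_num mD i).
Qed.

End Completeness.

(** * Riesz representation and weak compactness along ultrafilters *)

Section RieszAndWeakLimits.
Context {R : realType}.
Notation mu := (@lebesgue_measure R).
Implicit Types (D : set R) (f g h : R -> R).

Lemma half_expn_small (K e : R) : 0 < e -> exists n, K * 2^-1 ^+ n <= e.
Proof.
move=> e0; have K1 : 0 < `|K| + 1 by rewrite ltr_wpDl.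
have h1 : `|2^-1 : R| < 1 by rewrite ger0_norm ?invr_ge0// invf_lt1// ltr1n.
have /cvgrPdist_le/(_ (e / (`|K| + 1)) (divr_gt0 e0 K1)) := cvg_expr h1.
move=> [n _ /(_ n (leqnn n))]; rewrite /= sub0r normrN ger0_norm ?exprn_ge0 ?invr_ge0// => H.
exists n; apply: (@le_trans _ _ ((`|K| + 1) * 2^-1 ^+ n)).
  by rewrite ler_wpM2r ?exprn_ge0 ?invr_ge0// (le_trans (ler_norm K))// lerDl.
by rewrite mulrC -ler_pdivlMr.
Qed.

(** Minimise [J f = nrm D f ^ 2 / 2 - l f]. It is bounded below because [l] is bounded, the midpoint
    identity makes a minimising sequence Cauchy, and its limit represents [l] because the first
    variation vanishes. *)
Lemma riesz D (l : (R -> R) -> R) (C : R) : mset D -> (mu D < +oo)%E ->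
  (forall f g k, sqint D f -> sqint D g -> l (fun x => f x + k * g x) = l f + k * l g) ->
  (forall f, sqint D f -> `|l f| <= C * nrm D f) ->
  exists2 g, sqint D g & forall h, sqint D h -> l h = \int[mu]_(x in D) (g x * h x).
Proof.
move=> mD Dy lin bnd.
pose J f := 2^-1 * nrm D f ^+ 2 - l f.
have s0 : sqint D (fun=> 0) by exact: sqint_cst.
pose S := [set J f | f in [set f | sqint D f]].
have lbS : lbound S (- (C ^+ 2 / 2)).
  move=> _ [f sf <-]; rewrite /J; have := bnd f sf; rewrite ler_norml => /andP[_].
  by have := sqr_ge0 (nrm D f - C); lra.
have iS : has_inf S.
  by split; [exists (J (fun=> 0)); exists (fun=> 0)|exists (- (C ^+ 2 / 2))].
set m := inf S.
have mJ f : sqint D f -> m <= J f.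
  by move=> sf; apply: ge_inf; [exists (- (C ^+ 2 / 2))|exists f].
(* The value of [J] at a midpoint is the mean of the two values minus one eighth of the squared
   distance, so this tolerance yields distances of at most [2^-n]. *)
pose del n : R := (2^-1 ^+ n) ^+ 2 / 8.
have del0 n : 0 < del n by rewrite divr_gt0// !exprn_gt0// invr_gt0.
have /choice[f Hf] n : exists f, sqint D f /\ J f < m + del n.
  have [_ [f sf <-] H] := inf_adherent (del0 n) iS.
  by exists f.
have sf n : sqint D (f n) by case: (Hf n).
have Jf n : J (f n) < m + del n by case: (Hf n).
have JD p q k : sqint D p -> sqint D q -> J (fun x => p x + k * q x) =
    J p + k * (\int[mu]_(x in D) (p x * q x) - l q) + k ^+ 2 / 2 * nrm D q ^+ 2.
  by move=> sp sq; rewrite /J lin// !sqr_nrm sqr_int_add//; field.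
have cauchy n : nrm D (fun x => f n.+1 x - f n x) <= 2^-1 ^+ n.
  pose d x := f n.+1 x - f n x.
  have sd : sqint D d by exact: sqintB.
  have J1 := JD _ _ 1 (sf n) sd; have J2 := JD _ _ (2^-1) (sf n) sd.
  have E : (fun x => f n x + 1 * d x) = f n.+1 by apply/funext => x; rewrite /d; ring.
  rewrite E in J1.
  have mid : m <= J (fun x => f n x + 2^-1 * d x).
    by apply: mJ; apply: sqintD => //; exact: sqintZ.
  have dn : del n.+1 <= del n.
    rewrite /del ler_pM2r ?invr_gt0// lerXn2r ?nnegrE ?exprn_ge0 ?invr_ge0//.
    by rewrite exprS ler_piMl ?exprn_ge0 ?invr_ge0// invf_le1// ler1n.
  rewrite -ler_sqr ?nnegrE ?nrm_ge0 ?exprn_ge0 ?invr_ge0// -/d.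
  have := Jf n; have := Jf n.+1; move: mid dn; rewrite J1 J2 /del.
  set N := nrm D d ^+ 2; set P := \int[mu]_(x in D) _ - _; set a := (2^-1 ^+ n) ^+ 2.
  set b := (2^-1 ^+ n.+1) ^+ 2; set j := J (f n); rewrite exprVn expr1n.
  by move=> ? ? ? ?; lra.
have [g sg gf] := sqint_complete mD Dy sf cauchy.
exists g => // h sh; apply/eqP; rewrite -subr_eq0 -normr_le0.
apply/ler_addgt0Pr => e e0; rewrite add0r.
have [n Hn] := half_expn_small (1 + nrm D h ^+ 2 / 2 + 2 * nrm D h) e0.
apply: le_trans Hn; set t := 2^-1 ^+ n.
have t0 : 0 < t by rewrite exprn_gt0// invr_gt0.
set a := \int[mu]_(x in D) (f n x * h x) - l h.
(* Near-minimality of [f n] against [f n + k h]. Taking [k = t] and [k = -t] and dividing by [t]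
   bounds the first variation [a] by a multiple of [t]. *)
have A k : 0 <= k * a + k ^+ 2 / 2 * nrm D h ^+ 2 + t ^+ 2 / 8.
  have : m <= J (fun x => f n x + k * h x).
    by apply: mJ; apply: sqintD => //; exact: sqintZ.
  by have := Jf n; rewrite JD// -/a /del -/t; lra.
have B : `|a| <= t + t * (nrm D h ^+ 2 / 2).
  have A1 := A t; have A2 := A (- t); rewrite -(ler_pM2l t0) -(gtr0_norm t0) -normrM.
  rewrite (gtr0_norm t0) ler_norml; move: A1 A2; set N := nrm D h ^+ 2.
  have t2 : 0 <= t ^+ 2 by exact: sqr_ge0.
  by move=> A1 A2; apply/andP; split; lra.
have E : l h - \int[mu]_(x in D) (g x * h x) =
    - a - \int[mu]_(x in D) ((g x - f n x) * h x).
  rewrite /a (_ : \int[mu]_(x in D) ((g x - f n x) * h x) =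
    \int[mu]_(x in D) (g x * h x) - \int[mu]_(x in D) (f n x * h x)); first by ring.
  by rewrite -RintegralB//; [under eq_Rintegral do rewrite mulrBl|exact: sqint_itgM..].
rewrite E (le_trans (ler_normB _ _))// normrN mulrDl lerD//.
  by rewrite mulrDl mul1r [_ / 2 * t]mulrC.
rewrite (le_trans (cauchy_schwarz _ _ _))//; first exact: sqintB.
by rewrite mulrAC ler_wpM2r ?nrm_ge0.
Qed.

Section Ultrafilters.
Variables (T : Type) (U : set_system T).
Hypothesis UU : UltraFilter U.

Lemma ultraN (P : T -> Prop) : ~ U [set t | P t] -> U [set t | ~ P t].
Proof. by move=> nP; case: (in_ultra_setVsetC [set t | P t] UU). Qed.

(** For each [x] the ultrafilter decides whether [x <= f t] on a large set; the limit is the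
    supremum of the [x] for which this holds. *)
Lemma ultra_lim (f : T -> R) (B : R) : U [set t | `|f t| <= B] ->
  exists l, forall e : R, 0 < e -> U [set t | `|f t - l| <= e].
Proof.
move=> fB; pose S := [set x | U [set t | x <= f t]].
have SB : S (- B).
  by apply: filterS fB => t /=; rewrite ler_norml => /andP[].
have ubS : ubound S B.
  move=> x Sx; have [t [/= xt tB]] := filter_ex (filterI Sx fB).
  by rewrite (le_trans xt)// (le_trans (ler_norm _)).
have supS : has_sup S by split; [exists (- B)|exists B].
exists (sup S) => e e0.
have [x Sx xe] := sup_adherent e0 supS.
have nS : ~ S (sup S + e).
  move=> H; have : sup S + e <= sup S by apply: ub_le_sup => //; exists B.
  by rewrite gerDl leNgt e0.
have U2 := ultraN nS.
apply: filterS (filterI Sx U2) => t /= [H1 /negP]; rewrite -ltNge => H2.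
by rewrite ler_norml; apply/andP; split; lra.
Qed.

(** Weak compactness without extraction: the limits against all [h] exist simultaneously and form a
    bounded linear functional, for which Riesz supplies [g]. Lower semicontinuity of the norm comes
    from testing with [g] itself. *)
Lemma ultra_weak_limit D (tau : T -> R -> R) (C : R) : mset D -> (mu D < +oo)%E ->
  U [set t | sqint D (tau t) /\ nrm D (tau t) <= C] ->
  exists g, [/\ sqint D g,
    (forall h, sqint D h -> forall e : R, 0 < e ->
      U [set t | `|\int[mu]_(x in D) (tau t x * h x) - \int[mu]_(x in D) (g x * h x)| <= e]) &
    (forall C', U [set t | nrm D (tau t) <= C'] -> nrm D g <= C')].
Proof.
move=> mD Dy HC.
have bound h : sqint D h ->
    U [set t | `|\int[mu]_(x in D) (tau t x * h x)| <= C * nrm D h].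
  move=> sh; apply: filterS HC => t /= [st tC].
  by rewrite (le_trans (cauchy_schwarz _ _ _))// ler_wpM2r ?nrm_ge0.
have /choice[l Hl] h : exists l, sqint D h -> forall e : R, 0 < e ->
    U [set t | `|\int[mu]_(x in D) (tau t x * h x) - l| <= e].
  have [sh|nsh] := pselect (sqint D h); last by exists 0.
  by have [l Hl] := ultra_lim (bound h sh); exists l.
have lin f g k : sqint D f -> sqint D g -> l (fun x => f x + k * g x) = l f + k * l g.
  move=> sf sg; have sfg : sqint D (fun x => f x + k * g x).
    by apply: sqintD => //; exact: sqintZ.
  apply/eqP; rewrite -subr_eq0 -normr_le0; apply/ler_addgt0Pr => e e0; rewrite add0r.
  have K0 : 0 < 2 + `|k| by rewrite ltr_pwDl.
  have e' : 0 < e / (2 + `|k|) by exact: divr_gt0.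
  have [t [/= [st _] [H1 [H2 H3]]]] := filter_ex (filterI HC (filterI (Hl _ sf _ e')
    (filterI (Hl _ sg _ e') (Hl _ sfg _ e')))).
  move: H3; rewrite (_ : \int[mu]_(x in D) (tau t x * (f x + k * g x)) =
    \int[mu]_(x in D) (tau t x * f x) + k * \int[mu]_(x in D) (tau t x * g x)); last first.
    rewrite -RintegralZl//; last exact: sqint_itgM.
    rewrite -RintegralD//; [|exact: sqint_itgM|by apply: itgZ => //; exact: sqint_itgM].
    by apply: eq_Rintegral => x _; ring.
  move: H1 H2; set a := \int[mu]_(x in D) _; set b := \int[mu]_(x in D) _ => H1 H2 H3.
  have -> : l (fun x => f x + k * g x) - (l f + k * l g) =
    (a - l f) + k * (b - l g) - (a + k * b - l (fun x => f x + k * g x)) by ring.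
  rewrite (le_trans (ler_normB _ _))// (le_trans (lerD (ler_normD _ _) (lexx _)))// normrM.
  apply: (le_trans (lerD (lerD H1 (ler_wpM2l (normr_ge0 k) H2)) H3)).
  by rewrite le_eqVlt; apply/orP; left; apply/eqP; field; rewrite gt_eqF.
have lC h : sqint D h -> `|l h| <= C * nrm D h.
  move=> sh; apply/ler_addgt0Pr => e e0.
  have [t [/= H1 H2]] := filter_ex (filterI (bound h sh) (Hl h sh e e0)).
  move: H1 H2; rewrite !ler_norml => /andP[? ?] /andP[? ?].
  by apply/andP; split; lra.
have [g sg gl] := riesz mD Dy lin lC.
exists g; split => // [h sh e e0|C' HC'].
  by rewrite -gl//; exact: Hl.
have [/eqP n0|n0] := boolP (nrm D g == 0).
  have [t /= tC'] := filter_ex HC'.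
  by rewrite n0 (le_trans _ tC')// nrm_ge0.
have ng : 0 < nrm D g by rewrite lt_neqAle eq_sym n0 nrm_ge0.
rewrite -(ler_pM2r ng); apply/ler_addgt0Pr => e e0.
have [t [/= [st _] [tC' H]]] := filter_ex (filterI HC (filterI HC' (Hl g sg e e0))).
move: H; rewrite gl// (_ : \int[mu]_(x in D) (g x * g x) = nrm D g * nrm D g); last first.
  by rewrite -expr2 sqr_nrm; apply: eq_Rintegral => x _; rewrite expr2.
have := cauchy_schwarz mD st sg.
have := ler_wpM2r (nrm_ge0 D g) tC'.
rewrite !ler_norml => ? /andP[? ?] /andP[? ?]; lra.
Qed.

End Ultrafilters.

End RieszAndWeakLimits.

(** * The Modica-Mortola lower bound *)

Section ModicaMortola.
Context {R : realType}.
Notation mu := (@lebesgue_measure R).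
Implicit Types (s t x y : R) (f g h : R -> R).

(* The primitive of the square root of twice the double-well potential. *)
Definition well_primitive (r : R) : R := (r - r ^+ 3 / 3) / Num.sqrt 2.

Definition sqmod (a1 a2 : R -> R) (x : R) : R := a1 x ^+ 2 + a2 x ^+ 2.

Definition mm_density (eps : R) (a1 a2 b1 b2 : R -> R) (x : R) : R :=
  eps / 2 * (b1 x ^+ 2 + b2 x ^+ 2) + (4 * eps)^-1 * (sqmod a1 a2 x - 1) ^+ 2.

Lemma sqmod_ge0 (a1 a2 : R -> R) (x : R) : 0 <= sqmod a1 a2 x.
Proof. by rewrite addr_ge0 ?sqr_ge0. Qed.

Lemma mm_density_ge0 (eps : R) (a1 a2 b1 b2 : R -> R) (x : R) : 0 < eps ->
  0 <= mm_density eps a1 a2 b1 b2 x.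
Proof.
move=> e0; rewrite addr_ge0// mulr_ge0 ?sqr_ge0 ?addr_ge0 ?sqr_ge0//.
  by rewrite divr_ge0// ltW.
by rewrite invr_ge0 mulr_ge0// ltW.
Qed.

Lemma sqmod_cnt s t (a1 a2 : R -> R) : cnt s t a1 -> cnt s t a2 -> cnt s t (sqmod a1 a2).
Proof. by move=> c1 c2; apply: cntD; [exact: (cntM c1 c1)|exact: (cntM c2 c2)]. Qed.

Lemma mm_density_itgi s t (eps : R) (a1 a2 b1 b2 : R -> R) :
  cnt s t a1 -> cnt s t a2 -> sqint `[s, t] b1 -> sqint `[s, t] b2 ->
  itgi s t (mm_density eps a1 a2 b1 b2).
Proof.
move=> c1 c2 [_ s1] [_ s2]; apply: itgD => //; apply: itgZ => //; first exact: itgD.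
apply: cnt_itg; have C : cnt s t (fun x => sqmod a1 a2 x - 1).
  by apply: cntD; [exact: sqmod_cnt|exact: cnt_cst].
by rewrite /expr2; exact: (cntM C C).
Qed.

Lemma norm_sub_le (x1 x2 y1 y2 : R) :
  `|Num.sqrt (y1 ^+ 2 + y2 ^+ 2) - Num.sqrt (x1 ^+ 2 + x2 ^+ 2)|
  <= Num.sqrt ((y1 - x1) ^+ 2 + (y2 - x2) ^+ 2).
Proof.
have p (u v : R) : 0 <= u ^+ 2 + v ^+ 2 by rewrite addr_ge0 ?sqr_ge0.
rewrite -sqrtr_sqr ler_wsqrtr// sqrrB !sqr_sqrtr//.
set P := Num.sqrt _; set Q := Num.sqrt _.
have : y1 * x1 + y2 * x2 <= P * Q.
  rewrite (le_trans (ler_norm _))// -ler_sqr ?nnegrE ?mulr_ge0 ?sqrtr_ge0//.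
  rewrite exprMn !sqr_sqrtr// real_normK ?num_real//.
  by have := sqr_ge0 (y1 * x2 - y2 * x1); lra.
by rewrite mulr2n; lra.
Qed.

(** For [m = |1 - rho^2| / sqrt 2] the last term is the double-well term of the energy. *)
Lemma amgm (eps m z : R) : 0 < eps -> m * z <= eps / 2 * z ^+ 2 + m ^+ 2 / (2 * eps).
Proof.
move=> e0; rewrite -subr_ge0.
rewrite (_ : _ - _ = (eps * z - m) ^+ 2 / (2 * eps)); last by field; rewrite gt_eqF.
by rewrite divr_ge0 ?sqr_ge0// mulr_ge0// ltW.
Qed.

Lemma cnt_sqrt s t f : cnt s t f -> cnt s t (fun x => Num.sqrt (f x)).
Proof. by move=> fc; apply: (cnt_comp (F := Num.sqrt) fc) => x _; exact: sqrt_continuous. Qed.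

(** The Modica-Mortola inequality. The increment of [well_primitive] is factored algebraically, the
    increment of the modulus is bounded by the length of that of the curve, and [cousin] adds up the
    resulting estimates; the modulus is never differentiated, so zeros of the curve are allowed. *)
Lemma mm_bound s t (eps : R) (a1 a2 b1 b2 : R -> R) : 0 < eps -> s <= t ->
  prim s t a1 b1 -> prim s t a2 b2 -> sqint `[s, t] b1 -> sqint `[s, t] b2 ->
  `|well_primitive (Num.sqrt (sqmod a1 a2 t)) - well_primitive (Num.sqrt (sqmod a1 a2 s))|
    <= ig s t (mm_density eps a1 a2 b1 b2).
Proof.
move=> e0 st p1 p2 s1 s2.
have c1 := prim_cnt p1; have c2 := prim_cnt p2.
have qc := sqmod_cnt c1 c2.
pose rho x := Num.sqrt (sqmod a1 a2 x).
have rc : cnt s t rho by exact: cnt_sqrt.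
set h := fun x => well_primitive (rho x).
set ed := mm_density eps a1 a2 b1 b2.
have edi : itgi s t ed by exact: mm_density_itgi.
have [b1i H1] := p1; have [b2i H2] := p2.
(* [eta * k] absorbs two errors: the 1 pays for freezing the potential at the tag, the absolute
   values for freezing the slope [lin]. *)
pose k x := 1 + (`|b1 x| + `|b2 x|).
have ki : itgi s t k.
  by apply: itgD; [|exact: itgi_cst|apply: itgD => //; exact: itg_norm].
suff main (eta : R) : 0 < eta -> `|h t - h s| <= ig s t (fun x => ed x + eta * k x).
  apply/ler_addgt0Pr => e e_gt0.
  have k0 : 0 <= ig s t k by apply: ig_ge0 => x _; rewrite !addr_ge0.
  have k1 : 0 < ig s t k + 1 by rewrite ltr_wpDl.
  rewrite (le_trans (main (e / (ig s t k + 1)) _)) ?divr_gt0//.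
  rewrite igD ?igZ//; last exact: itgZ.
  by rewrite lerD2l mulrAC ler_pdivrMr// ler_wpM2l ?(ltW e_gt0)// lerDl.
move=> eta0.
have S f p q : s <= p -> q <= t -> itgi s t f -> itgi p q f.
  by move=> sp qt; exact: itgiS.
pose w x := (4 * eps)^-1 * (sqmod a1 a2 x - 1) ^+ 2.
have wc : cnt s t w.
  have C : cnt s t (fun x => sqmod a1 a2 x - 1).
    by apply: cntD => //; exact: cnt_cst.
  by apply: cntM; [exact: cnt_cst|exact: (cntM C C)].
pose P p q := `|h q - h p| <= ig p q (fun x => ed x + eta * k x).
have edki : itgi s t (fun x => ed x + eta * k x) by apply: itgD => //; exact: itgZ.
have s20 : 0 < Num.sqrt 2 :> R by rewrite sqrtr_gt0.
have loc x : s <= x <= t -> exists2 d : R, 0 < d & forall p q, s <= p -> p <= q ->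
    q <= t -> p = x \/ q = x -> q - p < d -> P p q.
  move=> sxt.
  (* The divided difference of [r - r^3 / 3] between [rho x] and [rho y]; at [y = x] it equals
     [1 - rho x ^ 2]. *)
  pose lin y := 1 - (rho x ^+ 2 + rho x * rho y + rho y ^+ 2) / 3.
  have linc : cnt s t (fun y => lin y / Num.sqrt 2).
    apply: cntM; last exact: cnt_cst.
    apply: cntD; first exact: cnt_cst.
    have C : cnt s t (fun y => (-3^-1) * ((rho x ^+ 2 + rho x * rho y) + rho y ^+ 2)).
      apply: cntM; first exact: cnt_cst.
      apply: cntD; last exact: (cntM rc rc).
      by apply: cntD; [exact: cnt_cst|apply: cntM => //; exact: cnt_cst].
    move=> y yst e ee; have [d d0 D] := C y yst e ee; exists d => // z zst zy.
    by have := D z zst zy; rewrite !mulNr ![3^-1 * _]mulrC.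
  have [d1 d10 D1] := linc x sxt eta eta0.
  have [d2 d20 D2] := wc x sxt eta eta0.
  exists (Num.min d1 d2); first by rewrite lt_min d10.
  move=> p q sp pq qt pqx; rewrite lt_min => /andP[qpd1 qpd2].
  have near y : p <= y <= q -> `|y - x| <= q - p.
    by move=> /andP[py yq]; rewrite ler_norml; case: pqx => <-; lra.
  have Sb y : p <= y <= q -> s <= y <= t.
    by move=> /andP[py yq]; rewrite (le_trans sp)//= (le_trans yq).
  have [y [ypq yq]] : exists y, p <= y <= q /\ ((x = p /\ y = q) \/ (x = q /\ y = p)).
    case: pqx => E; [exists q|exists p]; rewrite ?lexx ?pq; split => //;
      by [left|right].
  pose D1' := a1 q - a1 p; pose D2' := a2 q - a2 p.
  have E1 : D1' = ig p q b1 by exact: H1.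
  have E2 : D2' = ig p q b2 by exact: H2.
  pose del := Num.sqrt (D1' ^+ 2 + D2' ^+ 2).
  have rdel : `|rho y - rho x| <= del.
    rewrite /rho /sqmod (le_trans (norm_sub_le _ _ _ _))// ler_wsqrtr//.
    by case: yq => [[-> ->]|[-> ->]]; rewrite // /D1' /D2' -(opprB (a1 p)) -(opprB (a2 p)) !sqrrN.
  have hdel : `|h q - h p| <= `|lin y / Num.sqrt 2| * del.
    have -> : `|h q - h p| = `|h y - h x|.
      by case: yq => [[-> ->]|[-> ->]] //; rewrite distrC.
    rewrite (_ : h y - h x = lin y / Num.sqrt 2 * (rho y - rho x)); last first.
      by rewrite /h /well_primitive /lin; field; rewrite gt_eqF.
    by rewrite normrM ler_wpM2l.
  pose m := `|lin x / Num.sqrt 2|.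
  have lin_m : `|lin y / Num.sqrt 2| <= m + eta.
    have := D1 y (Sb y ypq) (le_lt_trans (near y ypq) qpd1) => H.
    rewrite -lerBlDl (le_trans _ H)// (le_trans _ (lerB_dist _ _))//.
  have delk : del <= ig p q (fun z => `|b1 z| + `|b2 z|).
    rewrite igD; [|exact: itg_norm (S _ _ _ sp qt b1i)|exact: itg_norm (S _ _ _ sp qt b2i)].
    apply: (@le_trans _ _ (`|D1'| + `|D2'|)).
      rewrite -ler_sqr ?nnegrE ?addr_ge0 ?sqrtr_ge0// sqr_sqrtr ?addr_ge0 ?sqr_ge0//.
      rewrite [leRHS]sqrrD !sqr_normr mulr2n.
      by have := mulr_ge0 (normr_ge0 D1') (normr_ge0 D2'); lra.
    by rewrite E1 E2 lerD// ig_norm//; exact: S.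
  have m2 : m ^+ 2 / (2 * eps) = w x.
    have r2 : sqmod a1 a2 x = rho x ^+ 2 by rewrite /rho sqr_sqrtr// sqmod_ge0.
    have sq2 : Num.sqrt 2 ^+ 2 = 2 :> R by rewrite sqr_sqrtr.
    by rewrite /m sqr_normr /w r2 /lin expr_div_n sq2; field; rewrite gt_eqF.
  have mdel : m * del <= ig p q (fun z => ed z + eta).
    (* [(c, s')] is the direction of the increment of the curve: the length [del] becomes linear in
       the densities, so it is an integral that can be estimated pointwise. For [del = 0] the zero
       vector does. *)
    have [c [s' [cs delE]]] : exists c s', c ^+ 2 + s' ^+ 2 <= 1 /\ del = c * D1' + s' * D2'.
      have [d0|d0] := eqVneq del 0.
        by exists 0, 0; rewrite d0 !expr0n !mul0r addr0; split.
      exists (D1' / del), (D2' / del); have del2 : del ^+ 2 = D1' ^+ 2 + D2' ^+ 2.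
        by rewrite sqr_sqrtr// addr_ge0 ?sqr_ge0.
      rewrite !expr_div_n -mulrDl -del2 divff ?sqrf_eq0//; split => //.
      by rewrite mulrAC [_ / del * D2']mulrAC -mulrDl -!expr2 -del2 expr2 mulfK.
    have csi : itgi p q (fun z => c * b1 z + s' * b2 z).
      by apply: itgD => //; apply: itgZ => //; exact: S.
    rewrite delE E1 E2 -!igZ; [|exact: S..].
    rewrite -igD; [|by apply: itgZ => //; exact: S..].
    rewrite -igZ//; apply: ig_le.
    - exact: itgZ.
    - by apply: itgD => //; [exact: S|exact: itgi_cst].
    - move=> z zpq; rewrite (le_trans (amgm _ _ e0))// m2 /ed /mm_density -/(w z) -addrA lerD//.
        rewrite ler_wpM2l ?divr_ge0 ?(ltW e0)//.
        have := sqr_ge0 (c * b2 z - s' * b1 z).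
        have := ler_wpM2r (addr_ge0 (sqr_ge0 (b1 z)) (sqr_ge0 (b2 z))) cs.
        by lra.
      have := D2 z (Sb z zpq) (le_lt_trans (near z zpq) qpd2).
      by rewrite ler_norml => /andP[? ?]; lra.
  rewrite /P (le_trans hdel)//.
  have del0 : 0 <= del by exact: sqrtr_ge0.
  rewrite (le_trans (ler_wpM2r del0 lin_m))// mulrDl.
  rewrite (@eq_ig _ _ _ (fun z => ed z + eta * k z)
    (fun z => (ed z + eta) + eta * (`|b1 z| + `|b2 z|))); last first.
    by move=> z _; rewrite /k; ring.
  have bi : itgi p q (fun z => `|b1 z| + `|b2 z|).
    by apply: itgD => //; apply: itg_norm => //; exact: S.
  rewrite igD; [|by apply: itgD => //; [exact: S|exact: itgi_cst]|exact: itgZ].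
  by rewrite lerD// igZ// ler_wpM2l// ltW.
apply: (cousin st (P := P)).
  move=> p r q sp pr rq qt H H'.
  rewrite /P (ig_cat pr rq)//; last exact: S.
  rewrite (le_trans _ (lerD H H'))// (_ : h q - h p = (h r - h p) + (h q - h r)); last by ring.
  exact: ler_normD.
move=> x sxt; have [d d0 D] := loc x sxt; move: sxt => /andP[sx xt].
exists d => //; split => [y /andP[xy yx] yt|y /andP[yx xy] sy].
  by apply: D => //; [left|rewrite ltrBlDl].
by apply: D => //; [right|rewrite ltrBlDr -ltrBlDl].
Qed.

(** With [r^2 = q] one has [r - r^3 / 3 = r (1 - q / 3)], which is at least
    [(1 - d) (2 - d) / 3]. *)
Lemma well_primitive_ge (q d : R) : d <= 1 -> `|q - 1| <= d ->
  (2 / 3 - d) / Num.sqrt 2 <= well_primitive (Num.sqrt q).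
Proof.
move=> d1; rewrite ler_norml => /andP[dq qd].
rewrite /well_primitive ler_wpM2r ?invr_ge0 ?sqrtr_ge0//.
have q0 : 0 <= q by lra.
set r := Num.sqrt q; have r0 : 0 <= r by exact: sqrtr_ge0.
have rq : r ^+ 2 = q by rewrite sqr_sqrtr.
have rd : 1 - d <= r by rewrite leNgt; apply/negP => rd; nra.
by have := rq; rewrite !exprS expr0 mulr1 => ?; nra.
Qed.

Lemma well_primitive_le (q d : R) : 0 <= d -> q <= d ^+ 2 ->
  well_primitive (Num.sqrt q) <= d / Num.sqrt 2.
Proof.
move=> d0 qd; rewrite ler_wpM2r ?invr_ge0 ?sqrtr_ge0//.
have : Num.sqrt q <= d by rewrite -[d]ger0_norm// -sqrtr_sqr ler_wsqrtr.
have : 0 <= Num.sqrt q ^+ 3 / 3 by rewrite divr_ge0// exprn_ge0// sqrtr_ge0.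
by lra.
Qed.

(** Each of the two crossings between the level [d] and a neighbourhood of 1 costs at least
    [(2/3 - d) / sqrt 2 - d / sqrt 2]; this is where the deficit [2 sqrt 2 d] comes from. *)
Lemma crossing_cost (eps d z1 z2 y : R) (a1 a2 b1 b2 : R -> R) : 0 < eps ->
  0 < d -> d <= 1 -> z1 <= y -> y <= z2 ->
  prim z1 z2 a1 b1 -> prim z1 z2 a2 b2 -> sqint `[z1, z2] b1 -> sqint `[z1, z2] b2 ->
  `|sqmod a1 a2 z1 - 1| <= d -> `|sqmod a1 a2 z2 - 1| <= d -> sqmod a1 a2 y <= d ^+ 2 ->
  2 * Num.sqrt 2 / 3 - 2 * Num.sqrt 2 * d <= ig z1 z2 (mm_density eps a1 a2 b1 b2).
Proof.
move=> e0 d0 d1 z1y yz2 p1 p2 s1 s2 q1 q2 qy.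
have sS p q f : z1 <= p -> q <= z2 -> sqint `[z1, z2] f -> sqint `[p, q] f.
  by move=> zp qz; apply: sqintS => //; apply: subset_itv; rewrite bnd_simp.
rewrite (@ig_cat _ z1 y)//; last first.
  by apply: mm_density_itgi => //; [exact: prim_cnt p1|exact: prim_cnt p2].
have L : `|_ - _| <= ig z1 y _ := mm_bound e0 z1y
  (primS (lexx _) yz2 p1) (primS (lexx _) yz2 p2) (sS _ _ _ (lexx _) yz2 s1) (sS _ _ _ (lexx _) yz2 s2).
have L' : `|_ - _| <= ig y z2 _ := mm_bound e0 yz2
  (primS z1y (lexx _) p1) (primS z1y (lexx _) p2) (sS _ _ _ z1y (lexx _) s1) (sS _ _ _ z1y (lexx _) s2).
have A1 := well_primitive_ge d1 q1; have A2 := well_primitive_ge d1 q2.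
have A3 := well_primitive_le (ltW d0) qy.
move: L L'; rewrite !ler_norml => /andP[L _] /andP[_ L'].
have E : 2 * Num.sqrt 2 / 3 - 2 * Num.sqrt 2 * d =
    2 * ((2 / 3 - d) / Num.sqrt 2 - d / Num.sqrt 2) :> R.
  have s20 : 0 < Num.sqrt 2 :> R by rewrite sqrtr_gt0.
  have E2 : Num.sqrt 2 = 2 / Num.sqrt 2 :> R.
    by apply: (mulIf (lt0r_neq0 s20)); rewrite mulfVK ?gt_eqF// -expr2 sqr_sqrtr.
  by rewrite {1 2}E2; field; rewrite gt_eqF.
by rewrite E; lra.
Qed.

(** Chebyshev: otherwise the integrand would exceed [d^2] on the whole interval. *)
Lemma exists_near_one p q (d : R) (a1 a2 : R -> R) : 0 < d -> p < q ->
  cnt p q a1 -> cnt p q a2 ->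
  ig p q (fun x => (sqmod a1 a2 x - 1) ^+ 2) < d ^+ 2 * (q - p) ->
  exists2 z, p <= z <= q & `|sqmod a1 a2 z - 1| <= d.
Proof.
move=> d0 pq c1 c2 H; apply: contrapT => N.
move: H; apply/negP; rewrite -leNgt -ig_cst ?(ltW pq)//; apply: ig_le.
- exact: itgi_cst.
- have C : cnt p q (fun x => sqmod a1 a2 x - 1).
    by apply: cntD; [exact: sqmod_cnt|exact: cnt_cst].
  by apply: cnt_itg; exact: (cntM C C).
- move=> x xpq; rewrite -(sqr_normr (_ - 1)) lerXn2r ?nnegrE ?(ltW d0)//.
  by rewrite leNgt; apply/negP => /ltW ?; apply: N; exists x.
Qed.

End ModicaMortola.

Section UnitVectorField.
Context {R : realType}.
Notation mu := (@lebesgue_measure R).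
Implicit Types (p q x : R) (f g h : R -> R).

Lemma cntV p q f : cnt p q f -> (forall x, p <= x <= q -> f x != 0) ->
  cnt p q (fun x => (f x)^-1).
Proof.
move=> fc f0; apply: (cnt_comp (F := GRing.inv) fc) => x xpq.
by apply: inv_continuous; exact: f0.
Qed.

Lemma derive_invsqrt (z : R) : 0 < z ->
  is_derive z 1 (fun y => (Num.sqrt y)^-1) (- (2 * Num.sqrt z ^+ 3)^-1).
Proof.
move=> z0; have s0 : Num.sqrt z != 0 by rewrite gt_eqF// sqrtr_gt0.
have := is_deriveV s0 (is_derive1_sqrt z0).
rewrite (_ : _ *: _ = - (2 * Num.sqrt z ^+ 3)^-1)//.
by rewrite /GRing.scale/=; field.
Qed.

(* w = c / |c| satisfies w' = (c x c') |c|^-3 (- c2, c1); this is the first component. *)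
Lemma unit_vector_weak p q (c1 c2 d1 d2 phi : R -> R) : p < q ->
  prim p q c1 d1 -> prim p q c2 d2 ->
  (forall x, p <= x <= q -> 0 < sqmod c1 c2 x) -> test_fun `]p, q[ phi ->
  ig p q (fun x => c1 x / Num.sqrt (sqmod c1 c2 x) * derive1 phi x) =
  ig p q (fun x => c2 x * (c1 x * d2 x - c2 x * d1 x) / Num.sqrt (sqmod c1 c2 x) ^+ 3 * phi x).
Proof.
move=> pq p1 p2 q0 tphi; have [dphi cphi phi0 cphi'] := test_funE tphi.
have pq' := ltW pq.
have c1c := prim_cnt p1; have c2c := prim_cnt p2.
pose rho x := Num.sqrt (sqmod c1 c2 x).
have rc : cnt p q rho by apply: cnt_sqrt; exact: sqmod_cnt.
have rho0 x : p <= x <= q -> rho x != 0.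
  by move=> xpq; rewrite gt_eqF// sqrtr_gt0 q0.
have psq : prim p q (sqmod c1 c2)
    (fun x => (c1 x * d1 x + c1 x * d1 x) + (c2 x * d2 x + c2 x * d2 x)).
  by apply: primD; [exact: (primM pq' p1 p1)|exact: (primM pq' p2 p2)].
have pinv := prim_comp (F := fun y => (Num.sqrt y)^-1)
  (F' := fun z => - (2 * Num.sqrt z ^+ 3)^-1) pq' psq
  (fun x xpq => derive_invsqrt (q0 x xpq)).
have {}pinv := pinv _.
have pw := primM pq' p1 (pinv _).
have pphi : prim p q phi (derive1 phi).
  by apply: prim_C1 => //; exact: continuous_cnt.
have F'c : cnt p q ((fun z => - (2 * Num.sqrt z ^+ 3)^-1) \o sqmod c1 c2).
  have C : cnt p q (fun x => 2 * rho x ^+ 3).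
    apply: cntM; first exact: cnt_cst.
    exact: (cntM rc (cntM rc rc)).
  have CV : cnt p q (fun x => (-1) * (2 * rho x ^+ 3)^-1).
    apply: cntM; first exact: cnt_cst.
    by apply: cntV => // x xpq; rewrite mulf_neq0 ?expf_neq0 ?rho0.
  move=> x xpq e e0; have [d d0 D] := CV x xpq e e0; exists d => // y ypq yx.
  by have := D y ypq yx; rewrite !mulN1r.
have [wi Hw] := primM pq' (pw F'c) pphi.
have out x : ~ (p < x < q) -> phi x = 0.
  move=> nx; have [|d d0 D] := phi0 x; first by rewrite /= in_itv.
  by have [] := D x; first by rewrite subrr normr0.
have := Hw p q (lexx _) pq' (lexx _).
rewrite !out ?ltxx ?andbF// !mulr0 subrr.
pose A x := c1 x / rho x * derive1 phi x.
pose B x := c2 x * (c1 x * d2 x - c2 x * d1 x) / rho x ^+ 3 * phi x.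
have Ai : itgi p q A.
  apply: cnt_itg; apply: cntM; last exact: continuous_cnt.
  by apply: cntM => //; exact: cntV.
have wE x : p <= x <= q -> phi x * ((Num.sqrt (sqmod c1 c2 x))^-1 * d1 x +
     c1 x * (- (2 * Num.sqrt (sqmod c1 c2 x) ^+ 3)^-1 *
       (c1 x * d1 x + c1 x * d1 x + (c2 x * d2 x + c2 x * d2 x)))) +
     c1 x * (Num.sqrt (sqmod c1 c2 x))^-1 * derive1 phi x = A x - B x.
  move=> xpq; rewrite /A /B -/(rho x).
  have r0 := rho0 x xpq.
  have r2 : rho x ^+ 2 = c1 x ^+ 2 + c2 x ^+ 2 by rewrite sqr_sqrtr// ltW// q0.
  (* Everything is brought over [rho^3]; with [rho^2 = c1^2 + c2^2] the radial part cancels and only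
     the cross product is left. *)
  have -> : (rho x)^-1 * d1 x = rho x ^+ 2 * d1 x / rho x ^+ 3 by field.
  by rewrite r2; field.
have Bi : itgi p q B.
  have H : itgi p q (fun x => A x - B x) by apply: eq_itgi wi => x xpq; exact: wE.
  by apply: eq_itgi (itgB _ Ai H) => // x _; ring.
rewrite (eq_ig wE) igB// => /esym/eqP; rewrite subr_eq0 => /eqP.
exact.
Qed.

End UnitVectorField.

Section Separation.
Context {R : realType}.
Notation mu := (@lebesgue_measure R).

Lemma seq_dist_gt0 (x : R) (s : seq R) : x \notin s ->
  exists2 m : R, 0 < m & forall y, y \in s -> m <= `|x - y|.
Proof.
elim: s => [_|y s IH]; first by exists 1.
rewrite inE negb_or => /andP[xy /IH[m m0 H]].
exists (Num.min m `|x - y|); first by rewrite lt_min m0 normr_gt0 subr_eq0.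
move=> z; rewrite inE => /predU1P[->|/H zm]; rewrite ge_min ?lexx ?orbT//.
by rewrite zm.
Qed.

(** The factors leave room for disjoint intervals of half-length [2 * r] around the points, each
    with a middle part and two flanks of length [r]. *)
Lemma seq_separated (a b : R) (s : seq R) : uniq s -> (forall x, x \in s -> a < x < b) ->
  exists2 r : R, 0 < r & (forall x, x \in s -> a <= x - 2 * r /\ x + 2 * r <= b) /\
    (forall x y, x \in s -> y \in s -> x != y -> 4 * r < `|x - y|).
Proof.
elim: s => [_ _|x s IH /= /andP[xs us] sab]; first by exists 1.
have [|r r0 [rab rsep]] := IH us.
  by move=> y ys; apply: sab; rewrite inE ys orbT.
have [m m0 Hm] := seq_dist_gt0 xs.
have /andP[ax xb] : a < x < b by apply: sab; rewrite inE eqxx.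
pose r' := Num.min (Num.min r (m / 8)) (Num.min ((x - a) / 2) ((b - x) / 2)).
have r'0 : 0 < r' by rewrite !lt_min r0 !divr_gt0 ?subr_gt0.
have : r' <= r' by [].
rewrite {2}/r' !le_min => /andP[/andP[r1 r2] /andP[r3 r4]].
exists r' => //; split=> [y|y z].
  rewrite inE => /predU1P[->|/rab[? ?]]; split; lra.
rewrite !inE => /predU1P[->|ys] /predU1P[->|zs].
- by rewrite eqxx.
- by move=> _; have := Hm z zs; lra.
- by move=> _; have := Hm y ys; rewrite distrC; lra.
- by move=> yz; have := rsep y z ys zs yz; lra.
Qed.

Lemma disjoint_intervals_cost (r k : R) (f : R -> R) (s : seq R) (D : set R) :
  mset D -> itg D f -> (forall x, D x -> 0 <= f x) -> uniq s ->
  (forall x, x \in s -> `[x - 2 * r, x + 2 * r] `<=` D) ->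
  (forall x y, x \in s -> y \in s -> x != y -> 4 * r < `|x - y|) ->
  (forall x, x \in s -> k <= ig (x - 2 * r) (x + 2 * r) f) ->
  (size s)%:R * k <= \int[mu]_(x in D) f x.
Proof.
elim: s D => [|x s IH] D mD fi f0 /=; first by rewrite mul0r => *; exact: Rintegral_ge0.
move=> /andP[xs us] sD sep cost.
pose I := `[x - 2 * r, x + 2 * r]%classic : set R.
have mI : mset I by exact: measurable_itv.
have ID : I `<=` D by apply: sD; rewrite inE eqxx.
have mDI : mset (D `\` I) by exact: measurableD.
have DE : D = I `|` (D `\` I) by rewrite setDUK.
rewrite DE Rintegral_setU//; last 2 first.
- by rewrite setDUK.
- by apply/disj_set2P/seteqP; split => // z [Iz [_ /(_ Iz)]].
rewrite -addn1 natrD mulrDl mul1r addrC lerD//; first by apply: cost; rewrite inE eqxx.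
have sub : D `\` I `<=` D by exact: subDsetl.
apply: IH => //.
- exact: itgS fi.
- by move=> y /sub; exact: f0.
- move=> y ys z /= zy; split; first by apply: (sD y) => //; rewrite inE ys orbT.
  move=> zx; have yx : x != y by apply: contra xs => /eqP ->.
  have := sep x y; rewrite !inE eqxx ys orbT => /(_ isT isT yx).
  rewrite ltNge => /negP; apply; move: zx zy; rewrite /I /= !in_itv/=.
  by move=> /andP[? ?] /andP[? ?]; rewrite ler_norml; apply/andP; split; lra.
- by move=> y z ys zs; apply: sep; rewrite inE ?ys ?zs orbT.
- by move=> y ys; apply: cost; rewrite inE ys orbT.
Qed.

Lemma filter_seq (T : Type) (F : set_system T) (P : R -> T -> Prop) (s : seq R) :
  Filter F -> (forall x, x \in s -> F [set t | P x t]) ->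
  F [set t | forall x, x \in s -> P x t].
Proof.
move=> FF; elim: s => [_|x s IH H].
  by apply: filterS (@filterT _ F _) => t _ x.
have F1 : F [set t | P x t] by apply: H; rewrite inE eqxx.
have F2 : F [set t | forall y, y \in s -> P y t].
  by apply: IH => y ys; apply: H; rewrite inE ys orbT.
apply: filterS (filterI F1 F2) => t [/= Px Ps] y.
by rewrite inE => /predU1P[->//|]; exact: Ps.
Qed.

End Separation.

(** * Families of bounded energy along an ultrafilter *)

Section LowerBound.
Context {R : realType}.
Notation mu := (@lebesgue_measure R).
Notation W := (`[(-1 : R), 2]%classic).
Variables (U : set_system R) (L n0 M : R) (a1 a2 b1 b2 : R -> R -> R) (u1 u2 : R -> R).

Definition curve (eps : R) := [/\ prim (-1) 2 (a1 eps) (b1 eps),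
  prim (-1) 2 (a2 eps) (b2 eps), sqint W (b1 eps), sqint W (b2 eps) &
  forall x, ~ (0 < x < 1) -> b1 eps x = 0 /\ b2 eps x = 0].

Definition torque (eps x : R) : R := a1 eps x * b2 eps x - a2 eps x * b1 eps x.

Notation sqm eps := (sqmod (a1 eps) (a2 eps)).
Notation mmd eps := (mm_density eps (a1 eps) (a2 eps) (b1 eps) (b2 eps)).

(** Since [U] is an ultrafilter, a point that is not a dip has a neighbourhood on which the modulus
    is at least [d] for a large set of parameters. The level stays a parameter because the price of
    a dip reaches [2 sqrt 2 / 3] only as [d] tends to 0. *)
Definition dips (d : R) : set R := [set x | -1 < x < 2 /\ forall r, 0 < r ->
  U [set eps | exists y, [/\ -1 <= y <= 2, `|y - x| < r & sqm eps y < d ^+ 2]]].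

Hypotheses (UU : UltraFilter U) (L0 : 0 < L)
  (Ueps : forall e : R, 0 < e -> U [set eps | 0 < eps < e])
  (Ucurve : U [set eps | curve eps])
  (Uenergy : U [set eps | ig (-1) 2 (mmd eps) +
     L / 2 * ig 0 1 (fun x => (torque eps x - n0) ^+ 2) <= M])
  (su1 : sqint W u1) (su2 : sqint W u2)
  (cv1 : forall e : R, 0 < e -> U [set eps | nrm W (fun x => a1 eps x - u1 x) <= e])
  (cv2 : forall e : R, 0 < e -> U [set eps | nrm W (fun x => a2 eps x - u2 x) <= e]).

Let mW : mset W. Proof. exact: measurable_itv. Qed.
Let Wy : (mu W < +oo)%E. Proof. exact: (@mu_itv_lty _ _ (-1) 2). Qed.
Let m01 : mset `[(0 : R), 1]. Proof. exact: measurable_itv. Qed.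
Let y01 : (mu `[(0%R : R), 1%R]%classic < +oo)%E. Proof. exact: (@mu_itv_lty _ _ 0 1). Qed.
Let S01 : `[(0 : R), 1]%classic `<=` W.
Proof. by apply: subset_itv; rewrite bnd_simp; lra. Qed.

Let cnt_sqint (f : R -> R) (p q : R) : cnt p q f -> sqint `[p, q] f.
Proof.
move=> fc; split; first exact: cnt_measurable.
by apply: cnt_itg; exact: (cntM fc fc).
Qed.

Let sqm1c eps : curve eps -> cnt (-1) 2 (fun x => sqm eps x - 1).
Proof.
move=> [p1 p2 _ _ _]; apply: cntD; last exact: cnt_cst.
by apply: sqmod_cnt; [exact: prim_cnt p1|exact: prim_cnt p2].
Qed.

Lemma torque_sqint eps : curve eps -> sqint W (torque eps).
Proof.
move=> [p1 p2 s1 s2 _].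
have [N1 H1] := cnt_bounded (prim_cnt p1); have [N2 H2] := cnt_bounded (prim_cnt p2).
apply: sqintB => //.
  by apply: (@sqintM _ _ _ _ N1) => //; exact: cnt_measurable (prim_cnt p1).
by apply: (@sqintM _ _ _ _ N2) => //; exact: cnt_measurable (prim_cnt p2).
Qed.

Lemma torque_out eps x : curve eps -> ~ (0 < x < 1) -> torque eps x = 0.
Proof. by move=> [_ _ _ _ H] /H[E1 E2]; rewrite /torque E1 E2; ring. Qed.

Lemma potential_small e : 0 < e ->
  U [set eps | nrm W (fun x => sqm eps x - 1) <= e].
Proof.
move=> e0; have K0 : 0 < 4 * (`|M| + 1) by rewrite mulr_gt0// ltr_wpDl.
(* The potential part of the energy bounds the squared norm by [4 * eps * M]; this range of [eps]
   brings it below [e ^ 2]. *)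
have e20 : 0 < e ^+ 2 / (4 * (`|M| + 1)) by rewrite divr_gt0// exprn_gt0.
apply: filterS (filterI (Ueps e20) (filterI Ucurve Uenergy)).
move=> eps /= [/andP[eps0 epsd] [c En]].
have [p1 p2 s1 s2 _] := c.
have c1 := prim_cnt p1; have c2 := prim_cnt p2.
have qi : itgi (-1) 2 (fun x => (sqm eps x - 1) ^+ 2).
  by apply: cnt_itg; exact: (cntM (sqm1c c) (sqm1c c)).
have mmi : itgi (-1) 2 (mmd eps) by exact: mm_density_itgi.
have : (4 * eps)^-1 * ig (-1) 2 (fun x => (sqm eps x - 1) ^+ 2) <= M.
  apply: le_trans En; rewrite -[leLHS]addr0 lerD//; last first.
    by rewrite mulr_ge0 ?divr_ge0 ?(ltW L0)// ig_ge0// => x _; exact: sqr_ge0.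
  rewrite -igZ//; apply: ig_le => //; first exact: itgZ.
  move=> x _; rewrite /mm_density lerDr mulr_ge0 ?addr_ge0 ?sqr_ge0//.
  by rewrite divr_ge0// ltW.
rewrite ler_pdivrMl ?mulr_gt0// => H.
rewrite -ler_sqr ?nnegrE ?nrm_ge0 ?(ltW e0)// sqr_nrm (le_trans H)//.
move: epsd; rewrite ltr_pdivlMr// => epsd.
apply: le_trans (ltW epsd); rewrite mulrA [eps * 4]mulrC ler_wpM2l ?mulr_ge0 ?(ltW eps0)//.
by rewrite (le_trans (ler_norm M))// lerDl.
Qed.

Lemma small_le0 (X K : R) :
  (forall e, 0 < e -> X <= K * e) -> X <= 0.
Proof.
move=> H; apply/ler_addgt0Pr => e e0; rewrite add0r.
have K1 : 0 < `|K| + 1 by rewrite ltr_wpDl.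
rewrite (le_trans (H (e / (`|K| + 1)) _)) ?divr_gt0//.
by rewrite mulrA ler_pdivrMr// mulrC ler_wpM2l ?(ltW e0)// (le_trans (ler_norm K))// lerDl.
Qed.

Let a_sqint eps : curve eps -> sqint W (a1 eps) /\ sqint W (a2 eps).
Proof.
by move=> [p1 p2 _ _ _]; split; apply: cnt_sqint; [exact: prim_cnt p1|exact: prim_cnt p2].
Qed.

(** Strong L^2 convergence gives L^1 convergence of the squares, and the potential term sends the
    squared moduli to 1, so the integral of [v] is zero. *)
Lemma limit_unit : {ae mu, forall x, W x -> u1 x ^+ 2 + u2 x ^+ 2 = 1}.
Proof.
pose v x := `|u1 x ^+ 2 + u2 x ^+ 2 - 1|.
have vi : itg W v.
  apply: itg_norm => //; apply: itgB => //; last exact: itg_cst.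
  by apply: itgD => //; [case: su1|case: su2].
have diff (a u : R -> R) : sqint W a -> sqint W u ->
    ig (-1) 2 (fun x => `|u x ^+ 2 - a x ^+ 2|) <=
    2 * (nrm W (fun x => a x - u x) * nrm W u) + nrm W (fun x => a x - u x) ^+ 2.
  move=> sa su; have sd : sqint W (fun x => a x - u x) by exact: sqintB.
  have i1 : itg W (fun x => `|a x - u x| * `|u x|).
    by apply: sqint_itgM => //; exact: sqint_norm.
  have i2 : itg W (fun x => (a x - u x) ^+ 2) by case: sd.
  apply: (@le_trans _ _ (ig (-1) 2 (fun x => 2 * (`|a x - u x| * `|u x|) + (a x - u x) ^+ 2))).
    apply: ig_le.
    - by apply: itg_norm => //; apply: itgB => //; [case: su|case: sa].
    - by apply: itgD => //; exact: itgZ.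
    - move=> x _; rewrite (_ : u x ^+ 2 - _ = - (2 * ((a x - u x) * u x) + (a x - u x) ^+ 2)).
        rewrite normrN (le_trans (ler_normD _ _))// (ger0_norm (sqr_ge0 _)) !normrM.
        by rewrite (ger0_norm (ler0n _ 2)).
      by ring.
  rewrite igD//; last exact: itgZ.
  by rewrite igZ// sqr_nrm lerD2r ler_wpM2l// cauchy_schwarz_norm.
have : ig (-1) 2 v <= 0.
  apply: (@small_le0 _ (2 * nrm W u1 + 1 + (2 * nrm W u2 + 1) + nrm W (fun=> 1))) => e e0.
  pose t := Num.min e 1.
  have t0 : 0 < t by rewrite lt_min e0 ltr01.
  have te : t <= e by rewrite ge_min lexx.
  have t1 : t <= 1 by rewrite ge_min lexx orbT.
  have [eps [/= H1 [H2 [H3 c]]]] := filter_ex (filterI (cv1 t0) (filterI (cv2 t0)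
    (filterI (potential_small t0) Ucurve))).
  have [sa1 sa2] := a_sqint c.
  have sq : sqint W (fun x => sqm eps x - 1) by apply: cnt_sqint; exact: sqm1c.
  have v1i : itg W (fun x => `|u1 x ^+ 2 - a1 eps x ^+ 2|).
    by apply: itg_norm => //; apply: itgB => //; [case: su1|case: sa1].
  have v2i : itg W (fun x => `|u2 x ^+ 2 - a2 eps x ^+ 2|).
    by apply: itg_norm => //; apply: itgB => //; [case: su2|case: sa2].
  have v3i : itg W (fun x => `|1| * `|sqm eps x - 1|).
    apply: itgZ => //; apply: itg_norm => //; exact: sqint_itg.
  apply: (@le_trans _ _ (ig (-1) 2 (fun x => `|u1 x ^+ 2 - a1 eps x ^+ 2|) +
     ig (-1) 2 (fun x => `|u2 x ^+ 2 - a2 eps x ^+ 2|) +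
     ig (-1) 2 (fun x => `|1| * `|sqm eps x - 1|))).
    rewrite -!igD//; last exact: itgD.
    apply: ig_le => //; first by do 2 apply: itgD => //.
    move=> x _; rewrite /v normr1 mul1r.
    rewrite (_ : u1 x ^+ 2 + _ - 1 = (u1 x ^+ 2 - a1 eps x ^+ 2) +
      (u2 x ^+ 2 - a2 eps x ^+ 2) + (sqm eps x - 1)); last by rewrite /sqmod; ring.
    by rewrite (le_trans (ler_normD _ _))// lerD2r ler_normD.
  have D1 := diff _ _ sa1 su1; have D2 := diff _ _ sa2 su2.
  have D3 := cauchy_schwarz_norm mW (sqint_cst 1 mW Wy) sq.
  have sqr_le (z : R) : 0 <= z -> z <= t -> z ^+ 2 <= e.
    move=> z0 zt; rewrite (le_trans _ te)// (le_trans _ zt)// expr2 ler_piMr//.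
    exact: le_trans t1.
  have N1 := nrm_ge0 W u1; have N2 := nrm_ge0 W u2; have N3 := nrm_ge0 W (fun=> 1 : R).
  have Q1 := sqr_le _ (nrm_ge0 _ _) H1; have Q2 := sqr_le _ (nrm_ge0 _ _) H2.
  have P1 := ler_wpM2r N1 (le_trans H1 te); have P2 := ler_wpM2r N2 (le_trans H2 te).
  have P3 := ler_wpM2l N3 (le_trans H3 te).
  rewrite (le_trans (lerD (lerD D1 D2) D3))//.
  by lra.
move=> H; have := Rintegral_ge0_eq0 mW vi (fun x _ => normr_ge0 _) H.
by apply: aeS => x E Wx; have /eqP := E Wx; rewrite normr_eq0 subr_eq0 => /eqP.
Qed.

Let torque_sqint01 eps : curve eps -> sqint `[0, 1] (fun x => torque eps x - n0).
Proof.
move=> c; apply: sqintB => //; last exact: sqint_cst.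
by apply: sqintS (torque_sqint c).
Qed.

Lemma nrm_torque_le (Q : R) :
  U [set eps | L / 2 * ig 0 1 (fun x => (torque eps x - n0) ^+ 2) <= Q] ->
  U [set eps | nrm `[0, 1] (fun x => torque eps x - n0) <= Num.sqrt (2 / L * Q)].
Proof.
apply: filterS => eps /= H; rewrite ler_wsqrtr//.
set I := ig 0 1 _ in H *; have -> : I = 2 / L * (L / 2 * I) by field; rewrite gt_eqF.
by rewrite ler_wpM2l// divr_ge0// ltW.
Qed.

Lemma torque_energy_le :
  U [set eps | L / 2 * ig 0 1 (fun x => (torque eps x - n0) ^+ 2) <= M].
Proof.
apply: filterS (filterI Uenergy (Ueps (ltr01))) => eps /= [En /andP[eps0 _]].
apply: le_trans En; rewrite lerDr ig_ge0// => x _.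
exact: mm_density_ge0.
Qed.

(** The last clause is kept for every bound [C], so that the sharper one that remains after paying
    for the dips can be inserted later. *)
Lemma torque_weak_limit : exists g0, [/\ sqint `[0, 1] g0,
  (forall h, sqint `[0, 1] h -> forall e : R, 0 < e ->
     U [set eps | `|ig 0 1 (fun x => (torque eps x - n0) * h x) -
                    ig 0 1 (fun x => g0 x * h x)| <= e]) &
  (forall C, U [set eps | nrm `[0, 1] (fun x => torque eps x - n0) <= C] ->
     nrm `[0, 1] g0 <= C)].
Proof.
apply: (@ultra_weak_limit _ _ U UU `[0, 1] (fun eps x => torque eps x - n0)
  (Num.sqrt (2 / L * M))) => //.
apply: filterS (filterI Ucurve (nrm_torque_le torque_energy_le)) => eps /= [c H].
by split => //; exact: torque_sqint01.
Qed.

Let nrm_sub (D E : set R) f : mset D -> mset E -> D `<=` E -> sqint E f -> nrm D f <= nrm E f.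
Proof.
move=> mD mE DE [_ fi]; rewrite ler_wsqrtr// le_Rintegral_set// => x _.
exact: sqr_ge0.
Qed.

(** Away from dips normalisation is a small perturbation: [c / rho] and [c / rho^3] differ from [c]
    by multiples of the quantity that the potential makes small. The second factor blows up as [d]
    tends to 0, so dips have to be excluded. *)
Lemma unit_deviation (c d rho : R) : 0 < d -> d <= rho -> `|c| <= rho ->
  `|c - c / rho| <= `|rho ^+ 2 - 1| /\
  `|c / rho ^+ 3 - c| <= (d^-1 ^+ 2 + d^-1) * `|rho ^+ 2 - 1|.
Proof.
move=> d0 dr cr; have r0 : 0 < rho by exact: lt_le_trans dr.
have rn : rho != 0 by rewrite gt_eqF.
have E : `|rho ^+ 2 - 1| = `|rho - 1| * (rho + 1).
  by rewrite -[rho + 1]gtr0_norm ?addr_gt0// -normrM; congr (`| _ |); ring.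
have cr1 : `|c / rho| <= 1 by rewrite normrM normfV (gtr0_norm r0) ler_pdivrMr// mul1r.
split.
  rewrite (_ : c - c / rho = c / rho * (rho - 1)); last by field.
  rewrite normrM E (le_trans (ler_wpM2r (normr_ge0 _) cr1))// mul1r ler_peMr//.
  by rewrite lerDr ltW.
rewrite (_ : c / rho ^+ 3 - c = c / rho * ((1 - rho) * ((1 + rho + rho ^+ 2) / rho ^+ 2))); last by field.
rewrite normrM (le_trans (ler_wpM2r (normr_ge0 _) cr1))// mul1r normrM distrC E.
rewrite mulrCA ler_wpM2l//.
have p0 : 0 <= (1 + rho + rho ^+ 2) / rho ^+ 2.
  by rewrite divr_ge0 ?addr_ge0 ?exprn_ge0// ltW.
rewrite ger0_norm// (@le_trans _ _ ((rho^-1 ^+ 2 + rho^-1) * (rho + 1)))//.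
  rewrite (_ : (rho^-1 ^+ 2 + rho^-1) * (rho + 1) = (1 + rho + rho ^+ 2 + rho) / rho ^+ 2); last by field.
  by rewrite ler_wpM2r ?invr_ge0 ?exprn_ge0 ?(ltW r0)// lerDl ltW.
have ri : rho^-1 <= d^-1 by rewrite lef_pV2.
have ri0 : 0 <= rho^-1 by rewrite invr_ge0 ltW.
by rewrite ler_wpM2r ?addr_ge0 ?(ltW r0)// lerD// lerXn2r ?nnegrE// (le_trans ri0).
Qed.

(** Limit passage in the weak form of [w1' = - (torque / rho^2) w2]. The right-hand side pairs the
    weakly convergent torque with the strongly convergent [c2 / rho^3]. The curve [(c1, c2)] stands
    for [(a1, a2)] and for its quarter turn [(a2, - a1)], which has the same modulus and torque, so
    that one statement yields both components. *)
Lemma local_weak_equation (c1 c2 d1 d2 : R -> R -> R) (v1 v2 g0 phi : R -> R) (p q d : R) :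
  -1 <= p -> p < q -> q <= 2 -> 0 < d -> test_fun `]p, q[ phi ->
  (forall eps, curve eps -> [/\ prim (-1) 2 (c1 eps) (d1 eps), prim (-1) 2 (c2 eps) (d2 eps),
     sqmod (c1 eps) (c2 eps) = sqm eps &
     (fun x => c1 eps x * d2 eps x - c2 eps x * d1 eps x) = torque eps]) ->
  sqint W v1 -> sqint W v2 ->
  (forall e : R, 0 < e -> U [set eps | nrm W (fun x => c1 eps x - v1 x) <= e]) ->
  (forall e : R, 0 < e -> U [set eps | nrm W (fun x => c2 eps x - v2 x) <= e]) ->
  U [set eps | forall y, p <= y <= q -> d ^+ 2 <= sqm eps y] ->
  sqint `[0, 1] g0 ->
  (forall h, sqint `[0, 1] h -> forall e : R, 0 < e ->
     U [set eps | `|ig 0 1 (fun x => (torque eps x - n0) * h x) -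
                    ig 0 1 (fun x => g0 x * h x)| <= e]) ->
  ig p q (fun x => v1 x * derive1 phi x) =
  ig p q (fun x => (if 0 < x < 1 then g0 x + n0 else 0) * v2 x * phi x).
Proof.
move=> lp pq q2 d0 tphi rot sv1 sv2 cvv1 cvv2 away sg0 wlim.
set g := fun x => if 0 < x < 1 then g0 x + n0 else 0.
have [dphi cphi phi0 cphi'] := test_funE tphi.
have out x : ~ (p < x < q) -> phi x = 0 /\ derive1 phi x = 0.
  by move=> nx; have [|e e0] := phi0 x; [rewrite /= in_itv|apply; rewrite subrr normr0].
have mK : mset `[p, q] by exact: measurable_itv.
have KW : `[p, q] `<=` W by apply: subset_itv; rewrite bnd_simp.
have Ky : (mu `[p, q]%classic < +oo)%E by exact: (@mu_itv_lty _ _ p q).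
have [B HB] := cnt_bounded (@continuous_cnt _ (-1) 2 _ cphi).
have B0 : 0 <= B by apply: le_trans (HB 0 _) => //; apply/andP; split; lra.
have mphi D : mset D -> mfun_on D phi.
  by move=> mD; exact: measurable_funTS (continuous_measurable_fun cphi).
have sphi' : sqint `[p, q] (derive1 phi) by apply: cnt_sqint; exact: continuous_cnt.
have sv2phi : sqint W (fun x => phi x * v2 x).
  by apply: (@sqintM _ _ _ _ B) => //; exact: mphi.
have sv2phi01 : sqint `[0, 1] (fun x => phi x * v2 x) by exact: sqintS sv2phi.
have sgW : sqint W g.
  have Soo : `](0 : R), 1[%classic `<=` `[0, 1] by apply: subset_itv; rewrite bnd_simp.
  have s1 : sqint `]0, 1[ (fun x => g0 x + n0).
    by apply: sqintS Soo _ => //; apply: sqintD => //; exact: sqint_cst.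
  have s2 : sqint `]0, 1[ g.
    by apply: eq_sqint s1 => // x; rewrite /= in_itv/= /g => ->.
  apply: sqint_sub0 s2 => //; first exact: subset_trans S01.
  by move=> x _; rewrite /= in_itv/= /g => /negP/negbTE ->.
pose psi x := phi x * v2 x.
have toW (f : R -> R) : ig p q (fun x => f x * psi x) = ig (-1) 2 (fun x => f x * psi x).
  rewrite (@Rintegral_sub0 _ `[p, q] W)// => x _ nx.
  rewrite /psi (out x _).1 ?mul0r ?mulr0// => /andP[px xq]; apply: nx.
  by rewrite /= in_itv/= !ltW.
have to01 (f : R -> R) : (forall x, ~ (0 < x < 1) -> f x = 0) ->
    ig (-1) 2 (fun x => f x * psi x) = ig 0 1 (fun x => f x * psi x).
  move=> f0; rewrite (@Rintegral_sub0 _ `[0, 1] W)// => x _ nx.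
  rewrite f0 ?mul0r// => /andP[x0 x1]; apply: nx.
  by rewrite /= in_itv/= !ltW.
have gpsi : ig p q (fun x => g x * v2 x * phi x) =
    ig 0 1 (fun x => g0 x * psi x) + n0 * ig 0 1 psi.
  rewrite (@eq_ig _ _ _ _ (fun x => g x * psi x)); last by move=> x _; rewrite /psi; ring.
  rewrite toW to01; last by move=> x /negP/negbTE; rewrite /g => ->.
  have i1 : itgi 0 1 (fun x => g0 x * psi x) by exact: sqint_itgM.
  have i2 : itgi 0 1 (fun x => n0 * psi x) by apply: itgZ => //; exact: sqint_itg.
  have i3 : itgi 0 1 (fun x => g x * psi x) by apply: sqint_itgM => //; exact: sqintS sgW.
  rewrite -igZ; last exact: sqint_itg.
  rewrite -igD// -(ig_oo i3) -(ig_oo (itgD m01 i1 i2)).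
  by apply: eq_Rintegral => x; rewrite inE/= in_itv/= /g => ->; ring.
apply/eqP; rewrite -subr_eq0 -normr_le0.
pose Cd := d^-1 ^+ 2 + d^-1.
pose Cj := Num.sqrt (2 / L * M) + nrm `[0, 1] (fun=> n0).
have Cd0 : 0 <= Cd by rewrite addr_ge0 ?exprn_ge0 ?invr_ge0 ?ltW.
have Cj0 : 0 <= Cj by rewrite addr_ge0 ?sqrtr_ge0 ?nrm_ge0.
(* One summand for each of the three errors separated in [split3]. *)
apply: (@small_le0 _ (2 * nrm `[p, q] (derive1 phi) + B * Cj * (Cd + 1) + 1)) => e e0.
have [eps [/= c [H1 [H2 [H3 [H4 [H5 H6]]]]]]] := filter_ex (filterI Ucurve
  (filterI (cvv1 e e0) (filterI (cvv2 e e0) (filterI (potential_small e0)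
  (filterI away (filterI (wlim _ sv2phi01 e e0) (nrm_torque_le torque_energy_le))))))).
have [pc1 pc2 sqE tqE] := rot eps c.
have tE x : c1 eps x * d2 eps x - c2 eps x * d1 eps x = torque eps x.
  by rewrite -tqE.
have K1 : prim p q (c1 eps) (d1 eps) by exact: primS pc1.
have K2 : prim p q (c2 eps) (d2 eps) by exact: primS pc2.
have c1c := prim_cnt K1; have c2c := prim_cnt K2.
have sq0 x : p <= x <= q -> 0 < sqm eps x.
  by move=> /H4; apply: lt_le_trans; rewrite exprn_gt0.
pose rho x := Num.sqrt (sqm eps x).
have rhod x : p <= x <= q -> d <= rho x.
  by move=> /H4 H; rewrite -[d]ger0_norm ?(ltW d0)// -sqrtr_sqr ler_wsqrtr.
have rho2 x : rho x ^+ 2 = sqm eps x by rewrite sqr_sqrtr// sqmod_ge0.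
have cle x : `|c1 eps x| <= rho x /\ `|c2 eps x| <= rho x.
  rewrite /rho -sqE /sqmod -!sqrtr_sqr; split; rewrite ler_wsqrtr//.
    by rewrite lerDl sqr_ge0.
  by rewrite lerDr sqr_ge0.
have rc : cnt p q rho.
  by apply: cnt_sqrt; rewrite -sqE; exact: sqmod_cnt.
have rn0 x : p <= x <= q -> rho x != 0.
  by move=> xpq; rewrite gt_eqF// sqrtr_gt0 sq0.
have := unit_vector_weak pq K1 K2; rewrite sqE => /(_ phi sq0 tphi).
rewrite (@eq_ig _ _ _ (fun x => c2 eps x * _ / _ * _)
  (fun x => torque eps x * phi x * (c2 eps x / rho x ^+ 3))); last first.
  by move=> x _; rewrite tE -/(rho x); ring.
move=> UV.
have sm1 : sqint W (fun x => sqm eps x - 1) by apply: cnt_sqint; exact: sqm1c.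
have sc1 : sqint `[p, q] (c1 eps) by exact: cnt_sqint.
have sc2 : sqint `[p, q] (c2 eps) by exact: cnt_sqint.
have sw1 : sqint `[p, q] (fun x => c1 eps x / rho x).
  by apply: cnt_sqint; apply: cntM => //; exact: cntV.
have sw2 : sqint `[p, q] (fun x => c2 eps x / rho x ^+ 3).
  apply: cnt_sqint; apply: cntM => //; apply: cntV => [|x xpq]; last by rewrite expf_neq0 ?rn0.
  exact: (cntM rc (cntM rc rc)).
have st : sqint `[p, q] (fun x => phi x * torque eps x).
  have tK : sqint `[p, q] (torque eps) by exact: sqintS (torque_sqint c).
  apply: (@sqintM _ _ _ _ B) => //; first exact: mphi.
  by move=> x /KW; exact: HB.
have sv1K : sqint `[p, q] v1 by exact: sqintS sv1.
have sv2K : sqint `[p, q] v2 by exact: sqintS sv2.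
have D1 : nrm `[p, q] (fun x => v1 x - c1 eps x / rho x) <= 2 * e.
  rewrite (@eq_nrm _ _ _ (fun x => (-1) * (c1 eps x - v1 x) + (c1 eps x - c1 eps x / rho x))).
    have sB : sqint `[p, q] (fun x => c1 eps x - v1 x) by exact: sqintB.
    rewrite (le_trans (nrmD mK (sqintZ _ mK sB) (sqintB mK sc1 sw1)))// nrmZ// normrN1 mul1r.
    rewrite mulr_natl mulr2n lerD//.
      apply: le_trans H1; apply: nrm_sub => //.
      by apply: sqintB => //; apply: cnt_sqint; exact: prim_cnt pc1.
    apply: le_trans H3; apply: (@le_trans _ _ (nrm `[p, q] (fun x => sqm eps x - 1))).
      apply: nrm_le => //; [exact: sqintB|exact: sqintS sm1|move=> x].
      rewrite /= in_itv/= => xpq; rewrite -rho2.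
      exact: (unit_deviation d0 (rhod x xpq) (cle x).1).1.
    exact: nrm_sub.
  by move=> x _; ring.
have D2 : nrm `[p, q] (fun x => c2 eps x / rho x ^+ 3 - v2 x) <= (Cd + 1) * e.
  rewrite (@eq_nrm _ _ _ (fun x => (c2 eps x / rho x ^+ 3 - c2 eps x) + (c2 eps x - v2 x))).
    rewrite (le_trans (nrmD mK (sqintB mK sw2 sc2) (sqintB mK sc2 sv2K)))// mulrDl mul1r lerD//.
      apply: (@le_trans _ _ (nrm `[p, q] (fun x => Cd * (sqm eps x - 1)))).
        apply: nrm_le => //; [exact: sqintB|by apply: sqintZ => //; exact: sqintS sm1|move=> x].
        rewrite /= in_itv/= => xpq; rewrite normrM [`|Cd|]ger0_norm// -rho2.
        exact: (unit_deviation d0 (rhod x xpq) (cle x).2).2.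
      rewrite nrmZ//; last exact: sqintS sm1.
      rewrite ger0_norm// ler_wpM2l//; apply: le_trans H3; exact: nrm_sub.
    apply: le_trans H2; apply: nrm_sub => //.
    by apply: sqintB => //; apply: cnt_sqint; exact: prim_cnt pc2.
  by move=> x _; ring.
have D3 : nrm `[p, q] (fun x => phi x * torque eps x) <= B * Cj.
  apply: (@le_trans _ _ (nrm `[p, q] (fun x => B * torque eps x))).
    apply: nrm_le => //.
      by apply: sqintZ => //; exact: sqintS (torque_sqint c).
    move=> x /KW; rewrite /= in_itv/= => xW.
    by rewrite !normrM ler_wpM2r// (le_trans (HB x xW))// ler_norm.
  rewrite nrmZ//; last exact: sqintS (torque_sqint c).
  rewrite ger0_norm// ler_wpM2l//.
  apply: (@le_trans _ _ (nrm W (torque eps))); first by apply: nrm_sub => //; exact: torque_sqint.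
  have -> : nrm W (torque eps) = nrm `[0, 1] (torque eps).
    congr Num.sqrt; apply: Rintegral_sub0 => // x _ nx.
    rewrite torque_out ?expr0n// => /andP[x0 x1]; apply: nx.
    by rewrite /= in_itv/= !ltW.
  rewrite (@eq_nrm _ _ _ (fun x => (torque eps x - n0) + n0)); last by move=> x _; rewrite subrK.
  rewrite (le_trans (nrmD m01 (torque_sqint01 c) (sqint_cst n0 m01 y01)))// lerD2r.
  exact: H6.
(* The errors are the strong convergence of [c1 / rho], that of [c2 / rho^3] against a bounded
   torque, and the weak convergence of the torque against the fixed [psi]. The change of domain is
   possible because [psi] vanishes off []p, q[] and the torque off []0, 1[]. *)
have split3 : ig p q (fun x => v1 x * derive1 phi x) - ig p q (fun x => g x * v2 x * phi x) =
  ig p q (fun x => (v1 x - c1 eps x / rho x) * derive1 phi x) +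
  ig p q (fun x => (phi x * torque eps x) * (c2 eps x / rho x ^+ 3 - v2 x)) +
  (ig 0 1 (fun x => (torque eps x - n0) * psi x) - ig 0 1 (fun x => g0 x * psi x)).
  rewrite (@eq_ig _ _ _ (fun x => (v1 x - _) * _)
    (fun x => v1 x * derive1 phi x - c1 eps x / rho x * derive1 phi x)); last first.
    by move=> x _; rewrite mulrBl.
  rewrite igB; [|exact: sqint_itgM..].
  rewrite UV.
  rewrite (@eq_ig _ _ _ (fun x => (phi x * torque eps x) * _)
    (fun x => torque eps x * phi x * (c2 eps x / rho x ^+ 3) - torque eps x * psi x)); last first.
    by move=> x _; rewrite /psi; ring.
  have it1 : itgi p q (fun x => torque eps x * phi x * (c2 eps x / rho x ^+ 3)).
    by apply: eq_itgi (sqint_itgM mK st sw2) => // x _; ring.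
  have it2 : itgi p q (fun x => torque eps x * psi x).
    by apply: eq_itgi (sqint_itgM mK st sv2K) => // x _; rewrite /psi; ring.
  rewrite igB// toW to01; last by move=> x; exact: torque_out.
  rewrite (@eq_ig _ _ _ (fun x => (torque eps x - n0) * psi x)
    (fun x => torque eps x * psi x - n0 * psi x)); last by move=> x _; rewrite mulrBl.
  have it3 : itgi 0 1 (fun x => torque eps x * psi x).
    by apply: sqint_itgM => //; exact: sqintS (torque_sqint c).
  rewrite igB//; last by apply: itgZ => //; exact: sqint_itg.
  rewrite igZ; last exact: sqint_itg.
  by rewrite gpsi; ring.
rewrite split3 (le_trans (ler_normD _ _))// !mulrDl mul1r lerD//; last first.
  by rewrite mul1r; exact: H5.
rewrite (le_trans (ler_normD _ _))// lerD//.
  rewrite (le_trans (cauchy_schwarz mK (sqintB mK sv1K sw1) sphi'))//.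
  rewrite -mulrDr mulrC ler_wpM2l ?nrm_ge0// (le_trans D1)//.
  by rewrite mulr_natl mulr2n.
rewrite (le_trans (cauchy_schwarz mK st (sqintB mK sw2 sv2K)))//.
by rewrite -mulrA ler_pM ?nrm_ge0.
Qed.

(** The smallness of the potential provides, on each flank of a dip, a point with modulus close to
    1, so the modulus has to go down and up again in between. The neighbourhoods are disjoint, hence
    the costs add up. *)
Lemma dips_cost (d : R) (s : seq R) : 0 < d -> d <= 1 -> uniq s ->
  (forall x, x \in s -> dips d x) ->
  U [set eps | (size s)%:R * (2 * Num.sqrt 2 / 3 - 2 * Num.sqrt 2 * d) <= ig (-1) 2 (mmd eps)].
Proof.
move=> d0 d1 us sd.
have [|r r0 [rW rsep]] := @seq_separated _ (-1) 2 s us.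
  by move=> x /sd[].
(* Squared, this is [d^2 r / 4], below the threshold [d^2 r] of [exists_near_one] on a flank of
   length [r]. *)
have dr0 : 0 < d * Num.sqrt r / 2 by rewrite divr_gt0// mulr_gt0// sqrtr_gt0.
have Udip : U [set eps | forall x, x \in s ->
    exists y, [/\ -1 <= y <= 2, `|y - x| < r & sqm eps y < d ^+ 2]].
  by apply: (@filter_seq _ _ U) => x /sd[_]; exact.
apply: filterS (filterI Ucurve (filterI (Ueps ltr01) (filterI (potential_small dr0) Udip))).
move=> eps /= [c [/andP[eps0 _] [Hpot Hdip]]].
have [p1 p2 s1 s2 _] := c.
have c1 := prim_cnt p1; have c2 := prim_cnt p2.
have mmi : itgi (-1) 2 (mmd eps) by exact: mm_density_itgi.
apply: (@disjoint_intervals_cost _ r _ _ _ W) => //.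
- by move=> x _; exact: mm_density_ge0.
- by move=> x /rW[? ?]; apply: subset_itv; rewrite bnd_simp.
move=> x xs; have [lx xl] := rW x xs.
have [y [_ yx qy]] := Hdip x xs.
have pot p q : -1 <= p -> q <= 2 -> q - p = r ->
    ig p q (fun x => (sqm eps x - 1) ^+ 2) < d ^+ 2 * (q - p).
  move=> lp q2 qp; rewrite qp.
  have qi : itgi (-1) 2 (fun x => (sqm eps x - 1) ^+ 2).
    by apply: cnt_itg; exact: (cntM (sqm1c c) (sqm1c c)).
  apply: (@le_lt_trans _ _ (ig (-1) 2 (fun x => (sqm eps x - 1) ^+ 2))).
    apply: le_Rintegral_set => // [|z _]; last exact: sqr_ge0.
    by apply: subset_itv; rewrite bnd_simp.
  rewrite -sqr_nrm; apply: (@le_lt_trans _ _ ((d * Num.sqrt r / 2) ^+ 2)).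
    by rewrite lerXn2r ?nnegrE ?nrm_ge0 ?(ltW dr0).
  rewrite exprMn exprMn sqr_sqrtr ?(ltW r0)// gtr_pMr ?mulr_gt0 ?exprn_gt0//.
  by rewrite expr2 -invfM invf_lt1 ?mulr_gt0//; lra.
have near p q : -1 <= p -> q <= 2 -> q - p = r ->
    exists2 z, p <= z <= q & `|sqm eps z - 1| <= d.
  move=> lp q2 qp; apply: (exists_near_one d0) => //; first by rewrite -subr_gt0 qp.
  - exact: cntS c1.
  - exact: cntS c2.
  - exact: pot.
have [||| z1 /andP[z1l z1r] q1] := near (x - 2 * r) (x - r); try lra.
have [||| z2 /andP[z2l z2r] q2] := near (x + r) (x + 2 * r); try lra.
move: yx; rewrite ltr_norml => /andP[yx1 yx2].
have z1W : -1 <= z1 by lra.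
have z2W : z2 <= 2 by lra.
have Sz : `[z1, z2] `<=` W by apply: subset_itv; rewrite bnd_simp.
apply: (@le_trans _ _ (ig z1 z2 (mmd eps))).
  have [z1y yz2] : z1 <= y /\ y <= z2 by split; lra.
  apply: (@crossing_cost _ eps d z1 z2 y _ _ _ _ eps0 d0 d1 z1y yz2 _ _ _ _ q1 q2 (ltW qy)).
  - exact: primS p1.
  - exact: primS p2.
  - exact: sqintS s1.
  - exact: sqintS s2.
apply: le_Rintegral_set => //.
- by apply: subset_itv; rewrite bnd_simp; lra.
- by move=> z _; exact: mm_density_ge0.
- exact: itgiS mmi.
Qed.

(** The last clause couples the two parts of the energy: what is left of [M] after paying for the
    dips bounds the torque energy along the ultrafilter, and this bound survives in the weak
    limit. *)
Theorem lower_bound_family : exists g, [/\ sqint W g,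
  forall x, ~ (0 < x < 1) -> g x = 0,
  forall d x, 0 < d -> -1 < x < 2 -> ~ dips d x -> exists2 r, 0 < r &
    [/\ -1 <= x - r, x + r <= 2 & forall phi, test_fun `]x - r, x + r[ phi ->
      ig (x - r) (x + r) (fun y => u1 y * derive1 phi y) =
        ig (x - r) (x + r) (fun y => g y * u2 y * phi y) /\
      ig (x - r) (x + r) (fun y => u2 y * derive1 phi y) =
        - ig (x - r) (x + r) (fun y => g y * u1 y * phi y)] &
  forall d s, 0 < d -> d <= 1 -> uniq s -> (forall x, x \in s -> dips d x) ->
    L / 2 * ig 0 1 (fun x => (g x - n0) ^+ 2)
      + (size s)%:R * (2 * Num.sqrt 2 / 3 - 2 * Num.sqrt 2 * d) <= M].
Proof.
have [g0 [sg0 wlim g0le]] := torque_weak_limit.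
pose g x := if 0 < x < 1 then g0 x + n0 else 0.
have Soo : `](0 : R), 1[%classic `<=` `[0, 1] by apply: subset_itv; rewrite bnd_simp.
have sgW : sqint W g.
  have s1 : sqint `]0, 1[ (fun x => g0 x + n0).
    by apply: sqintS Soo _ => //; apply: sqintD => //; exact: sqint_cst.
  have s2 : sqint `]0, 1[ g.
    by apply: eq_sqint s1 => // x; rewrite /= in_itv/= /g => ->.
  apply: sqint_sub0 s2 => //; first exact: subset_trans S01.
  by move=> x _; rewrite /= in_itv/= /g => /negP/negbTE ->.
exists g; split => //.
- by move=> x /negP/negbTE; rewrite /g => ->.
- move=> d x d0 xW nd.
  have [r r0 nU] : exists2 r, 0 < r & ~ U [set eps | exists y,
      [/\ -1 <= y <= 2, `|y - x| < r & sqm eps y < d ^+ 2]].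
    apply: contrapT => H; apply: nd; split => // r r0; apply: contrapT => nU.
    by apply: H; exists r.
  have away := ultraN UU nU.
  move/andP: xW => [x1 x2].
  pose r' := Num.min (r / 2) (Num.min (x + 1) (2 - x)).
  have r'0 : 0 < r' by rewrite !lt_min divr_gt0// !subr_gt0 -ltrBlDr sub0r x1.
  have : r' <= r' by [].
  rewrite {2}/r' !le_min => /and3P[r1 r2 r3].
  have xr1 : -1 <= x - r' by lra.
  have xr2 : x + r' <= 2 by lra.
  have pq : x - r' < x + r' by lra.
  have away' : U [set eps | forall y, x - r' <= y <= x + r' -> d ^+ 2 <= sqm eps y].
    apply: filterS away => eps /= H y /andP[y1 y2]; rewrite leNgt; apply/negP => q.
    apply: H; exists y; split => //; first by apply/andP; split; lra.
    by rewrite ltr_norml; apply/andP; split; lra.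
  exists r' => //; split=> // phi tphi; split.
    apply: (@local_weak_equation a1 a2 b1 b2 u1 u2 g0 phi _ _ d) => //.
    by move=> eps [p1 p2 _ _ _]; split.
  have -> : - ig (x - r') (x + r') (fun y => g y * u1 y * phi y) =
      ig (x - r') (x + r') (fun y => g y * (-1 * u1 y) * phi y).
    have sg : sqint `[x - r', x + r'] g.
      by apply: sqintS sgW => //; apply: subset_itv; rewrite bnd_simp.
    have [_ cphi _ _] := test_funE tphi.
    have su : sqint `[x - r', x + r'] u1.
      by apply: sqintS su1 => //; apply: subset_itv; rewrite bnd_simp.
    rewrite -[LHS]mulN1r -igZ; first by apply: eq_ig => y _; ring.
    apply: eq_itgi (cntM_itg (continuous_cnt cphi) (sqint_itgM (measurable_itv _) sg su)) => // y _.
    by rewrite mulrC.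
  apply: (@local_weak_equation a2 (fun eps y => -1 * a1 eps y) b2 (fun eps y => -1 * b1 eps y)
    u2 (fun y => -1 * u1 y) g0 phi _ _ d) => //.
  + move=> eps [p1 p2 _ _ _]; split => //; first exact: primZ.
      by apply/funext => y; rewrite /sqmod; ring.
    by apply/funext => y; rewrite /torque; ring.
  + exact: sqintZ.
  + move=> e e0; apply: filterS (filterI Ucurve (cv1 e0)) => eps /= [c H].
    rewrite (@eq_nrm _ _ _ (fun y => -1 * (a1 eps y - u1 y))); last by move=> y _; ring.
    rewrite nrmZ ?normrN1 ?mul1r//.
    by apply: sqintB => //; have [] := a_sqint c.
- move=> d s d0 d1 us sd.
  set k := 2 * _ / 3 - _.
  have Uk : U [set eps | L / 2 * ig 0 1 (fun x => (torque eps x - n0) ^+ 2)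
      <= M - (size s)%:R * k].
    apply: filterS (filterI Uenergy (dips_cost d0 d1 us sd)) => eps /= [H1 H2].
    by rewrite lerBrDr (le_trans _ H1)// addrC lerD2r.
  have Q0 : 0 <= M - (size s)%:R * k.
    have [eps /= H] := filter_ex Uk; apply: le_trans H.
    by rewrite mulr_ge0 ?divr_ge0 ?(ltW L0)// ig_ge0// => x _; exact: sqr_ge0.
  have := g0le _ (nrm_torque_le Uk).
  have LQ0 : 0 <= 2 / L * (M - (size s)%:R * k) by rewrite mulr_ge0// divr_ge0// ltW.
  rewrite -ler_sqr ?nnegrE ?nrm_ge0 ?sqrtr_ge0// sqr_nrm sqr_sqrtr//.
  have -> : ig 0 1 (fun x => g0 x ^+ 2) = ig 0 1 (fun x => (g x - n0) ^+ 2).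
    have i1 : itgi 0 1 (fun x => g0 x ^+ 2) by case: sg0.
    have i2 : itgi 0 1 (fun x => (g x - n0) ^+ 2).
      have [] // : sqint `[0, 1] (fun x => g x - n0).
      by apply: sqintB => //; [exact: sqintS sgW|exact: sqint_cst].
    rewrite -(ig_oo i1) -(ig_oo i2); apply: eq_Rintegral => x.
    by rewrite inE/= in_itv/= /g => ->; ring.
  set I := ig 0 1 _ => H; rewrite -lerBrDr.
  have -> : M - (size s)%:R * k = L / 2 * (2 / L * (M - (size s)%:R * k)).
    by field; rewrite gt_eqF.
  by rewrite ler_wpM2l// divr_ge0// ltW.
Qed.

End LowerBound.

(** * Jump sets and the liminf inequality *)

Section NullSetsAndTraces.
Context {R : realType}.
Notation mu := (@lebesgue_measure R).
Implicit Types (a b x : R) (f g h : R -> R) (D J : set R).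

Lemma finite_mset J : finite_set J -> mset J.
Proof. by move=> fJ; apply: countable_measurable => //; exact: finite_set_countable. Qed.

Lemma open_setD_finite D J : open D -> finite_set J -> open (D `\` J).
Proof.
move=> oD fJ; apply: openI => //; rewrite openC.
have [H _] := @accessible_finite_set_closed R.
by apply: H fJ; apply: hausdorff_accessible; exact: Rhausdorff.
Qed.

(** The rational-interval covering of [ae_open_cover] again, here starting from one good
    neighbourhood per point. *)
Lemma ae_local D (P : R -> Prop) :
  (forall x, D x -> exists2 d, 0 < d & {ae mu, forall y, x - d < y < x + d -> P y}) ->
  {ae mu, forall x, D x -> P x}.
Proof.
move=> H.
pose Q (n : nat) x := if (unpickle n : option (rat * rat)) is Some pq
  then {ae mu, forall y, ratr pq.1 < y < ratr pq.2 -> P y} -> ratr pq.1 < x < ratr pq.2 -> P x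
  else True.
have : {ae mu, forall x, forall n, Q n x}.
  apply: ae_foralln => n; rewrite /Q; case: (unpickle n) => [[p q]/=|]; last exact: aeW.
  have [aP|naP] := pselect {ae mu, forall y, ratr p < y < ratr q -> P y}.
    by apply: aeS aP => x Hx _.
  by apply: aeW.
apply: aeS => x Hx Dx; have [d d0 aP] := H x Dx.
have [p /[!in_itv]/= /andP[p1 p2]] := @rat_in_itvoo R (x - d) x ltac:(lra).
have [q /[!in_itv]/= /andP[q1 q2]] := @rat_in_itvoo R x (x + d) ltac:(lra).
have := Hx (pickle (p, q)); rewrite /Q pickleK/=; apply; last by rewrite p2.
by apply: aeS aP => y Hy /andP[py yq]; apply: Hy; apply/andP; split; lra.
Qed.

Lemma finite_ae_notin J : finite_set J -> {ae mu, forall x, ~ J x}.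
Proof.
move=> fJ; exists J; split.
- exact: finite_mset.
- by apply: countable_lebesgue_measure0; exact: finite_set_countable.
- by move=> x /= /contrapT.
Qed.

Lemma Rintegral_setD_finite a b J f : finite_set J -> itgi a b f ->
  \int[mu]_(x in `]a, b[ `\` J) f x = ig a b f.
Proof.
move=> fJ fi; rewrite -ig_oo//; congr fine; apply/esym.
apply: (@negligible_integral _ _ _ mu `]a, b[ J) => //.
- exact: finite_mset.
- by apply: (itgS _ _ _ fi) => //; apply: subset_itv; rewrite bnd_simp.
- by apply: countable_lebesgue_measure0; exact: finite_set_countable.
Qed.

Lemma itg_le_ae D f g : mset D -> mfun_on D f ->
  {ae mu, forall x, D x -> `|f x| <= g x} -> itg D g -> itg D f.
Proof.
move=> mD mf fg gi; apply/integrableP; split; first exact/measurable_EFinP.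
have := itg_norm mD gi => /integrableP[mg]; apply: le_lt_trans.
apply: ae_ge0_le_integral => //.
- by apply: measurableT_comp => //; exact/measurable_EFinP.
- exact: measurableT_comp.
- apply: aeS fg => x H Dx /=; rewrite lee_fin normr_id (le_trans (H Dx))//.
  exact: ler_norm.
Qed.

Lemma cnt_fst_snd a b (v : R -> R * R) : {within `[a, b], continuous v} ->
  cnt a b (fst \o v) /\ cnt a b (snd \o v).
Proof.
move=> /subspace_continuousP vc.
have H x : a <= x <= b -> forall e : R, 0 < e -> exists2 d : R, 0 < d &
    forall y, a <= y <= b -> `|y - x| < d ->
    `|(v y).1 - (v x).1| <= e /\ `|(v y).2 - (v x).2| <= e.
  move=> xab e e0; have := vc x xab => /cvg_ballP/(_ _ e0).
  rewrite near_withinE => /nbhs_ballP[d /= d0 D].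
  exists d => // y yab yx; have [] := D y _ yab; first by rewrite /ball/= distrC.
  by rewrite /ball/= => h1 h2; split; rewrite distrC ltW.
by split=> x xab e e0; have [d d0 D] := H x xab e e0; exists d => // y yab yx;
  have [] := D y yab yx.
Qed.

Lemma cnt_pair a b f g : cnt a b f -> cnt a b g ->
  {within `[a, b], continuous (fun x => (f x, g x))}.
Proof.
move=> fc gc; apply/subspace_continuousP => x xab; apply/cvg_ballP => e e0.
have e2 : 0 < e / 2 by exact: divr_gt0.
have [d1 d10 D1] := fc x xab _ e2; have [d2 d20 D2] := gc x xab _ e2.
rewrite near_withinE; apply/nbhs_ballP; exists (Num.min d1 d2) => /=.
  by rewrite lt_min d10.
move=> y; rewrite /ball/= distrC lt_min => /andP[y1 y2] yab.
by split; rewrite /ball/= distrC (@le_lt_trans _ _ (e / 2))//;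
  [exact: D1|rewrite ltr_pdivrMr// ltr_pMr// ltr1n|exact: D2|rewrite ltr_pdivrMr// ltr_pMr// ltr1n].
Qed.

Lemma right_traceP a b (u : R -> R * R) f g : a < b -> cnt a b f -> cnt a b g ->
  {ae mu, forall x, a < x < b -> u x = (f x, g x)} ->
  forall l, right_trace u a l <-> l = (f a, g a).
Proof.
move=> ab fc gc ufg l; split=> [[d [d0 [v [vc uv va]]]]|->].
  have [v1 v2] := cnt_fst_snd vc.
  pose b' := Num.min b (a + d).
  have ab' : a < b' by rewrite lt_min ab/= ltrDl.
  have bb : b' <= b by rewrite ge_min lexx.
  have bd : b' <= a + d by rewrite ge_min lexx orbT.
  have E : {ae mu, forall x, a < x < b' -> v x = (f x, g x)}.
    apply: aeS2 uv ufg => x H1 H2 /andP[ax xb].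
    rewrite -H1/= ?in_itv/= ?H2 ?ax//=; first by rewrite (lt_le_trans xb).
    by rewrite (lt_le_trans xb).
  have E1 : (fst \o v) a = f a.
    apply: (cnt_ae_eq ab' (cntS (lexx _) bd v1) (cntS (lexx _) bb fc)).
      by apply: aeS E => x H /H /= ->.
    by rewrite lexx ltW.
  have E2 : (snd \o v) a = g a.
    apply: (cnt_ae_eq ab' (cntS (lexx _) bd v2) (cntS (lexx _) bb gc)).
      by apply: aeS E => x H /H /= ->.
    by rewrite lexx ltW.
  by rewrite -va -E1 -E2/=; case: (v a).
exists (b - a); split; first by rewrite subr_gt0.
exists (fun x => (f x, g x)); rewrite subrKC; split => //; exact: cnt_pair.
Qed.

Lemma left_traceP a b (u : R -> R * R) f g : a < b -> cnt a b f -> cnt a b g ->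
  {ae mu, forall x, a < x < b -> u x = (f x, g x)} ->
  forall l, left_trace u b l <-> l = (f b, g b).
Proof.
move=> ab fc gc ufg l; split=> [[d [d0 [v [vc uv va]]]]|->].
  have [v1 v2] := cnt_fst_snd vc.
  pose a' := Num.max a (b - d).
  have ab' : a' < b by rewrite gt_max ab/= ltrBlDr ltrDl.
  have aa : a <= a' by rewrite le_max lexx.
  have ad : b - d <= a' by rewrite le_max lexx orbT.
  have E : {ae mu, forall x, a' < x < b -> v x = (f x, g x)}.
    apply: aeS2 uv ufg => x H1 H2 /andP[ax xb].
    rewrite -H1/= ?in_itv/= ?H2 ?xb ?andbT//; first by rewrite (le_lt_trans aa).
    by rewrite (le_lt_trans ad).
  have E1 : (fst \o v) b = f b.
    apply: (cnt_ae_eq ab' (cntS ad (lexx _) v1) (cntS aa (lexx _) fc)).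
      by apply: aeS E => x H /H /= ->.
    by rewrite lexx ltW.
  have E2 : (snd \o v) b = g b.
    apply: (cnt_ae_eq ab' (cntS ad (lexx _) v2) (cntS aa (lexx _) gc)).
      by apply: aeS E => x H /H /= ->.
    by rewrite lexx ltW.
  by rewrite -va -E1 -E2/=; case: (v b).
exists (b - a); split; first by rewrite subr_gt0.
exists (fun x => (f x, g x)); rewrite opprB addrC subrK; split => //; exact: cnt_pair.
Qed.

Definition extend (l r : R) (f : R -> R) (x : R) : R :=
  if x <= 0 then l else if 1 <= x then r else f x.

Definition extend0 (g : R -> R) (x : R) : R := if 0 < x < 1 then g x else 0.

Lemma extend_prim F g : prim 0 1 F g ->
  prim (-1) 2 (extend (F 0) (F 1) F) (extend0 g).
Proof.
move=> pF; apply: (@prim_cat _ _ 0); [lra|lra| |apply: (@prim_cat _ _ 1); [lra|lra| |]].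
- apply: eq_prim (prim_cst (-1) 0 (F 0)) => x /andP[_ x0]; rewrite ?/extend ?x0//.
  by rewrite /extend0 ltNge x0.
- have {}pF : prim 0 1 F (extend0 g).
    apply: (prim_ae _ _ pF).
      apply: (@measurable_fun_itv_cc R 0 1 false true).
      have m : mfun_on `]0, 1[ g.
        case: pF => gi _; apply: itg_measurable => //.
        by apply: (itgS _ _ _ gi) => //; apply: subset_itv; rewrite bnd_simp.
      by apply: eq_measurable_fun m => x; rewrite inE/= in_itv/= /extend0 => ->.
    have f01 : finite_set [set (0 : R); 1] by [].
    apply: aeS (finite_ae_notin f01) => x nx /andP[x0 x1]; rewrite /extend0 ifT//.
    by rewrite !lt_neqAle x0 x1 !andbT; apply/andP; split; apply/eqP => E;
      apply: nx; [left|right].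
  apply: eq_prim pF => // x /andP[x0 x1]; rewrite /extend.
  have [x0'|x0'] := leP x 0; first by congr F; apply/eqP; rewrite eq_le x0 x0'.
  by have [x1'|//] := leP 1 x; congr F; apply/eqP; rewrite eq_le x1 x1'.
- apply: eq_prim (prim_cst 1 2 (F 1)) => x /andP[x1 _].
    by rewrite /extend x1; case: (leP x 0) => //; lra.
  by rewrite /extend0 [x < 1]ltNge x1 andbF.
Qed.

Lemma extend0_sqint g : sqint `]0, 1[ g -> sqint `[(-1), 2] (extend0 g).
Proof.
move=> sg; have s : sqint `]0, 1[ (extend0 g).
  by apply: eq_sqint sg => // x; rewrite /= in_itv/= /extend0 => ->.
apply: sqint_sub0 s => //; first by apply: subset_itv; rewrite bnd_simp; lra.
by move=> x _ /negP/negbTE; rewrite in_itv/= /extend0 => ->.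
Qed.

Lemma extend_sqint (l r : R) f : sqint `]0, 1[ f -> sqint `[(-1), 2] (extend l r f).
Proof.
move=> sf; pose s01 := `](0 : R), 1[%classic.
have mW : mset `[(-1 : R), 2] by exact: measurable_itv.
have Wy : (mu `[(-1)%R : R, 2%R]%classic < +oo)%E by exact: (@mu_itv_lty _ _ (-1) 2).
have c1 : sqint `[(-1), 2] (fun x => if x <= 0 then l else 0).
  apply: (@sqint_bounded _ _ _ `|l|) => //; last by move=> x _; case: ifP; rewrite ?normr0.
  by apply: measurable_funTS; apply: measurable_fun_ifT => //; exact: measurable_fun_ler.
have c2 : sqint `[(-1), 2] (fun x => if 1 <= x then r else 0).
  apply: (@sqint_bounded _ _ _ `|r|) => //; last by move=> x _; case: ifP; rewrite ?normr0.
  by apply: measurable_funTS; apply: measurable_fun_ifT => //; exact: measurable_fun_ler.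
have := sqintD mW (sqintD mW c1 c2) (extend0_sqint sf).
apply: eq_sqint => // x _; rewrite /extend /extend0.
have [x0|x0] := leP x 0; first by rewrite leNgt (le_lt_trans x0)//= !addr0.
by have [x1|x1] := leP 1 x; rewrite /= add0r ?addr0 ?add0r.
Qed.

End NullSetsAndTraces.

(** * Energy and L^2 distance in terms of everywhere defined curves *)

Section EnergyOfCurves.
Context {R : realType}.
Notation mu := (@lebesgue_measure R).
Notation W := (`[(-1 : R), 2]%classic).
Implicit Types (x : R) (f g h : R -> R) (D J : set R) (u v : R -> R * R).

Lemma wderivP D f : H1 D f -> is_weak_deriv D f (wderiv D f).
Proof. by move=> [_ [g wg]]; rewrite /wderiv; apply: (xgetPex (fun=> 0)); exists g. Qed.

Lemma mset01 : mset (unit_interval : set R).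
Proof. exact: measurable_itv. Qed.

(** The values frozen outside []0, 1[] are the boundary values by the trace conditions, so extending
    creates no jump and the curve is absolutely continuous on all of [[-1, 2]]. *)
Lemma admissible_curve alpha u : admissible alpha u -> exists a1 a2 b1 b2 : R -> R,
  [/\ prim (-1) 2 a1 b1 /\ prim (-1) 2 a2 b2,
      sqint W b1 /\ sqint W b2,
      (forall x, ~ (0 < x < 1) -> b1 x = 0 /\ b2 x = 0),
      (forall x, (x <= 0 -> (a1 x, a2 x) = (1, 0)) /\ (1 <= x -> (a1 x, a2 x) = cis alpha)) &
      {ae mu, forall x, 0 < x < 1 -> u x = (a1 x, a2 x)} /\
      (forall x, 0 < x < 1 -> (b1 x, b2 x) = wderiv_vec unit_interval u x)].
Proof.
move=> [[h1 h2] r0 l1].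
have w1 := wderivP h1; have w2 := wderivP h2.
have [F1 p1 ae1] := weak_deriv_itv ltr01 (proj1 h1) w1.
have [F2 p2 ae2] := weak_deriv_itv ltr01 (proj1 h2) w2.
have aeu : {ae mu, forall x, 0 < x < 1 -> u x = (F1 x, F2 x)}.
  by apply: aeS2 ae1 ae2 => x H1 H2 x01; rewrite -H1// -H2//=; case: (u x).
have c1 := prim_cnt p1; have c2 := prim_cnt p2.
have [E01 E02] : 1 = F1 0 /\ 0 = F2 0.
  by move: r0 => /(right_traceP ltr01 c1 c2 aeu) [].
have E1 : cis alpha = (F1 1, F2 1) by apply/(left_traceP ltr01 c1 c2 aeu).
exists (extend (F1 0) (F1 1) F1), (extend (F2 0) (F2 1) F2).
exists (extend0 (wderiv unit_interval (fst \o u))), (extend0 (wderiv unit_interval (snd \o u))).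
split.
- by split; [exact: extend_prim p1|exact: extend_prim p2].
- by split; apply: extend0_sqint; apply/(L2P _ mset01); [case: w1|case: w2].
- by move=> x /negP/negbTE; rewrite /extend0 => ->.
- move=> x; rewrite /extend; split=> [->|x1]; first by rewrite -E01 -E02.
  by rewrite [x <= 0]leNgt (lt_le_trans ltr01 x1)/= x1 E1.
- split; last by move=> x x01; rewrite /extend0 x01.
  apply: aeS aeu => x H /[dup] x01 /andP[x0 x1]; rewrite H// /extend.
  by rewrite leNgt x0/= leNgt x1.
Qed.

(** On the two added pieces the density is zero and the modulus is 1, so the Modica-Mortola part
    vanishes there and may be integrated over [[-1, 2]]. *)
Lemma energyE (L : R) (N : nat) (alpha eps : R) u (a1 a2 b1 b2 : R -> R) : 0 < eps ->
  admissible alpha u ->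
  prim (-1) 2 a1 b1 -> prim (-1) 2 a2 b2 -> sqint W b1 -> sqint W b2 ->
  (forall x, ~ (0 < x < 1) -> [/\ b1 x = 0, b2 x = 0 & sqmod a1 a2 x = 1]) ->
  {ae mu, forall x, 0 < x < 1 -> u x = (a1 x, a2 x)} ->
  {ae mu, forall x, 0 < x < 1 -> (b1 x, b2 x) = wderiv_vec unit_interval u x} ->
  energy L N alpha eps u = (ig (-1) 2 (mm_density eps a1 a2 b1 b2) +
    L / 2 * ig 0 1 (fun x => (a1 x * b2 x - a2 x * b1 x - 2 * pi * N%:R) ^+ 2))%:E.
Proof.
move=> e0 adm p1 p2 s1 s2 out ua bw; rewrite /energy asboolT//.
set n0 := 2 * pi * N%:R.
have mW : mset W by exact: measurable_itv.
have m01 : mset `[(0 : R), 1] by exact: measurable_itv.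
have y01 : (mu `[0%R : R, 1%R]%classic < +oo)%E by exact: (@mu_itv_lty _ _ 0 1).
have S01 : `[(0 : R), 1] `<=` W by apply: subset_itv; rewrite bnd_simp; lra.
have c1 := prim_cnt p1; have c2 := prim_cnt p2.
have st : sqint W (fun x => a1 x * b2 x - a2 x * b1 x).
  have [N1 H1] := cnt_bounded c1; have [N2 H2] := cnt_bounded c2.
  apply: sqintB => //.
    by apply: (@sqintM _ _ _ _ N1) => //; exact: cnt_measurable c1.
  by apply: (@sqintM _ _ _ _ N2) => //; exact: cnt_measurable c2.
have st1 : sqint `[0, 1] (fun x => a1 x * b2 x - a2 x * b1 x - n0).
  by apply: sqintB => //; [exact: sqintS st|exact: sqint_cst].
have mmi : itgi (-1) 2 (mm_density eps a1 a2 b1 b2) by exact: mm_density_itgi.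
have mmi1 : itgi 0 1 (mm_density eps a1 a2 b1 b2) by exact: itgS mmi.
have ti : itgi 0 1 (fun x => (a1 x * b2 x - a2 x * b1 x - n0) ^+ 2) by case: st1.
have Ti := itgZ (L / 2) m01 ti.
have Ei := itgD m01 mmi1 Ti.
have -> : ig (-1) 2 (mm_density eps a1 a2 b1 b2) = ig 0 1 (mm_density eps a1 a2 b1 b2).
  apply: Rintegral_sub0 => // x _ nx.
  have [|q1 q2 q] := out x; first by move=> /andP[x0 x1]; apply: nx; rewrite /= in_itv/= !ltW.
  by rewrite /mm_density q1 q2 q subrr !expr0n/= !addr0 !mulr0 addr0.
rewrite -igZ// -igD// -ig_oo// fineK; last first.
  apply: integrable_fin_num; first exact: mset01.
  by apply: (itgS _ _ _ Ei) => //; apply: subset_itv; rewrite bnd_simp.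
have [[h1 h2] _ _] := adm.
have [/(L2P _ mset01)[mu1 _] _] := h1; have [/(L2P _ mset01)[mu2 _] _] := h2.
have [/(L2P _ mset01)[mw1 _] _] := wderivP h1.
have [/(L2P _ mset01)[mw2 _] _] := wderivP h2.
apply: ae_eq_integral; first exact: mset01.
- apply/measurable_EFinP; apply: measurable_funD; [apply: measurable_funD|].
  + by apply: measurable_funM => //; apply: measurable_funD; exact: measurable_funX.
  + apply: measurable_funM => //; apply: measurable_funX; apply: measurable_funB => //.
    by apply: measurable_funD; exact: measurable_funX.
  + apply: measurable_funM => //; apply: measurable_funX; apply: measurable_funB => //.
    by apply: measurable_funB; exact: measurable_funM.
- apply/measurable_EFinP; apply: (@itg_measurable _ `]0, 1[) => //.
  by apply: (itgS _ _ _ Ei) => //; apply: subset_itv; rewrite bnd_simp.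
- apply: aeS2 ua bw => x H1 H2 x01.
  have {}x01 : 0 < x < 1 by move: x01; rewrite /unit_interval /= in_itv.
  move/(_ x01) : H1 => H1; move/(_ x01) : H2 => [E1 E2].
  by congr EFin; rewrite /twist /sqnorm2 /wderiv_vec /mm_density /sqmod H1/= E1 E2.
Qed.

Lemma L2distE D u v : mset D -> L2vec D u -> L2vec D v ->
  L2dist D u v = (Num.sqrt (nrm D (fun x => (u x).1 - (v x).1) ^+ 2 +
                            nrm D (fun x => (u x).2 - (v x).2) ^+ 2))%:E.
Proof.
move=> mD [/(L2P _ mD) su1 /(L2P _ mD) su2] [/(L2P _ mD) sv1 /(L2P _ mD) sv2].
have [md1 d1] := sqintB mD su1 sv1; have [md2 d2] := sqintB mD su2 sv2.
rewrite !sqr_nrm -RintegralD//.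
pose h x := norm2 (u x - v x).
have h2 x : h x ^+ 2 = ((u x).1 - (v x).1) ^+ 2 + ((u x).2 - (v x).2) ^+ 2.
  by rewrite /h /norm2 sqr_sqrtr// /sqnorm2 addr_ge0 ?sqr_ge0.
rewrite /L2dist unlock /Lnorm.
have -> : (\int[mu]_x `|(EFin \o h \_ D) x| `^ 2 = \int[mu]_(x in D) (h x ^+ 2)%:E)%E.
  rewrite [RHS]integral_mkcond; apply: eq_integral => x _ /=.
  rewrite powR_mulrn// -normrX ger0_norm ?sqr_ge0// !patchE.
  by case: ifP => // _; rewrite expr0n.
have -> : (\int[mu]_(x in D) (h x ^+ 2)%:E = (\int[mu]_(x in D) (h x ^+ 2))%:E)%E.
  rewrite fineK//; apply: integrable_fin_num => //.
  by apply: eq_itg (itgD mD d1 d2) => // x _; rewrite h2.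
rewrite poweR_EFin; congr EFin; rewrite powR12_sqrt; last first.
  by apply: Rintegral_ge0 => x _; exact: sqr_ge0.
by congr Num.sqrt; apply: eq_Rintegral => x _; rewrite h2.
Qed.

Lemma L2_cvgP D (v_ : R -> R -> R * R) u : mset D -> L2vec D u ->
  (forall eps, 0 < eps -> L2vec D (v_ eps)) ->
  L2_cvg D v_ u <-> forall e : R, 0 < e -> \forall eps \near 0^'+,
    nrm D (fun x => (v_ eps x).1 - (u x).1) <= e /\
    nrm D (fun x => (v_ eps x).2 - (u x).2) <= e.
Proof.
move=> mD su sv; rewrite /L2_cvg; split=> [/fine_cvgP[_ /cvgrPdist_le H] e e0|H].
  near=> eps; have eps0 : 0 < eps by near: eps; exact: nbhs_right_gt.
  have : `|0 - fine (L2dist D (v_ eps) u)| <= e by near: eps; exact: H.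
  rewrite L2distE//=; last exact: sv.
  rewrite sub0r normrN ger0_norm ?sqrtr_ge0// => He.
  have n1 := nrm_ge0 D (fun x => (v_ eps x).1 - (u x).1).
  have n2 := nrm_ge0 D (fun x => (v_ eps x).2 - (u x).2).
  split; apply: le_trans He.
    by rewrite -[leLHS]ger0_norm// -sqrtr_sqr ler_wsqrtr// lerDl sqr_ge0.
  by rewrite -[leLHS]ger0_norm// -sqrtr_sqr ler_wsqrtr// lerDr sqr_ge0.
apply/fine_cvgP; split.
  near=> eps; have eps0 : 0 < eps by near: eps; exact: nbhs_right_gt.
  by rewrite L2distE//; exact: sv.
apply/cvgrPdist_le => /= e e0.
near=> eps; have eps0 : 0 < eps by near: eps; exact: nbhs_right_gt.
have [h1 h2] : nrm D (fun x => (v_ eps x).1 - (u x).1) <= e / 2 /\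
    nrm D (fun x => (v_ eps x).2 - (u x).2) <= e / 2.
  by near: eps; apply: H; exact: divr_gt0.
rewrite L2distE//=; last exact: sv.
have n1 := nrm_ge0 D (fun x => (v_ eps x).1 - (u x).1).
have n2 := nrm_ge0 D (fun x => (v_ eps x).2 - (u x).2).
rewrite sub0r normrN ger0_norm ?sqrtr_ge0//.
rewrite -[leRHS]ger0_norm ?(ltW e0)// -sqrtr_sqr ler_wsqrtr//.
apply: (@le_trans _ _ ((e / 2) ^+ 2 + (e / 2) ^+ 2)).
  by rewrite lerD// lerXn2r ?nnegrE ?divr_ge0 ?(ltW e0).
by have := sqr_ge0 e; lra.
Unshelve. all: by end_near. Qed.

End EnergyOfCurves.

(** * Jump set and twist of a limit *)

Section JumpSetOfLimit.
Context {R : realType}.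
Notation mu := (@lebesgue_measure R).
Notation W := (`[(-1 : R), 2]%classic).
Notation I01 := (unit_interval : set R).
Variables (alpha : R) (u : R -> R * R) (U1 U2 g : R -> R).
Hypotheses (su : L2vec I01 u) (uU : forall x, 0 < x < 1 -> u x = (U1 x, U2 x))
  (Ul : forall x, x <= 0 -> (U1 x, U2 x) = (1, 0))
  (Ur : forall x, 1 <= x -> (U1 x, U2 x) = cis alpha)
  (sU1 : sqint W U1) (sU2 : sqint W U2) (sg : sqint W g)
  (unitU : {ae mu, forall x, W x -> U1 x ^+ 2 + U2 x ^+ 2 = 1}).

Let G1 x := - (g x * U2 x).
Let G2 x := g x * U1 x.

Let mW : mset W. Proof. exact: measurable_itv. Qed.
Let Wy : (mu W < +oo)%E. Proof. exact: (@mu_itv_lty _ _ (-1) 2). Qed.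

Let sqint_G (h k : R -> R) : mfun_on W h -> (forall x, h x ^+ 2 = g x ^+ 2 * k x ^+ 2) ->
  {ae mu, forall x, W x -> k x ^+ 2 <= 1} -> sqint W h.
Proof.
move=> mh hk k1; split=> //; apply: (@itg_le_ae _ _ _ (fun x => g x ^+ 2)) => //.
- exact: measurable_funX.
- apply: aeS k1 => x H Wx; rewrite ger0_norm ?sqr_ge0// hk ler_piMr ?sqr_ge0//.
  exact: H.
- by case: sg.
Qed.

Let sG1 : sqint W G1.
Proof.
apply: (@sqint_G _ U2).
- by apply: measurableT_comp => //; apply: measurable_funM; [case: sg|case: sU2].
- by move=> x; rewrite /G1; ring.
- by apply: aeS unitU => x H /H <-; rewrite lerDr sqr_ge0.
Qed.

Let sG2 : sqint W G2.
Proof.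
apply: (@sqint_G _ U1).
- by apply: measurable_funM; [case: sg|case: sU1].
- by move=> x; rewrite /G2; ring.
- by apply: aeS unitU => x H /H <-; rewrite lerDl sqr_ge0.
Qed.

(* The limit satisfies u' = i g u around x. *)
Definition regular_at x := exists2 r, 0 < r & exists F1 F2,
  [/\ prim (x - r) (x + r) F1 G1, prim (x - r) (x + r) F2 G2,
      {ae mu, forall y, x - r < y < x + r -> U1 y = F1 y} &
      {ae mu, forall y, x - r < y < x + r -> U2 y = F2 y}].

Lemma regular_at_weak x r : 0 < r -> -1 <= x - r -> x + r <= 2 ->
  (forall phi, test_fun `]x - r, x + r[ phi ->
      ig (x - r) (x + r) (fun y => U1 y * derive1 phi y) =
        ig (x - r) (x + r) (fun y => g y * U2 y * phi y) /\
      ig (x - r) (x + r) (fun y => U2 y * derive1 phi y) =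
        - ig (x - r) (x + r) (fun y => g y * U1 y * phi y)) ->
  regular_at x.
Proof.
move=> r0 xr rx H.
have mI : mset `[x - r, x + r] by exact: measurable_itv.
have SI : `[x - r, x + r] `<=` W by apply: subset_itv; rewrite bnd_simp.
have ii h : sqint W h -> itgi (x - r) (x + r) h.
  by move=> sh; apply: itgS SI _ => //; exact: sqint_itg sh.
have lt_r : x - r < x + r by lra.
have [|F1 p1 e1] := weak_prim lt_r (ii _ sU1) (ii _ sG1).
  move=> psi tpsi; have [-> _] := H psi tpsi.
  have [_ cpsi _ _] := test_funE tpsi.
  have i1 := cntM_itg (continuous_cnt cpsi) (ii _ sG1).
  rewrite -RintegralN//; last by apply: eq_itg i1 => // y _; ring.
  by apply: eq_Rintegral => y _; rewrite /G1; ring.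
have [|F2 p2 e2] := weak_prim lt_r (ii _ sU2) (ii _ sG2).
  by move=> psi tpsi; have [_ ->] := H psi tpsi.
by exists r => //; exists F1, F2.
Qed.

Let regular_cval x : regular_at x -> exists2 r, 0 < r &
  [/\ prim (x - r) (x + r) (cval U1) G1, prim (x - r) (x + r) (cval U2) G2,
      {ae mu, forall y, x - r < y < x + r -> U1 y = cval U1 y} &
      {ae mu, forall y, x - r < y < x + r -> U2 y = cval U2 y}].
Proof.
(* [cval] is known to equal [F1] and [F2] on the open interval only; halving the radius gives this
   on a closed one. *)
move=> [r r0 [F1 [F2 [p1 p2 e1 e2]]]]; exists (r / 2); first exact: divr_gt0.
have E1 := cvalE (prim_cnt p1) e1; have E2 := cvalE (prim_cnt p2) e2.
have P k F G : prim (x - r) (x + r) F G ->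
    (forall y, x - r < y < x + r -> k y = F y) -> prim (x - r / 2) (x + r / 2) k G.
  move=> pF kF; apply: (@eq_prim _ _ _ F _ G) => [y yr|//|]; first by rewrite kF//; lra.
  by apply: primS pF; lra.
split; [exact: P E1|exact: P E2| |].
- by apply: aeS e1 => y H yr; rewrite H ?E1//; lra.
- by apply: aeS e2 => y H yr; rewrite H ?E2//; lra.
Qed.

Let mI01 : mset I01. Proof. exact: mset01. Qed.
Let oI01 : open I01. Proof. exact: itv_open. Qed.
Let mD J : finite_set J -> mset (I01 `\` J).
Proof. by move=> fJ; apply: measurableD => //; exact: finite_mset. Qed.
Let S01 : I01 `<=` W.
Proof. by apply: subset_itv; rewrite bnd_simp; lra. Qed.

Lemma regular_weak_deriv J : finite_set J ->
  (forall x, 0 < x < 1 -> ~ J x -> regular_at x) ->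
  is_weak_deriv (I01 `\` J) (fst \o u) G1 /\ is_weak_deriv (I01 `\` J) (snd \o u) G2.
Proof.
move=> fJ H.
have SD : I01 `\` J `<=` I01 by move=> x [].
have SW := subset_trans SD S01.
have oD := open_setD_finite oI01 fJ.
have L2D f : L2 I01 f -> L2 (I01 `\` J) f.
  by move=> /(L2P _ mI01) sf; apply/(L2P _ (mD fJ)); exact: (sqintS (mD fJ) mI01 SD sf).
have [E1 E2] : {ae mu, forall x, (I01 `\` J) x -> U1 x = cval U1 x} /\
    {ae mu, forall x, (I01 `\` J) x -> U2 x = cval U2 x}.
  by split; apply: ae_local => x [x01 Jx];
    have [r r0 [_ _ e1 e2]] := regular_cval (H x x01 Jx); exists r.
split; [apply: (@prim_weak_deriv _ _ 0 1 _ _ (cval U1))|apply: (@prim_weak_deriv _ _ 0 1 _ _ (cval U2))] => //; try exact: mD.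
- by apply: L2D; case: su.
- by apply/(L2P _ (mD fJ)); exact: (sqintS (mD fJ) mW SW sG1).
- by apply: aeS E1 => x E Dx; rewrite -E//= uU//; case: Dx.
- by move=> x [x01 Jx]; have [r r0 []] := regular_cval (H x x01 Jx); exists r.
- by apply: L2D; case: su.
- by apply/(L2P _ (mD fJ)); exact: (sqintS (mD fJ) mW SW sG2).
- by apply: aeS E2 => x E Dx; rewrite -E//= uU//; case: Dx.
- by move=> x [x01 Jx]; have [r r0 []] := regular_cval (H x x01 Jx); exists r.
Qed.

Variable B : set R.
Hypotheses (fB : finite_set B) (regB : forall x, -1 < x < 2 -> ~ B x -> regular_at x).

(** A point of [B] may be regular as well: off the finite set [B] the weak derivative is already
    known to be [i g u], and a density may be changed on a finite set. Being H^1 near a point thus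
    implies regularity there, which is what makes the minimality of jump sets usable. *)
Lemma H1vec_regular J : finite_set J -> H1vec (I01 `\` J) u ->
  forall x, 0 < x < 1 -> ~ J x -> regular_at x.
Proof.
move=> fJ [h1 h2] x x01 Jx.
have oD := open_setD_finite oI01 fJ.
have w1 := wderivP h1; have w2 := wderivP h2.
have [v1 v2] : is_weak_deriv (I01 `\` B) (fst \o u) G1 /\ is_weak_deriv (I01 `\` B) (snd \o u) G2.
  by apply: (regular_weak_deriv fB) => y y01 By; apply: (regB _ By); lra.
have fJB : finite_set (J `|` B) by rewrite finite_setU.
have SJ : I01 `\` (J `|` B) `<=` I01 `\` J by move=> y [y01 nJB]; split=> // Jy; apply: nJB; left.
have SB : I01 `\` (J `|` B) `<=` I01 `\` B by move=> y [y01 nJB]; split=> // By; apply: nJB; right.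
have L2D f : L2 I01 f -> L2 (I01 `\` (J `|` B)) f.
  move=> /(L2P _ mI01) sf; apply/(L2P _ (mD fJB)); apply: sqintS sf => //; exact: mD.
have q1 := weak_deriv_unique (open_setD_finite oI01 fJB) (mD fJB) (L2D _ (proj1 su))
  (weak_derivS (mD fJB) (mD fJ) SJ w1) (weak_derivS (mD fJB) (mD fB) SB v1).
have q2 := weak_deriv_unique (open_setD_finite oI01 fJB) (mD fJB) (L2D _ (proj2 su))
  (weak_derivS (mD fJB) (mD fJ) SJ w2) (weak_derivS (mD fJB) (mD fB) SB v2).
have [c1 p1] := weak_deriv_cval oD (mD fJ) (proj1 h1) w1.
have [c2 p2] := weak_deriv_cval oD (mD fJ) (proj1 h2) w2.
have [|r r0 Dr] := @open_ball_itv _ _ x oD; first by split.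
have ltr : x - r < x + r by lra.
have Sr : `[x - r, x + r] `<=` I01 `\` J by move=> y; rewrite /= in_itv/=; exact: Dr.
have nB := finite_ae_notin fB.
have SrW : `[x - r, x + r] `<=` W by move=> y /Sr[y01 _]; exact: S01.
have mG h : sqint W h -> mfun_on `[x - r, x + r] h.
  by move=> [mh _]; apply: measurable_funS SrW mh.
exists r => //; exists (cval (fst \o u)), (cval (snd \o u)); split.
- apply: prim_ae (mG _ sG1) _ (p1 _ _ (ltW ltr) Sr).
  by apply: aeS2 q1 nB => y H nBy yr; apply: H; have [y01 nJ] := Dr _ yr; split=> // -[].
- apply: prim_ae (mG _ sG2) _ (p2 _ _ (ltW ltr) Sr).
  by apply: aeS2 q2 nB => y H nBy yr; apply: H; have [y01 nJ] := Dr _ yr; split=> // -[].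
- apply: aeS c1 => y H /andP[y1 y2].
  have Dy : (I01 `\` J) y by apply: Dr; rewrite !ltW.
  by rewrite -H//= uU//; case: Dy.
- apply: aeS c2 => y H /andP[y1 y2].
  have Dy : (I01 `\` J) y by apply: Dr; rewrite !ltW.
  by rewrite -H//= uU//; case: Dy.
Qed.

(* The minimal jump set inside the interval is the set of non-regular points. *)
Lemma jump_set_exists : exists J, is_jump_set alpha u J.
Proof.
pose J' := [set x | 0 < x < 1 /\ ~ regular_at x].
have J'B : J' `<=` B.
  move=> x [x01 nx]; apply: contrapT => nB; apply: nx.
  by apply: (regB _ nB); lra.
have fJ' : finite_set J' := sub_finite_set J'B fB.
(* The traces decide separately about 0 and 1. These points lie outside the open interval, so adding
   them leaves the H^1 condition unchanged. *)
pose P0 := exists2 l, right_trace u 0 l & l <> (1, 0).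
pose P1 := exists2 l, left_trace u 1 l & l <> cis alpha.
pose E := [set x : R | x = 0 /\ P0] `|` [set x | x = 1 /\ P1].
have fE : finite_set E.
  apply: (@sub_finite_set _ _ [set 0; 1]); last exact: finite_set2.
  by move=> x [[-> _]|[-> _]]; [left|right].
have fJ : finite_set (J' `|` E) by rewrite finite_setU.
have JE x : 0 < x < 1 -> (J' `|` E) x -> ~ regular_at x.
  by move=> x01 [[]//|[[x0 _]|[x1 _]]]; move: x01; lra.
exists (J' `|` E); split.
- split=> // x [[x01 _]|[[-> _]|[-> _]]]; rewrite /= in_itv/= ?lexx ?ler01//.
  by move/andP: x01 => [x0 x1]; rewrite !ltW.
- have [w1 w2] : is_weak_deriv (I01 `\` (J' `|` E)) (fst \o u) G1 /\
      is_weak_deriv (I01 `\` (J' `|` E)) (snd \o u) G2.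
    apply: regular_weak_deriv => // x x01 nJ; apply: contrapT => nx.
    by apply: nJ; left.
  have L2D f : L2 I01 f -> L2 (I01 `\` (J' `|` E)) f.
    move=> /(L2P _ mI01) sf; apply/(L2P _ (mD fJ)); apply: sqintS sf => //; exact: mD.
  split.
    by split; split; [apply: L2D; case: su|exists G1|apply: L2D; case: su|exists G2].
  apply: aeS unitU => x H [x01 _]; rewrite /sqnorm2 uU//=; apply: H.
  exact: S01.
- move=> x [Jx x01] hx; apply: (JE x x01 Jx).
  apply: (H1vec_regular (finite_setD _ fJ) hx) => //.
  by case=> _; apply.
- split=> [[[]|[[]//|[]]]|p0].
  + by rewrite ltxx.
  + by move/eqP; rewrite eq_sym oner_eq0.
  + by right; left.
- split=> [[[]|[[]//|[]]]|p1] //.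
  + by rewrite ltxx andbF.
  + by move/eqP; rewrite oner_eq0.
  + by right; right.
Qed.

(** A point of [J] outside [B] would be regular. Inside the interval it could then be dropped from
    [J], against minimality; at 0 or 1 the extended curve would be continuous, so the trace would be
    the boundary value. *)
Lemma jump_set_dips J : is_jump_set alpha u J -> J `<=` B.
Proof.
move=> [[fJ JI] [hu _] minJ J0 J1] x Jx; apply: contrapT => nB.
have /andP[x0 x1] : 0 <= x <= 1 by have := JI _ Jx; rewrite /= in_itv.
have rx : regular_at x by apply: (regB _ nB); lra.
move: x0 x1; rewrite le_eqVlt => /orP[/eqP x0|x0]; last rewrite le_eqVlt => /orP[/eqP x1|x1].
- move=> _; rewrite -x0 in Jx rx; have [l rl] := J0.1 Jx; apply.
  have [r r0 [F1 [F2 []]]] := rx; rewrite sub0r add0r => p1 p2 e1 e2.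
  pose r' := Num.min r 1.
  have r'0 : 0 < r' by rewrite lt_min r0 ltr01.
  have [r'r r'1] : r' <= r /\ r' <= 1 by rewrite !ge_min !lexx orbT.
  have c1 : cnt 0 r' F1 by apply: cntS (prim_cnt p1); lra.
  have c2 : cnt 0 r' F2 by apply: cntS (prim_cnt p2); lra.
  have ae12 : {ae mu, forall y, 0 < y < r' -> u y = (F1 y, F2 y)}.
    by apply: aeS2 e1 e2 => y H1 H2 yr; rewrite uU; [rewrite H1 ?H2//; lra|lra].
  move: rl => /(right_traceP r'0 c1 c2 ae12) ->.
  have nr : - r < 0 by lra.
  have k1 : cnt (- r) 0 F1 by apply: cntS (prim_cnt p1); lra.
  have k2 : cnt (- r) 0 F2 by apply: cntS (prim_cnt p2); lra.
  have -> : F1 0 = 1.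
    apply: (@cnt_ae_eq R _ _ _ (fun=> 1) nr k1 (cnt_cst 1) _ 0 _); last by lra.
    apply: aeS e1 => y H /andP[y1 y2]; rewrite -H; last lra.
    by have [] := Ul (ltW y2).
  congr pair.
  apply: (@cnt_ae_eq R _ _ _ (fun=> 0) nr k2 (cnt_cst 0) _ 0 _); last by lra.
  apply: aeS e2 => y H /andP[y1 y2]; rewrite -H; last lra.
  by have [] := Ul (ltW y2).
- rewrite x1 in Jx rx; have [l rl] := J1.1 Jx; apply.
  have [r r0 [F1 [F2 [p1 p2 e1 e2]]]] := rx.
  pose r' := Num.min r 1.
  have r'0 : 0 < r' by rewrite lt_min r0 ltr01.
  have [r'r r'1] : r' <= r /\ r' <= 1 by rewrite !ge_min !lexx orbT.
  have c1 : cnt (1 - r') 1 F1 by apply: cntS (prim_cnt p1); lra.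
  have c2 : cnt (1 - r') 1 F2 by apply: cntS (prim_cnt p2); lra.
  have ae12 : {ae mu, forall y, 1 - r' < y < 1 -> u y = (F1 y, F2 y)}.
    by apply: aeS2 e1 e2 => y H1 H2 yr; rewrite uU; [rewrite H1 ?H2//; lra|lra].
  have r'1' : 1 - r' < 1 by lra.
  move: rl => /(left_traceP r'1' c1 c2 ae12) ->.
  have nr : 1 < 1 + r by lra.
  have k1 : cnt 1 (1 + r) F1 by apply: cntS (prim_cnt p1); lra.
  have k2 : cnt 1 (1 + r) F2 by apply: cntS (prim_cnt p2); lra.
  congr pair.
    apply: (@cnt_ae_eq R _ _ _ (fun=> (cos alpha)) nr k1 (cnt_cst (cos alpha)) _ 1 _); last by lra.
    apply: aeS e1 => y H /andP[y1 y2]; rewrite -H; last lra.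
    by have [] := Ur (ltW y1).
  apply: (@cnt_ae_eq R _ _ _ (fun=> (sin alpha)) nr k2 (cnt_cst (sin alpha)) _ 1 _); last by lra.
  apply: aeS e2 => y H /andP[y1 y2]; rewrite -H; last lra.
  by have [] := Ur (ltW y1).
- apply: (minJ x) => //.
    by split=> //; rewrite /unit_interval /= in_itv/= x0 x1.
  have fJx : finite_set (J `\ x) := finite_setD _ fJ.
  have [w1 w2] : is_weak_deriv (I01 `\` (J `\ x)) (fst \o u) G1 /\
      is_weak_deriv (I01 `\` (J `\ x)) (snd \o u) G2.
    apply: regular_weak_deriv => // y y01 nJ; have [<-//|/eqP xy] := eqVneq x y.
    apply: (H1vec_regular fJ hu) => // Jy; apply: nJ; split=> //.
    by move=> yx; apply: xy.
  have L2D f : L2 I01 f -> L2 (I01 `\` (J `\ x)) f.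
    move=> /(L2P _ mI01) sf; apply/(L2P _ (mD fJx)); apply: sqintS sf => //; exact: mD.
  by split; split; [apply: L2D; case: su|exists G1|apply: L2D; case: su|exists G2].
Qed.

(** For [u' = i g u] the twist is [g |u|^2], and the modulus is 1 almost everywhere. *)
Lemma twist_integral J (n0 : R) : is_jump_set alpha u J ->
  (\int[mu]_(x in I01 `\` J) ((twist (I01 `\` J) u x - n0) ^+ 2)%:E =
   (ig 0 1 (fun x => (g x - n0) ^+ 2))%:E)%E.
Proof.
move=> [[fJ JI] [hu _] minJ J0 J1].
have [v1 v2] := regular_weak_deriv fJ (H1vec_regular fJ hu).
have [h1 h2] := hu.
have w1 := wderivP h1; have w2 := wderivP h2.
have oD := open_setD_finite oI01 fJ.
have q1 := weak_deriv_unique oD (mD fJ) (proj1 h1) w1 v1.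
have q2 := weak_deriv_unique oD (mD fJ) (proj1 h2) w2 v2.
have [/(L2P _ (mD fJ))[mu1 _] _] := h1; have [/(L2P _ (mD fJ))[mu2 _] _] := h2.
have [/(L2P _ (mD fJ))[mw1 _] _] := w1.
have [/(L2P _ (mD fJ))[mw2 _] _] := w2.
have y01 : (mu `[0%R : R, 1%R]%classic < +oo)%E by exact: (@mu_itv_lty _ _ 0 1).
have m01 : mset `[(0 : R), 1] by exact: measurable_itv.
have sgn : sqint `[0, 1] (fun x => g x - n0).
  apply: sqintB => //; last exact: sqint_cst.
  by apply: sqintS sg => //; apply: subset_itv; rewrite bnd_simp; lra.
have [_ gi] := sgn.
rewrite -(Rintegral_setD_finite fJ gi).
have SD : I01 `\` J `<=` `[0, 1] by move=> x [+ _]; apply: subset_itv; rewrite bnd_simp.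
have giD : itg (I01 `\` J) (fun x => (g x - n0) ^+ 2) by apply: itgS SD gi => //; exact: mD.
rewrite fineK; last by apply: integrable_fin_num => //; exact: mD.
apply: ae_eq_integral; first exact: mD.
- apply/measurable_EFinP; apply: measurable_funX; apply: measurable_funB => //.
  by apply: measurable_funB; exact: measurable_funM.
- by apply/measurable_EFinP; apply: itg_measurable giD; exact: mD.
- apply: aeS2 unitU (aeS2 (fun x H1 H2 => conj H1 H2) q1 q2) => x H [H1 H2] Dx.
  have x01 : 0 < x < 1 by move: Dx => [+ _]; rewrite /unit_interval /= in_itv.
  have {}H : U1 x ^+ 2 + U2 x ^+ 2 = 1 by apply: H; apply: S01.
  congr (((_ - n0) ^+ 2)%:E); rewrite /twist /wderiv_vec/= H1// H2// uU//= /G1 /G2.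
  have -> : U1 x * (g x * U1 x) - U2 x * - (g x * U2 x) = g x * (U1 x ^+ 2 + U2 x ^+ 2) by ring.
  by rewrite H mulr1.
Qed.

End JumpSetOfLimit.

(** * Lower bound for the energies of a convergent family *)

Section GammaLiminf.
Context {R : realType}.
Notation mu := (@lebesgue_measure R).
Notation W := (`[(-1 : R), 2]%classic).
Notation I01 := (unit_interval : set R).
Variables (L : R) (N : nat) (alpha : R).
Hypothesis L0 : 0 < L.

Notation n0 := (2 * pi * N%:R : R).

Lemma limit_energyE (u : R -> R * R) J (X : R) : jump_set alpha u = J ->
  is_jump_set alpha u J ->
  (\int[mu]_(x in I01 `\` J) ((twist (I01 `\` J) u x - n0) ^+ 2)%:E = X%:E)%E ->
  limit_energy L N alpha u = (L / 2 * X + 2 * Num.sqrt 2 / 3 * (size (finmap.enum_fset (fset_set J)))%:R)%:E.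
Proof.
move=> <- jJ XE; have [[fJ _] _ _ _ _] := jJ.
rewrite /limit_energy asboolT; last by exists (jump_set alpha u).
by rewrite XE /counting asboolT// EFinD !EFinM.
Qed.

Lemma jump_setP (u : R -> R * R) : (exists J, is_jump_set alpha u J) ->
  is_jump_set alpha u (jump_set alpha u).
Proof. by move=> [J jJ]; rewrite /jump_set; apply: (xgetPex set0); exists J. Qed.

(** The lower bound along a single ultrafilter, free of any liminf. Since [M] is real, the existence
    of a jump set for [u] is part of what is shown. *)
Lemma limit_energy_ultra (U : set_system R) (u_ : R -> R -> R * R) (u : R -> R * R) (M : R) :
  UltraFilter U -> (forall e : R, 0 < e -> U [set eps | 0 < eps < e]) ->
  L2vec I01 u ->
  (forall e : R, 0 < e -> U [set eps | nrm I01 (fun x => (u_ eps x).1 - (u x).1) <= e /\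
                                       nrm I01 (fun x => (u_ eps x).2 - (u x).2) <= e]) ->
  U [set eps | (energy L N alpha eps (u_ eps) <= M%:E)%E] ->
  (limit_energy L N alpha u <= M%:E)%E.
Proof.
move=> UU Ueps su Ucv UE.
have mW : mset W by exact: measurable_itv.
have mI : mset I01 := mset01.
have SI : I01 `<=` W by apply: subset_itv; rewrite bnd_simp; lra.
(* Curves are chosen for the admissible [u_ eps]; for the others the requirement is void and zero
   functions are taken. *)
pose Q eps (t : (R -> R) * (R -> R) * ((R -> R) * (R -> R))) := admissible alpha (u_ eps) ->
  [/\ prim (-1) 2 t.1.1 t.2.1 /\ prim (-1) 2 t.1.2 t.2.2,
      sqint W t.2.1 /\ sqint W t.2.2,
      (forall x, ~ (0 < x < 1) -> t.2.1 x = 0 /\ t.2.2 x = 0),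
      (forall x, (x <= 0 -> (t.1.1 x, t.1.2 x) = (1, 0)) /\ (1 <= x -> (t.1.1 x, t.1.2 x) = cis alpha)) &
      {ae mu, forall x, 0 < x < 1 -> u_ eps x = (t.1.1 x, t.1.2 x)} /\
      (forall x, 0 < x < 1 -> (t.2.1 x, t.2.2 x) = wderiv_vec I01 (u_ eps) x)].
have [eps|T QT] := @choice _ _ Q.
  have [adm|nadm] := pselect (admissible alpha (u_ eps)); last first.
    by exists ((fun=> 0, fun=> 0), (fun=> 0, fun=> 0)).
  by have [a1 [a2 [b1 [b2 H]]]] := admissible_curve adm; exists ((a1, a2), (b1, b2)).
pose a1 eps := (T eps).1.1; pose a2 eps := (T eps).1.2.
pose b1 eps := (T eps).2.1; pose b2 eps := (T eps).2.2.
pose U1 := extend 1 (cos alpha) (fst \o u); pose U2 := extend 0 (sin alpha) (snd \o u).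
have [/(L2P _ mI) su1 /(L2P _ mI) su2] := su.
have sU1 : sqint W U1 by exact: extend_sqint.
have sU2 : sqint W U2 by exact: extend_sqint.
(* A finite energy forces admissibility, since the energy is infinite otherwise. *)
have Uadm : U [set eps | 0 < eps /\ admissible alpha (u_ eps)].
  apply: filterS (filterI (Ueps 1 ltr01) UE) => eps [/andP[e0 _]] /= H; split=> //.
  by apply: contrapT => nadm; move: H; rewrite /energy asboolF.
have Ucurve : U [set eps | curve a1 a2 b1 b2 eps].
  by apply: filterS Uadm => eps [_ /QT[[p1 p2] [s1 s2] z _ _]].
have Uenergy : U [set eps | ig (-1) 2 (mm_density eps (a1 eps) (a2 eps) (b1 eps) (b2 eps)) +
     L / 2 * ig 0 1 (fun x => (torque a1 a2 b1 b2 eps x - n0) ^+ 2) <= M].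
  apply: filterS (filterI Uadm UE) => eps [[e0 adm]] /=.
  have [[p1 p2] [s1 s2] z bd [ua bw]] := QT _ adm.
  rewrite (energyE L N e0 adm p1 p2 s1 s2 _ ua); last 2 first.
  - move=> x nx; have [-> ->] := z x nx; split=> //.
    have [bl br] := bd x; rewrite /sqmod.
    have [x0|x0] := leP x 0; first by have [-> ->] := bl x0; rewrite expr1n expr0n addr0.
    have x1 : 1 <= x by rewrite leNgt; apply/negP => x1; apply: nx; rewrite x0 x1.
    by have [-> ->] := br x1; rewrite cos2Dsin2.
  - by apply: aeS ua => x _; exact: bw.
  by rewrite lee_fin.
(* Stated for an arbitrary coordinate [k] so as to treat both components at once. Outside []0, 1[]
   the curve and the extended limit coincide, hence the norms over [W] and over the unit interval
   agree. *)
have cvk (k : R * R -> R) (a : R -> R -> R) l r : (forall eps x, a eps x = k ((T eps).1.1 x, (T eps).1.2 x)) ->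
    k (1, 0) = l -> k (cis alpha) = r -> mfun_on I01 (k \o u) ->
    (forall e : R, 0 < e -> U [set eps | nrm I01 (fun x => k (u_ eps x) - k (u x)) <= e]) ->
    (forall eps, 0 < eps /\ admissible alpha (u_ eps) -> mfun_on I01 (k \o u_ eps) /\ mfun_on I01 (a eps)) ->
    forall e : R, 0 < e -> U [set eps | nrm W (fun x => a eps x - extend l r (k \o u) x) <= e].
  move=> aE kl kr mku H mk e e0; apply: filterS (filterI (H e e0) Uadm) => eps [+ adm] /=.
  congr (_ <= _); rewrite /nrm; congr Num.sqrt.
  have [[p1 p2] [s1 s2] z bd [ua bw]] := QT _ adm.2.
  have [mu1 ma] := mk eps adm.
  rewrite [RHS](@Rintegral_sub0 _ I01)//; last first.
    move=> x _; rewrite /unit_interval /= in_itv/= => /negP nx.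
    rewrite aE /extend; have [bl br] := bd x; case: ifPn => x0.
      by rewrite bl// kl subrr expr0n.
    case: ifPn => x1; first by rewrite br// kr subrr expr0n.
    by move: nx; rewrite ltNge x0 ltNge x1.
  have E x : I01 x -> extend l r (k \o u) x = k (u x).
    rewrite /unit_interval /= in_itv/= => /andP[x0 x1].
    by rewrite /extend leNgt x0/= leNgt x1.
  apply: Rintegral_ae_eq => //.
  - by apply: measurable_funX; apply: measurable_funB.
  - apply: measurable_funX; apply: measurable_funB => //.
    by apply: eq_measurable_fun mku => x /set_mem/E ->.
  - apply: aeS ua => x H1 xI; by rewrite E// aE -H1.
have ms f : sqint I01 f -> mfun_on I01 f by case.
have mT eps (t : R -> R) p : prim (-1) 2 t p -> mfun_on I01 t.
  by move=> /prim_cnt/cnt_measurable; apply: measurable_funS.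
have cv1 : forall e : R, 0 < e -> U [set eps | nrm W (fun x => a1 eps x - U1 x) <= e].
  apply: (cvk fst a1) => //.
  - exact: ms su1.
  - by move=> e /Ucv; apply: filterS => eps [].
  - move=> eps [e0 adm]; have [[p1 p2] _ _ _ _] := QT _ adm.
    by case: adm => [[[/(L2P _ mI) s1 _] _] _ _]; split; [exact: ms s1|exact: mT p1].
have cv2 : forall e : R, 0 < e -> U [set eps | nrm W (fun x => a2 eps x - U2 x) <= e].
  apply: (cvk snd a2) => //.
  - exact: ms su2.
  - by move=> e /Ucv; apply: filterS => eps [].
  - move=> eps [e0 adm]; have [[p1 p2] _ _ _ _] := QT _ adm.
    by case: adm => [[_ [/(L2P _ mI) s1 _]] _ _]; split; [exact: ms s1|exact: mT p2].
have unitU := limit_unit UU L0 Ueps Ucurve Uenergy sU1 sU2 cv1 cv2.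
have [g [sg g0 gw gcost]] := lower_bound_family UU L0 Ueps Ucurve Uenergy sU1 sU2 cv1 cv2.
pose B d := dips U a1 a2 d.
set X := ig 0 1 (fun x => (g x - n0) ^+ 2) in gcost.
have X0 : 0 <= X by apply: Rintegral_ge0 => x _; exact: sqr_ge0.
have LX0 : 0 <= L / 2 * X by rewrite mulr_ge0// divr_ge0// ltW.
have s20 : 0 < Num.sqrt 2 :> R by rewrite sqrtr_gt0.
(* At levels up to [1 / 6] a dip still costs at least [sqrt 2 / 3], so a finite set of more than
   [M / k] dips is impossible. *)
have fB d : 0 < d -> d <= 1 / 6 -> finite_set (B d).
  move=> d0 d6; apply: contrapT => iB.
  have k0 : 0 < 2 * Num.sqrt 2 / 3 - 2 * Num.sqrt 2 * d.
    apply: (@lt_le_trans _ _ (Num.sqrt 2 / 3)); first exact: divr_gt0.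
    have : Num.sqrt 2 * d <= Num.sqrt 2 * (1 / 6) by rewrite ler_pM2l.
    by lra.
  set k := _ - _ in k0.
  have [S SB Sn] := infinite_set_fset (Num.bound `|M / k|) iB.
  have d1 : d <= 1 by lra.
  have H := gcost d (finmap.enum_fset S) d0 d1 (finmap.fset_uniq S) (fun x xS => SB x xS).
  have : (size (finmap.enum_fset S))%:R * k <= M by move: H; rewrite -/k; lra.
  rewrite -ler_pdivlMr// leNgt => /negP; apply.
  apply: le_lt_trans (ler_norm _) _; apply: lt_le_trans (archi_boundP (normr_ge0 _)) _.
  by rewrite ler_nat.
have Uu x : 0 < x < 1 -> u x = (U1 x, U2 x).
  move=> /andP[x0 x1]; rewrite /U1 /U2 /extend leNgt x0/= leNgt x1/=.
  by case: (u x).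
have Ul x : x <= 0 -> (U1 x, U2 x) = (1, 0) by rewrite /U1 /U2 /extend => ->.
have Ur x : 1 <= x -> (U1 x, U2 x) = cis alpha.
  by move=> x1; rewrite /U1 /U2 /extend x1 leNgt (lt_le_trans ltr01 x1).
have regB d x : 0 < d -> -1 < x < 2 -> ~ B d x -> regular_at U1 U2 g x.
  move=> d0 x12 nB; have [r r0 [xr rx Hr]] := gw d x d0 x12 nB.
  exact: regular_at_weak r0 xr rx Hr.
have d60 : 0 < 1 / 6 :> R by lra.
have exJ : exists J, is_jump_set alpha u J.
  apply: (jump_set_exists alpha su Uu sU1 sU2 sg unitU (fB _ d60 (lexx _))) => x.
  exact: regB.
have jJ := jump_setP exJ.
set J := jump_set alpha u in jJ.
have [[fJ _] _ _ _ _] := jJ.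
have JB d : 0 < d -> d <= 1 / 6 -> J `<=` B d.
  move=> d0 d6; apply: (jump_set_dips su Uu Ul Ur sU1 sU2 sg unitU (fB _ d0 d6) _ jJ) => x.
  exact: regB.
have TI : (\int[mu]_(x in I01 `\` J) ((twist (I01 `\` J) u x - n0) ^+ 2)%:E = X%:E)%E.
  apply: (twist_integral su Uu sU1 sU2 sg unitU (fB _ d60 (lexx _)) _ n0 jJ) => x.
  exact: regB.
rewrite (limit_energyE (erefl J) jJ TI) lee_fin.
(* The jump set does not depend on [d] and consists of dips of every level up to [1 / 6]; the total
   deficit [c * d] is made at most [e]. *)
apply/ler_addgt0Pr => e e0.
pose c := (size (finmap.enum_fset (fset_set J)))%:R * (2 * Num.sqrt 2) : R.
have c0 : 0 <= c by rewrite mulr_ge0// mulr_ge0// ltW.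
have c1 : 0 < c + 1 by rewrite ltr_wpDl.
pose d := Num.min (1 / 6) (e / (c + 1)).
have d0 : 0 < d by rewrite lt_min d60 divr_gt0.
have d6 : d <= 1 / 6 by rewrite ge_min lexx.
have d1 : d <= 1 by lra.
have := gcost d (finmap.enum_fset (fset_set J)) d0 d1 (finmap.fset_uniq _).
have cd : c * d <= e.
  apply: (@le_trans _ _ ((c + 1) * d)); first by rewrite ler_pM2r// lerDl.
  by rewrite mulrC -ler_pdivlMr// ge_min lexx orbT.
have mem x : x \in finmap.enum_fset (fset_set J) -> B d x.
  by move=> xJ; apply: (JB _ d0 d6); apply: set_mem; rewrite -in_fset_set.
move=> /(_ mem) H.
have : (size (finmap.enum_fset (fset_set J)))%:R * (2 * Num.sqrt 2 / 3 - 2 * Num.sqrt 2 * d) =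
   2 * Num.sqrt 2 / 3 * (size (finmap.enum_fset (fset_set J)))%:R - c * d by rewrite /c; ring.
move: H; move: (_ * (_ - _)) => Y; move: (2 * _ / 3 * _) => Z; lra.
Qed.

Lemma ereal_between (l m : \bar R) : (l < m)%E -> exists M : R, (l < M%:E < m)%E.
Proof.
case: l m => [r| |] [s| |]//= H.
- exists ((r + s) / 2); rewrite !lte_fin in H *; lra.
- by exists (r + 1); rewrite ltry lte_fin ltrDl ltr01.
- by exists (s - 1); rewrite ltNyr lte_fin ltrBlDr ltrDl ltr01.
- by exists 0; rewrite ltry ltNyr.
Qed.

Lemma gamma_liminf (u_ : R -> R -> R * R) (u : R -> R * R) :
  (forall eps : R, 0 < eps -> L2vec I01 (u_ eps)) -> L2vec I01 u -> L2_cvg I01 u_ u ->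
  (limit_energy L N alpha u <= limf_einf (fun eps => energy L N alpha eps (u_ eps)) (0 : R)^'+)%E.
Proof.
move=> su_ su /(L2_cvgP mset01 su su_) cv; rewrite leNgt; apply/negP => /ereal_between[M /andP[]].
rewrite limf_einfE => lM; rewrite ltNge => /negP; apply.
(* If the inequality failed, parameters with energy at most [M] would occur arbitrarily close to 0;
   the filter restricted to them is proper and extends to an ultrafilter. *)
set P := [set eps : R | (energy L N alpha eps (u_ eps) <= M%:E)%E].
have pF : ProperFilter (within P (0 : R)^'+).
  apply: Build_ProperFilter_ex => [V /= FV].
  have : (ereal_inf [set energy L N alpha x (u_ x) | x in [set x | P x -> V x]] < M%:E)%E.
    by apply: le_lt_trans lM; apply: ereal_sup_ubound; exists [set x | P x -> V x].
  by move=> /ereal_inf_lt[_ [x Vx <-] /ltW xM]; exists x; apply: Vx.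
have [U [UU FU]] := ultraFilterLemma pF.
apply: (@limit_energy_ultra U u_ u M) => //.
- move=> e e0; apply: FU; rewrite /within/=.
  near=> x => _; apply/andP; split; near: x; [exact: nbhs_right_gt|exact: nbhs_right_lt].
- by move=> e e0; apply: FU; rewrite /within/=; near=> x => _; near: x; exact: cv.
- by apply: FU; rewrite /within/=; near=> x.
Unshelve. all: by end_near. Qed.

End GammaLiminf.

(** * Recovery sequences *)

Section Profile.
Context {R : realType}.
Notation mu := (@lebesgue_measure R).
Implicit Types (a b c x : R) (f g h : R -> R).

Lemma prim_oo a b f g h : prim a b f g -> (forall x, a < x < b -> g x = h x) -> prim a b f h.
Proof.
move=> [gi H] gh.
have hi : itgi a b h.
  apply: itg_oo; apply: (@eq_itg _ _ g) => //.
  by apply: itgS gi => //; apply: subset_itv; rewrite bnd_simp.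
split=> // s t as_ st tb; rewrite H//.
rewrite -(ig_oo (itgiS as_ tb gi)) -(ig_oo (itgiS as_ tb hi)).
apply: eq_Rintegral => x; rewrite inE/= in_itv/= => /andP[sx xt].
by rewrite gh// (le_lt_trans as_ sx) (lt_le_trans xt tb).
Qed.

Variable t : R.
Hypothesis t0 : 0 < t.

(* The optimal profile of the Modica-Mortola energy with parameter [t ^ 2],
   tanh(z / (sqrt 2 * t ^ 2)), solves [f' = rate * (1 - f ^ 2)]. *)
Let rate : R := (Num.sqrt 2 * t ^+ 2)^-1.

Definition th c x : R := 1 - 2 / (expR (2 * rate * (x - c)) + 1).

Definition dth c x : R := rate * (1 - th c x ^+ 2).

Let s20 : 0 < Num.sqrt 2 :> R. Proof. by rewrite sqrtr_gt0. Qed.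
Let s2E : Num.sqrt 2 ^+ 2 = 2 :> R. Proof. by rewrite sqr_sqrtr. Qed.
Let rate0 : 0 < rate. Proof. by rewrite invr_gt0 mulr_gt0// exprn_gt0. Qed.

Lemma th_derive c x : is_derive x 1 (th c) (dth c x).
Proof.
set k := 2 * rate; set E := expR (k * (x - c)).
have d1 : is_derive x 1 (fun y => k * (y - c)) k.
  have -> : (fun y => k * (y - c)) = k \*: (id - cst c) by apply/funext => y.
  by apply: is_derive_eq; rewrite subr0 /GRing.scale/= mulr1.
have d2 : is_derive x 1 (fun y => expR (k * (y - c)) + 1) (E * k).
  have -> : (fun y => expR (k * (y - c)) + 1) = (expR \o (fun y => k * (y - c))) + cst 1.
    by apply/funext => y.
  have d3 := @is_derive1_comp _ expR (fun y => k * (y - c)) x _ _ (is_derive_expR (k * (x - c))) d1.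
  by apply: is_derive_eq; rewrite addr0.
have E1 : (fun y => expR (k * (y - c)) + 1) x != 0 by rewrite gt_eqF// ltr_wpDr// expR_gt0.
have d4 := @is_deriveV _ (fun y => expR (k * (y - c)) + 1) x _ _ E1 d2.
have -> : th c = cst 1 - (2 : R) \*: (fun y => (expR (k * (y - c)) + 1)^-1).
  by apply/funext => y.
apply: is_derive_eq; rewrite /dth /th -/k -/E /GRing.scale/= sub0r /k.
by field.
Qed.

Lemma th_bound c x : -1 < th c x < 1.
Proof.
have E0 := expR_gt0 (2 * rate * (x - c)).
have E1 : 0 < expR (2 * rate * (x - c)) + 1 by rewrite ltr_wpDr.
rewrite /th; apply/andP; split; last by rewrite ltrBlDr ltrDl divr_gt0.
by rewrite ltrBrDr -ltrBrDl opprK ltr_pdivrMr//; lra.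
Qed.

Lemma th_center c : th c c = 0.
Proof. by rewrite /th subrr mulr0 expR0; field. Qed.

Lemma th_le c x y : x <= y -> th c x <= th c y.
Proof.
move=> xy; rewrite /th lerB// ler_pM2l// lef_pV2 ?posrE ?ltr_wpDr ?expR_gt0// ?expR_ge0//.
by rewrite lerD2r ler_expR ler_pM2l ?mulr_gt0// lerD2r.
Qed.

Lemma th_odd c z : th c (c - z) = - th c (c + z).
Proof.
have [-> ->] : th c (c - z) = 1 - 2 / (expR (2 * rate * - z) + 1) /\
    th c (c + z) = 1 - 2 / (expR (2 * rate * z) + 1).
  by split; rewrite /th; congr (1 - 2 / (expR (_ * _) + 1)); ring.
rewrite mulrN expRN.
have E0 := expR_gt0 (2 * rate * z).
by field; rewrite !gt_eqF// ltr_wpDr// ltW.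
Qed.

Lemma th_cnt a b c : cnt a b (th c).
Proof.
apply: continuous_cnt => x; apply/differentiable_continuous/derivable1_diffP.
by case: (th_derive c x).
Qed.

Lemma dth_cnt a b c : cnt a b (dth c).
Proof.
have -> : dth c = fun x => rate * (1 + -1 * (th c x * th c x)).
  by apply/funext => x; rewrite /dth; ring.
apply: cntM; first exact: cnt_cst.
apply: cntD; first exact: cnt_cst.
apply: cntM; first exact: cnt_cst.
by apply: cntM; exact: th_cnt.
Qed.

(** The normalisation makes the truncated profile reach 1 exactly at distance [t], so that it
    continues by 1. *)
Definition th_scale : R := (th 0 t)^-1.

Lemma th_edge c : th c (c + t) = th 0 t.
Proof. by rewrite /th addrAC subrr add0r subr0. Qed.

(** With [y = sqrt 2 / t] and [exp y >= 1 + y] the edge value is at least [y / (2 + y)], whose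
    inverse is [1 + sqrt 2 t]. A bound linear in [t] is crude but sufficient. *)
Lemma th_scale_bound : 1 <= th_scale <= 1 + 2 * t.
Proof.
have /andP[_ h1] := th_bound 0 t.
pose y : R := 2 * rate * t.
have yE : y = Num.sqrt 2 / t.
  rewrite /y /rate -[X in X * _ * _]s2E; field.
  by rewrite !gt_eqF.
have y0 : 0 < y by rewrite yE divr_gt0.
have hy : y / (2 + y) <= th 0 t.
  rewrite /th subr0 -/y.
  have -> : y / (2 + y) = 1 - 2 / (2 + y) by field; rewrite gt_eqF// ltr_wpDr// ltW.
  rewrite lerB// ler_pM2l// lef_pV2 ?posrE ?ltr_wpDr ?expR_gt0 ?expR_ge0// ?(ltW y0)//.
  by have := expR_ge1Dx y; lra.
have h0 : 0 < th 0 t by apply: lt_le_trans hy; rewrite divr_gt0// addr_gt0.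
rewrite /th_scale; apply/andP; split; first by rewrite invf_ge1// ltW.
rewrite invf_ple ?posrE//; last by rewrite addr_gt0// mulr_gt0.
apply: le_trans hy.
rewrite -[leLHS]div1r ler_pdivlMr ?addr_gt0// mulrAC ler_pdivrMr; last by rewrite addr_gt0// mulr_gt0.
have : 1 <= t * y.
  rewrite yE mulrC divfK ?gt_eqF//.
  by rewrite -[leLHS]sqrtr1 ler_sqrt// ler1n.
lra.
Qed.

Definition prof c x : R := if `|x - c| < t then th_scale * `|th c x| else 1.

(** The value 0 at the centre is deliberate: nothing is known about the curve at a jump point, and
    the pointwise estimates have to hold there too. *)
Definition dprof c x : R :=
  if c < x < c + t then th_scale * dth c x
  else if c - t < x < c then - (th_scale * dth c x) else 0.

Let scale0 : 0 < th_scale.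
Proof. by have /andP[/(lt_le_trans ltr01)] := th_scale_bound. Qed.

Let scale_edge : th_scale * th 0 t = 1.
Proof. by rewrite mulVf// -invr_eq0 gt_eqF. Qed.

Let edge0 : 0 < th 0 t.
Proof. by rewrite -invr_gt0. Qed.

Lemma prof_bound c x : 0 <= prof c x <= 1.
Proof.
rewrite /prof; case: ifPn => [|_]; last by rewrite ler01 lexx.
rewrite ltr_distl => /andP[x1 x2].
rewrite mulr_ge0 ?(ltW scale0)//= -scale_edge ler_pM2l// ler_norml; apply/andP; split.
  by rewrite -(th_edge c) -th_odd th_le// ltW.
by rewrite -(th_edge c) th_le// ltW.
Qed.

Lemma prof_far c x : t <= `|x - c| -> prof c x = 1 /\ dprof c x = 0.
Proof.
move=> tx; rewrite /prof ltNge tx/=; split=> //; rewrite /dprof.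
case: ifPn => [/andP[x1 x2]|_].
  by move: tx; rewrite gtr0_norm ?subr_gt0// lerBrDl leNgt x2.
case: ifPn => // /andP[x1 x2].
by move: tx; rewrite ltr0_norm ?subr_lt0// opprB leNgt ltrBlDr -ltrBlDl x1.
Qed.

Lemma prof_center c : prof c c = 0 /\ dprof c c = 0.
Proof. by rewrite /prof /dprof !ltxx subrr normr0 t0 th_center normr0 mulr0 andbF. Qed.

Lemma prof_prim a b c : a <= c - t -> c + t <= b -> prim a b (prof c) (dprof c).
Proof.
move=> ac cb.
have pth p q k : prim p q (fun x => k * th c x) (fun x => k * dth c x).
  by apply: primZ; apply: prim_C1 => [x _|]; [exact: th_derive|exact: dth_cnt].
have cst1 p q : (forall x, p <= x <= q -> t <= `|x - c|) -> prim p q (prof c) (dprof c).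
  by move=> H; apply: eq_prim (prim_cst p q 1) => x /H/prof_far[].
have [e1 e2 e3 e4] : [/\ c - t <= b, c - t <= c, c <= b & c <= c + t].
  by have := t0; split; lra.
apply: (@prim_cat _ _ (c - t) _ _ _ ac e1); last apply: (@prim_cat _ _ c _ _ _ e2 e3); last apply: (@prim_cat _ _ (c + t) _ _ _ e4 cb).
- by apply: cst1 => x /andP[_ xc]; rewrite distrC ger0_norm; lra.
- apply: (@prim_oo _ _ _ (fun x => - th_scale * dth c x)).
    apply: (eq_prim _ _ (pth (c - t) c (- th_scale))) => // x /andP[x1 x2].
    have th0 : th c x <= 0 by rewrite -(th_center c) th_le.
    rewrite /prof distrC ger0_norm ?subr_ge0//.
    case: ifPn => [_|]; first by rewrite ler0_norm// mulrN mulNr.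
    rewrite -leNgt => tx; have -> : x = c - t by lra.
    by rewrite th_odd th_edge mulrNN.
  move=> x /andP[x1 x2]; rewrite /dprof x1 x2 (ltNge c) (ltW x2)/=; lra.
- apply: (@prim_oo _ _ _ (fun x => th_scale * dth c x)).
    apply: (eq_prim _ _ (pth c (c + t) th_scale)) => // x /andP[x1 x2].
    have th0 : 0 <= th c x by rewrite -(th_center c) th_le.
    rewrite /prof ger0_norm ?subr_ge0//.
    case: ifPn => [_|]; first by rewrite ger0_norm.
    rewrite -leNgt => tx; have -> : x = c + t by lra.
    by rewrite th_edge.
  by move=> x xc; rewrite /dprof xc.
- by apply: cst1 => x /andP[xc _]; rewrite ger0_norm; lra.
Qed.

(** Twice a common bound of the gradient and the potential terms for [eps = t ^ 2], which the
    optimal profile balances. *)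
Definition prof_cost c x : R :=
  if `|x - c| < t then th_scale ^+ 2 / (2 * t ^+ 2) * (1 - th c x ^+ 2) ^+ 2 else 0.

Lemma prof_cost_ge0 c x : 0 <= prof_cost c x.
Proof.
by rewrite /prof_cost; case: ifP => // _; rewrite mulr_ge0 ?sqr_ge0// divr_ge0 ?sqr_ge0// mulr_ge0 ?sqr_ge0.
Qed.

(** By the differential equation the gradient term is at most half of the bound. So is the potential
    term: rescaling by a factor at least 1, without exceeding 1, only brings the profile closer to
    1. *)
Lemma prof_costP c x :
  t ^+ 2 / 2 * dprof c x ^+ 2 + (4 * t ^+ 2)^-1 * (prof c x ^+ 2 - 1) ^+ 2 <= prof_cost c x.
Proof.
have t20 : 0 < t ^+ 2 by rewrite exprn_gt0.
have [/prof_far[-> ->]|xt] := leP t `|x - c|.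
  by rewrite expr1n subrr expr0n/= !mulr0 addr0; exact: prof_cost_ge0.
rewrite /prof_cost xt; set q := 1 - th c x ^+ 2.
have /andP[h1 h2] := th_bound c x.
have q0 : 0 <= q by rewrite subr_ge0 -real_normK ?num_real// expr_le1// ler_norml !ltW.
have /andP[p0 p1] := prof_bound c x.
have /andP[s1 _] := th_scale_bound.
have A : t ^+ 2 / 2 * dprof c x ^+ 2 <= th_scale ^+ 2 / (4 * t ^+ 2) * q ^+ 2.
  have E : t ^+ 2 / 2 * (th_scale * dth c x) ^+ 2 = th_scale ^+ 2 / (4 * t ^+ 2) * q ^+ 2.
    rewrite /dth -/q /rate -[X in _ / X * _ = _]s2E.
    have -> : 4 = Num.sqrt 2 ^+ 4 :> R by rewrite (exprM _ 2 2) s2E; ring.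
    by field; rewrite !gt_eqF.
  rewrite /dprof; case: ifP => _; first by rewrite E.
  case: ifP => _; first by rewrite sqrrN E.
  by rewrite expr0n/= mulr0 mulr_ge0 ?sqr_ge0// divr_ge0 ?sqr_ge0// mulr_ge0 ?sqr_ge0.
have B : (4 * t ^+ 2)^-1 * (prof c x ^+ 2 - 1) ^+ 2 <= th_scale ^+ 2 / (4 * t ^+ 2) * q ^+ 2.
  rewrite [th_scale ^+ 2 / _]mulrC -mulrA ler_pM2l ?invr_gt0 ?mulr_gt0//.
  apply: (@le_trans _ _ (q ^+ 2)); last first.
    by rewrite ler_peMl ?sqr_ge0// -(expr1n _ 2) lerXn2r ?nnegrE// ltW.
  rewrite -sqrrN opprB lerXn2r ?nnegrE//.
    by rewrite subr_ge0 expr_le1.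
  rewrite lerB// -[X in X <= _]sqr_normr lerXn2r ?nnegrE//.
  by rewrite /prof xt ler_peMl.
have -> : th_scale ^+ 2 / (2 * t ^+ 2) * q ^+ 2 =
    th_scale ^+ 2 / (4 * t ^+ 2) * q ^+ 2 + th_scale ^+ 2 / (4 * t ^+ 2) * q ^+ 2.
  by field; rewrite gt_eqF.
exact: lerD.
Qed.

(** By the differential equation the cost is the derivative of a multiple of [th - th^3 / 3], that
    is of [well_primitive] along the profile; its increment from edge to edge stays below the value
    [4/3] of the untruncated profile. *)
Lemma prof_cost_ig a b c : a <= c - t -> c + t <= b ->
  itgi a b (prof_cost c) /\ ig a b (prof_cost c) <= th_scale ^+ 2 * (2 * Num.sqrt 2 / 3).
Proof.
move=> ac cb; pose H x := th_scale ^+ 2 / (2 * t ^+ 2) * (1 - th c x ^+ 2) ^+ 2.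
pose P x := th_scale ^+ 2 * (Num.sqrt 2 / 2) * (th c x - th c x * th c x * th c x / 3).
have ct : c - t <= c + t by have := t0; lra.
have pP : prim (c - t) (c + t) P H.
  have pth : prim (c - t) (c + t) (th c) (dth c).
    by apply: prim_C1 => [x _|]; [exact: th_derive|exact: dth_cnt].
  have p3 := primM ct (primM ct pth pth) pth.
  have := primZ (th_scale ^+ 2 * (Num.sqrt 2 / 2)) (primD pth (primZ (- 3^-1) p3)).
  apply: eq_prim => x _; first by rewrite /P; ring.
  rewrite /H /dth /rate.
  have -> : (2 * t ^+ 2)^-1 = (Num.sqrt 2 * Num.sqrt 2 * t ^+ 2)^-1 by rewrite -expr2 s2E.
  have e2 : Num.sqrt 2 / 2 = (Num.sqrt 2)^-1 :> R.
    by rewrite -[X in _ / X = _]s2E; field; rewrite gt_eqF.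
  by rewrite e2; field; rewrite !gt_eqF.
have [Hi HP] := pP.
have S : `[c - t, c + t] `<=` `[a, b] by apply: subset_itv; rewrite bnd_simp.
have out x : `[a, b]%classic x -> ~ `[c - t, c + t]%classic x -> prof_cost c x = 0.
  move=> _; rewrite /= in_itv/= /prof_cost => nx.
  by case: ifPn => //; rewrite ltr_distl => /andP[x1 x2]; case: nx; rewrite !ltW.
have eqH x : c - t < x < c + t -> H x = prof_cost c x.
  by move=> xc; rewrite /prof_cost ltr_distl xc.
have [ci _] : prim (c - t) (c + t) P (prof_cost c) by exact: prim_oo pP eqH.
have mI (p q : R) : mset `[p, q] by exact: measurable_itv.
split; first by apply: (itg_sub0 _ _ S out ci); exact: mI.
rewrite (Rintegral_sub0 (mI _ _) (mI _ _) S out).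
have -> : ig (c - t) (c + t) (prof_cost c) = ig (c - t) (c + t) H.
  by rewrite -(ig_oo ci) -(ig_oo Hi); apply: eq_Rintegral => x; rewrite inE/= in_itv/= => /eqH.
rewrite -HP// /P th_odd th_edge.
set T := th 0 t.
have T1 : T < 1 by have /andP[] := th_bound 0 t.
have -> : th_scale ^+ 2 * (Num.sqrt 2 / 2) * (T - T * T * T / 3) -
    th_scale ^+ 2 * (Num.sqrt 2 / 2) * (- T - - T * - T * - T / 3) =
    th_scale ^+ 2 * (Num.sqrt 2 * (T - T * T * T / 3)) by field.
have -> : 2 * Num.sqrt 2 / 3 = Num.sqrt 2 * (2 / 3) :> R by field.
rewrite ler_pM2l ?exprn_gt0//.
rewrite ler_pM2l//.
(* [2/3 - (T - T^3 / 3) = (1 - T)^2 (2 + T) / 3]. *)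
have T0 : 0 <= (1 - T) * (1 - T) * (2 + T).
  by apply: mulr_ge0; [rewrite -expr2 sqr_ge0|rewrite addr_ge0// ltW].
rewrite -subr_ge0 (_ : _ - _ = (1 - T) * (1 - T) * (2 + T) / 3); last by field.
by rewrite divr_ge0.
Qed.

End Profile.

(** * The modulus with several zeros *)

Section ProductProfile.
Context {R : realType}.
Notation mu := (@lebesgue_measure R).
Implicit Types (a b c x : R) (s : seq R) (f g h : R -> R).
Variable t : R.
Hypothesis t0 : 0 < t.

Definition rho s x : R := \prod_(c <- s) prof t c x.

Fixpoint drho s x : R :=
  if s is c :: s' then rho s' x * dprof t c x + prof t c x * drho s' x else 0.

(** It is positive where the recovery curve may differ from the limit, and its integral is of order
    [t], which bounds all the errors of the modification. *)
Definition hits s x : R := \sum_(c <- s) (`|x - c| < t)%R%:R.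

Let rho_cons c s x : rho (c :: s) x = prof t c x * rho s x.
Proof. by rewrite /rho big_cons. Qed.

Lemma rho_bound s x : 0 <= rho s x <= 1.
Proof.
elim: s => [|c s /andP[r0 r1]]; first by rewrite /rho big_nil ler01 lexx.
by have /andP[p0 p1] := prof_bound t0 c x; rewrite rho_cons mulr_ge0// mulr_ile1.
Qed.

Lemma rho_prim a b s : a <= b -> (forall c, c \in s -> a <= c - t /\ c + t <= b) ->
  prim a b (rho s) (drho s).
Proof.
move=> ab; elim: s => [_|c s IH H].
  by apply: eq_prim (prim_cst a b 1) => // x _; rewrite /rho big_nil.
have [ac cb] := H c (mem_head _ _).
have := primM ab (prof_prim t0 ac cb) (IH (fun d ds => H d (mem_behead (s := c :: s) ds))).
by apply: eq_prim => x _ //; rewrite rho_cons.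
Qed.

Lemma rho_far s x : (forall c, c \in s -> t <= `|x - c|) -> rho s x = 1 /\ drho s x = 0.
Proof.
elim: s => [_|c s IH H]; first by rewrite /rho big_nil.
have [E1 E2] := IH (fun d ds => H d (mem_behead (s := c :: s) ds)).
have [p1 p2] := prof_far (H c (mem_head _ _)).
by rewrite rho_cons /= E1 E2 p1 p2 !mulr1 mulr0 addr0.
Qed.

Lemma rho_center s c : c \in s -> rho s c = 0 /\ drho s c = 0.
Proof.
elim: s => [//|d s IH]; rewrite inE rho_cons /= => /predU1P[->|/IH[-> E]].
  by have [-> ->] := prof_center t0 d; rewrite !mul0r mulr0 addr0.
by rewrite E mul0r !mulr0 addr0.
Qed.

Lemma hits_ge0 s x : 0 <= hits s x.
Proof. by apply: sumr_ge0 => c _; rewrite ler0n. Qed.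

Lemma hits_ig a b s : a <= b -> itgi a b (hits s) /\ ig a b (hits s) <= (size s)%:R * (2 * t).
Proof.
move=> ab; rewrite /hits; elim: s => [|c s [IH1 IH2]].
  have E x : \sum_(c <- [::]) (`|x - c| < t)%R%:R = 0 :> R by rewrite big_nil.
  split; first by apply: eq_itgi (itgi_cst a b 0) => x _; rewrite E.
  by rewrite (eq_ig (g := fun=> 0)) => [|x _]; rewrite ?E// ig_cst// !mul0r.
pose k x : R := (`|x - c| < t)%R%:R.
have E x : \sum_(d <- c :: s) (`|x - d| < t)%R%:R = k x + \sum_(d <- s) (`|x - d| < t)%R%:R.
  by rewrite big_cons.
have mI (p q : R) : mset `[p, q] by exact: measurable_itv.
have ct : c - t <= c + t by have := t0; lra.
have ki p q : itgi p q k.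
  have kt : itgi (c - t) (c + t) k.
    have [//] : prim (c - t) (c + t) (fun x => x) k.
    apply: (@prim_oo _ _ _ _ (fun=> 1)).
      by apply: prim_C1 => // ; exact: cnt_cst.
    by move=> x xc; rewrite /k ltr_distl xc.
  pose p' := Num.min p (c - t); pose q' := Num.max q (c + t).
  apply: (@itgiS _ p' q'); [by rewrite ge_min lexx|by rewrite le_max lexx|].
  apply: (itg_sub0 (mI _ _) (mI _ _) _ _ kt).
    by apply: subset_itv; rewrite bnd_simp ?ge_min ?le_max lexx orbT.
  move=> x _ /=; rewrite in_itv/= /k => nx.
  by case: ltP => //; rewrite ltr_distl => /andP[x1 x2]; case: nx; rewrite !ltW.
split; first by apply: eq_itgi (itgD (mI a b) (ki a b) IH1) => x _; rewrite E.
rewrite (eq_ig (g := fun x => k x + \sum_(d <- s) (`|x - d| < t)%R%:R)) => [|x _]; last exact: E.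
rewrite igD// /= -natr1 mulrDl mul1r [leLHS]addrC lerD//.
pose p := Num.min a (c - t); pose q := Num.max b (c + t).
have pq : `[a, b] `<=` `[p, q].
  by apply: subset_itv; rewrite bnd_simp ?ge_min ?le_max lexx.
apply: (@le_trans _ _ (ig p q k)).
  by apply: le_Rintegral_set => //; exact: ki.
rewrite (@Rintegral_sub0 _ `[c - t, c + t])//.
- apply: (@le_trans _ _ (ig (c - t) (c + t) (fun=> 1))).
    by apply: ig_le => // [|x _]; [exact: itgi_cst|rewrite /k; case: ltP].
  rewrite ig_cst//; lra.
- by apply: subset_itv; rewrite bnd_simp ?ge_min ?le_max lexx orbT.
- move=> x _ /=; rewrite in_itv/= /k => nx.
  by case: ltP => //; rewrite ltr_distl => /andP[x1 x2]; case: nx; rewrite !ltW.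
Qed.

(** Centres are more than [2 * t] apart, so at each point at most one factor of the product differs
    from 1. *)
Lemma rho_cost s x : uniq s ->
  (forall c d, c \in s -> d \in s -> c != d -> 2 * t < `|c - d|) ->
  t ^+ 2 / 2 * drho s x ^+ 2 + (4 * t ^+ 2)^-1 * (rho s x ^+ 2 - 1) ^+ 2
    <= \sum_(c <- s) prof_cost t c x.
Proof.
elim: s => [_ _|c s IH /= /andP[cs us] sep].
  by rewrite big_nil /rho big_nil /= expr1n subrr expr0n/= !mulr0 addr0.
rewrite big_cons rho_cons.
have [xc|xc] := ltP `|x - c| t.
  have far d : d \in s -> t <= `|x - d|.
    move=> ds; have dc : c != d by apply: contraNneq cs => ->.
    have := sep c d (mem_head _ _) (mem_behead (s := c :: s) ds) dc.
    have -> : c - d = (x - d) - (x - c) by ring.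
    have := ler_normB (x - d) (x - c); lra.
  have [-> ->] := rho_far far; rewrite mul1r mulr0 addr0 mulr1.
  apply: le_trans (prof_costP t0 c x) _; rewrite lerDl.
  by apply: sumr_ge0 => d _; exact: prof_cost_ge0.
have [-> ->] := prof_far xc; rewrite mulr0 !mul1r add0r.
apply: (@le_trans _ _ (\sum_(d <- s) prof_cost t d x)); last first.
  by rewrite lerDr prof_cost_ge0.
apply: IH => // d e ds es; apply: sep; exact: (mem_behead (s := c :: s)).
Qed.

Lemma rho_cost_ig a b s : a <= b -> (forall c, c \in s -> a <= c - t /\ c + t <= b) ->
  itgi a b (fun x => \sum_(c <- s) prof_cost t c x) /\
  ig a b (fun x => \sum_(c <- s) prof_cost t c x) <=
    (size s)%:R * (th_scale t ^+ 2 * (2 * Num.sqrt 2 / 3)).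
Proof.
move=> ab; elim: s => [_|c s IH H].
  have E x : \sum_(c <- [::]) prof_cost t c x = 0 :> R by rewrite big_nil.
  split; first by apply: eq_itgi (itgi_cst a b 0) => x _; rewrite E.
  by rewrite (eq_ig (g := fun=> 0)) => [|x _]; rewrite ?E// ig_cst// !mul0r.
have [IH1 IH2] := IH (fun d ds => H d (mem_behead (s := c :: s) ds)).
have [ac cb] := H c (mem_head _ _).
have [ci cH] := prof_cost_ig t0 ac cb.
have E x : \sum_(d <- c :: s) prof_cost t d x = prof_cost t c x + \sum_(d <- s) prof_cost t d x.
  by rewrite big_cons.
have mI (p q : R) : mset `[p, q] by exact: measurable_itv.
split; first by apply: eq_itgi (itgD (mI a b) ci IH1) => x _; rewrite E.
rewrite (eq_ig (g := fun x => prof_cost t c x + \sum_(d <- s) prof_cost t d x)) => [|x _]; last exact: E.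
by rewrite igD// /= -natr1 mulrDl mul1r [leLHS]addrC lerD.
Qed.

End ProductProfile.

(** * Multiplying a curve with jumps by the modulus *)

Section RecoveryCurve.
Context {R : realType}.
Notation mu := (@lebesgue_measure R).
Notation W := (`[(-1 : R), 2]%classic).
Notation I01 := (unit_interval : set R).
Implicit Types (x l : R) (s : seq R) (A F G H : R -> R).

(** Agreement with [F] is asked on the open side only, so [A x] itself is free and [l] is the
    one-sided limit. [piecewise_prim] below thus permits jumps at points of [s] only. *)
Definition right_prim A G x l := exists2 r, 0 < r & exists F H,
  [/\ prim x (x + r) F H, forall y, x < y < x + r -> A y = F y /\ G y = H y & F x = l].

Definition left_prim A G x l := exists2 r, 0 < r & exists F H,
  [/\ prim (x - r) x F H, forall y, x - r < y < x -> A y = F y /\ G y = H y & F x = l].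

Definition piecewise_prim s A G := forall x,
  (exists l, right_prim A G x l /\ (x \notin s -> l = A x)) /\
  (exists l, left_prim A G x l /\ (x \notin s -> l = A x)).

Variable t : R.
Hypothesis t0 : 0 < t.

Lemma rho_mul_prim s A G : (forall c, c \in s -> -1 <= c - t /\ c + t <= 2) ->
  piecewise_prim s A G ->
  prim (-1) 2 (fun x => rho t s x * A x) (fun x => drho t s x * A x + rho t s x * G x).
Proof.
move=> sW pw.
have pr : prim (-1) 2 (rho t s) (drho t s) by apply: rho_prim => //; lra.
pose P p q := prim p q (fun x => rho t s x * A x) (fun x => drho t s x * A x + rho t s x * G x).
have main p q F H : p <= q -> -1 <= p -> q <= 2 -> prim p q F H ->
    (forall x, p <= x <= q -> rho t s x * A x = rho t s x * F x) ->
    (forall x, p < x < q -> A x = F x /\ G x = H x) -> P p q.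
  move=> pq p1 q2 pF rAF AF.
  apply: (@prim_oo _ _ _ _ (fun x => F x * drho t s x + rho t s x * H x)); last first.
    by move=> x /AF[-> ->]; ring.
  have := primM pq (primS p1 q2 pr) pF.
  by apply: eq_prim => x xpq; rewrite ?rAF.
apply: (@cousin _ _ _ P); first by lra.
  by move=> p r q _ pr' rq _; exact: prim_cat.
move=> x /andP[x1 x2].
have [[l1 [[r1 r10 [F1 [H1 [p1 e1 v1]]]] c1]] [l2 [[r2 r20 [F2 [H2 [p2 e2 v2]]]] c2]]] := pw x.
exists (Num.min r1 r2); first by rewrite lt_min r10.
have at_x F : (x \notin s -> F x = A x) -> rho t s x * A x = rho t s x * F x.
  by have [/(rho_center t0)[-> _]|_ ->] := boolP (x \in s); rewrite ?mul0r.
split=> [q /andP[xq qd] q2|p /andP[dp px] p1'].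
- have qr : q < x + r1 by apply: lt_le_trans qd _; rewrite lerD2l ge_min lexx.
  apply: (@main _ _ F1 H1) => //.
  + by apply: primS p1 => //; exact: ltW.
  + move=> y /andP[]; rewrite le_eqVlt => /predU1P[<- _|xy yq].
      by apply: at_x => xs; rewrite v1 c1.
    by have [|-> _] := e1 y; first by rewrite xy (le_lt_trans yq).
  + by move=> y /andP[xy yq]; apply: e1; rewrite xy (lt_trans yq).
- have pr2 : x - r2 < p by apply: le_lt_trans dp; rewrite lerB// ge_min lexx orbT.
  apply: (@main _ _ F2 H2) => //.
  + by apply: primS p2 => //; exact: ltW.
  + move=> y /andP[py]; rewrite le_eqVlt => /predU1P[->|yx].
      by apply: at_x => xs; rewrite v2 c2.
    by have [|-> _] := e2 y; first by rewrite yx (lt_le_trans pr2 py).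
  + by move=> y /andP[py yx]; apply: e2; rewrite yx (lt_trans pr2).
Qed.

Variables (L alpha : R) (N : nat) (s : seq R) (A1 A2 G1 G2 : R -> R).
Hypotheses (us : uniq s)
  (sep : forall c d, c \in s -> d \in s -> c != d -> 2 * t < `|c - d|)
  (s01 : forall c, c \in s -> t <= c <= 1 - t)
  (pw1 : piecewise_prim s A1 G1) (pw2 : piecewise_prim s A2 G2)
  (sG1 : sqint W G1) (sG2 : sqint W G2)
  (Gout : forall x, ~ (0 < x < 1) -> G1 x = 0 /\ G2 x = 0)
  (Aunit : forall x, x \notin s -> A1 x ^+ 2 + A2 x ^+ 2 = 1)
  (Aleft : forall x, x <= 0 -> (A1 x, A2 x) = (1, 0))
  (Aright : forall x, 1 <= x -> (A1 x, A2 x) = cis alpha).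

Let v1 x := rho t s x * A1 x.
Let v2 x := rho t s x * A2 x.
Let b1 x := drho t s x * A1 x + rho t s x * G1 x.
Let b2 x := drho t s x * A2 x + rho t s x * G2 x.
Let v x := (v1 x, v2 x).
Let cost x := \sum_(c <- s) prof_cost t c x.

Let sW c : c \in s -> -1 <= c - t /\ c + t <= 2.
Proof. by move=> /s01; have := t0; split; lra. Qed.

Let mW : mset W. Proof. exact: measurable_itv. Qed.
Let p1 : prim (-1) 2 v1 b1. Proof. exact: rho_mul_prim. Qed.
Let p2 : prim (-1) 2 v2 b2. Proof. exact: rho_mul_prim. Qed.

Let costP x : t ^+ 2 / 2 * drho t s x ^+ 2 + (4 * t ^+ 2)^-1 * (rho t s x ^+ 2 - 1) ^+ 2 <= cost x.
Proof. exact: rho_cost. Qed.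

Let rle1 x : rho t s x ^+ 2 <= 1.
Proof. by have /andP[r0 r1] := rho_bound t0 s x; rewrite expr_le1. Qed.

Let W12 : -1 <= 2 :> R. Proof. by lra. Qed.

Let sb (k : R -> R) (A G : R -> R) : sqint W G -> prim (-1) 2 k (fun x => drho t s x * A x + rho t s x * G x) ->
  (forall x, x \notin s -> A x ^+ 2 <= 1) -> sqint W (fun x => drho t s x * A x + rho t s x * G x).
Proof.
move=> [mG iG] [bi _] A1'; set b := fun x => _.
have mb : mfun_on W b by exact: itg_measurable bi.
split=> //.
have [ci _] := rho_cost_ig t0 W12 sW.
(* From [(p + q)^2 <= 2 p^2 + 2 q^2], the first term being controlled by
   [drho^2 <= 2 / t^2 * cost]. *)
apply: (@itg_le _ _ _ (fun x => 4 / t ^+ 2 * cost x + 2 * G x ^+ 2)) => //.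
- exact: measurable_funX.
- move=> x _; rewrite ger0_norm ?sqr_ge0// /b.
  have dc : drho t s x ^+ 2 <= 2 / t ^+ 2 * cost x.
    rewrite -ler_pdivrMl ?divr_gt0 ?exprn_gt0// invf_div.
    apply: le_trans (costP x); rewrite lerDl mulr_ge0 ?sqr_ge0// invr_ge0 mulr_ge0 ?sqr_ge0//.
  have da : drho t s x ^+ 2 * A x ^+ 2 <= drho t s x ^+ 2.
    have [/(rho_center t0)[_ ->]|xs] := boolP (x \in s); first by rewrite expr0n mul0r.
    by rewrite ler_piMr ?sqr_ge0// A1'.
  have rg : rho t s x ^+ 2 * G x ^+ 2 <= G x ^+ 2 by rewrite ler_piMl ?sqr_ge0.
  have := sqr_ge0 (drho t s x * A x - rho t s x * G x).
  move: dc da rg; set d2 := 2 / _ * _ => dc da rg.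
  have -> : 4 / t ^+ 2 * cost x = 2 * d2 by rewrite /d2; ring.
  rewrite -!exprMn in da rg *; rewrite sqrrB sqrrD; lra.
- by apply: itgD => //; apply: itgZ.
Qed.

Let A11 x : x \notin s -> A1 x ^+ 2 <= 1.
Proof. by move=> /Aunit <-; rewrite lerDl sqr_ge0. Qed.
Let A21 x : x \notin s -> A2 x ^+ 2 <= 1.
Proof. by move=> /Aunit <-; rewrite lerDr sqr_ge0. Qed.
Let sb1 : sqint W b1. Proof. exact: (sb sG1 p1 A11). Qed.
Let sb2 : sqint W b2. Proof. exact: (sb sG2 p2 A21). Qed.

Let out x : ~ (0 < x < 1) -> rho t s x = 1 /\ drho t s x = 0.
Proof.
move=> nx; apply: rho_far => c /s01 /andP[c1 c2]; rewrite leNgt; apply/negP.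
by rewrite ltr_distl => /andP[h1 h2]; apply: nx; apply/andP; split; lra.
Qed.

Let not_center x : ~ (0 < x < 1) -> x \notin s.
Proof. by move=> nx; apply/negP => /s01; have := t0; move=> h h'; apply: nx; lra. Qed.

Let mI : mset I01. Proof. exact: mset01. Qed.
Let oI : open I01. Proof. exact: itv_open. Qed.
Let SI : I01 `<=` W. Proof. by apply: subset_itv; rewrite bnd_simp; lra. Qed.

Let wd k b : prim (-1) 2 k b -> sqint W b -> L2 I01 k /\ is_weak_deriv I01 k b.
Proof.
move=> pk sbb; have ck := prim_cnt pk.
have sk : L2 I01 k.
  apply/(L2P _ mI); apply: (@sqintS _ _ W) => //; split; first exact: cnt_measurable.
  by apply: cnt_itg; exact: (cntM ck ck).
split=> //; apply: (@prim_weak_deriv _ I01 0 1 k b k) => //.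
- by apply/(L2P _ mI); exact: (sqintS mI mW SI sbb).
- exact: aeW.
- move=> x; rewrite /unit_interval /= in_itv/= => /andP[x0 x1]; exists 1 => //.
  by apply: primS pk; lra.
Qed.

Lemma recovery_admissible : admissible alpha v.
Proof.
have [L1 w1] := wd p1 sb1; have [L2' w2] := wd p2 sb2.
have c1 : cnt 0 1 v1 by apply: cntS (prim_cnt p1); lra.
have c2 : cnt 0 1 v2 by apply: cntS (prim_cnt p2); lra.
have [r0 _] : rho t s 0 = 1 /\ drho t s 0 = 0 by apply: out; lra.
have [r1 _] : rho t s 1 = 1 /\ drho t s 1 = 0 by apply: out; lra.
split.
- by split; split=> //; [exists b1|exists b2].
- apply/(right_traceP ltr01 c1 c2); first exact: aeW.
  by rewrite /v1 /v2 r0 !mul1r Aleft.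
- apply/(left_traceP ltr01 c1 c2); first exact: aeW.
  by rewrite /v1 /v2 r1 !mul1r Aright.
Qed.

(* The terms containing drho cancel. *)
Lemma recovery_torque :
  sqint `[0, 1] (fun x => rho t s x ^+ 2 * (A1 x * G2 x - A2 x * G1 x)).
Proof.
have [N1 H1] := cnt_bounded (prim_cnt p1); have [N2 H2] := cnt_bounded (prim_cnt p2).
have m01 : mset `[(0 : R), 1] by exact: measurable_itv.
have S01 : `[(0 : R), 1] `<=` W by apply: subset_itv; rewrite bnd_simp; lra.
apply: (sqintS m01 mW S01); apply: (@eq_sqint _ _ (fun x => v1 x * b2 x - v2 x * b1 x)) => //.
  by move=> x _; rewrite /v1 /v2 /b1 /b2; ring.
apply: sqintB => //.
  by apply: (@sqintM _ _ _ _ N1) => //; exact: cnt_measurable (prim_cnt p1).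
by apply: (@sqintM _ _ _ _ N2) => //; exact: cnt_measurable (prim_cnt p2).
Qed.

(** Splitting with weight [t] multiplies the profile cost by [1 + t] only, while the derivative of
    the limit enters with [t^2 / 2 * (1 + 1 / t) = (t^2 + t) / 2]. Both corrections disappear as [t]
    tends to 0. *)
Lemma recovery_energy : exists2 Y,
  Y <= (1 + t) * ((size s)%:R * (th_scale t ^+ 2 * (2 * Num.sqrt 2 / 3)))
       + (t ^+ 2 + t) / 2 * (ig (-1) 2 (fun x => G1 x ^+ 2 + G2 x ^+ 2)) &
  energy L N alpha (t ^+ 2) v = (Y + L / 2 *
    ig 0 1 (fun x => (rho t s x ^+ 2 * (A1 x * G2 x - A2 x * G1 x) - 2 * pi * N%:R) ^+ 2))%:E.
Proof.
have t20 : 0 < t ^+ 2 by rewrite exprn_gt0.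
have [L1 w1] := wd p1 sb1; have [L2' w2] := wd p2 sb2.
exists (ig (-1) 2 (mm_density (t ^+ 2) v1 v2 b1 b2)); last first.
  rewrite (energyE L N t20 recovery_admissible p1 p2 sb1 sb2).
  - congr ((_ + _ * _)%:E); apply: eq_ig => x _; congr ((_ - _) ^+ 2).
    by rewrite /v1 /v2 /b1 /b2; ring.
  - move=> x nx; have [r1 d0] := out nx; have [g1 g2] := Gout nx.
    rewrite /b1 /b2 r1 d0 g1 g2 !mul0r mulr0 addr0; split=> //.
    by rewrite /sqmod /v1 /v2 r1 !mul1r Aunit// not_center.
  - exact: aeW.
  - have [h1 h2] : H1vec I01 v by case: recovery_admissible.
    have q1 := weak_deriv_unique oI mI L1 w1 (wderivP h1).
    have q2 := weak_deriv_unique oI mI L2' w2 (wderivP h2).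
    by apply: aeS2 q1 q2 => x e1 e2 x01; congr pair; [exact: e1|exact: e2].
have [ci cH] := rho_cost_ig t0 W12 sW.
have [[_ i1] [_ i2]] := (sG1, sG2).
have iG : itgi (-1) 2 (fun x => G1 x ^+ 2 + G2 x ^+ 2) by exact: itgD.
have tt : 0 <= 1 + t by rewrite addr_ge0// ltW.
apply: (@le_trans _ _ (ig (-1) 2 (fun x => (1 + t) * cost x
     + (t ^+ 2 + t) / 2 * (G1 x ^+ 2 + G2 x ^+ 2)))); last first.
  by rewrite igD; [rewrite !igZ// lerD2r ler_wpM2l|exact: itgZ|exact: itgZ].
apply: ig_le.
- exact: (mm_density_itgi (t ^+ 2) (prim_cnt p1) (prim_cnt p2) sb1 sb2).
- by apply: itgD => //; exact: itgZ.
move=> x _; rewrite /mm_density.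
have cx := costP x.
have G0 : 0 <= (t ^+ 2 + t) / 2 * (G1 x ^+ 2 + G2 x ^+ 2).
  by rewrite mulr_ge0 ?addr_ge0 ?divr_ge0 ?addr_ge0 ?sqr_ge0// ltW.
have c0 : 0 <= cost x by apply: sumr_ge0 => c _; exact: prof_cost_ge0.
(* [Aunit] says nothing at a centre, but there [rho] and [drho] both vanish. *)
have [xs|xs] := boolP (x \in s).
  have [r0 d0] := rho_center t0 xs.
  move: cx; rewrite /b1 /b2 /sqmod /v1 /v2 r0 d0 !mul0r addr0 !expr0n/= addr0 !mulr0 !add0r.
  move=> cx; apply: le_trans cx _; rewrite -[leLHS]addr0 lerD//.
  by rewrite ler_peMl// lerDl ltW.
have -> : sqmod v1 v2 x = rho t s x ^+ 2.
  by rewrite /sqmod /v1 /v2 !exprMn -mulrDr Aunit// mulr1.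
set d := drho t s x in cx *; set r := rho t s x in cx *.
(* Young's inequality for the cross term, with weight t. *)
have Y (A G : R) : (d * A + r * G) ^+ 2 <= (1 + t) * (d ^+ 2 * A ^+ 2) + (1 + t^-1) * G ^+ 2.
  apply: (@le_trans _ _ ((1 + t) * (d ^+ 2 * A ^+ 2) + (1 + t^-1) * (r ^+ 2 * G ^+ 2))); last first.
    rewrite lerD2l ler_wpM2l//; first by rewrite addr_ge0// invr_ge0 ltW.
    by rewrite ler_piMl ?sqr_ge0// rle1.
  rewrite -subr_ge0.
  have -> : (1 + t) * (d ^+ 2 * A ^+ 2) + (1 + t^-1) * (r ^+ 2 * G ^+ 2) - (d * A + r * G) ^+ 2
    = (t * (d * A) - r * G) ^+ 2 / t by field; rewrite gt_eqF.
  by rewrite divr_ge0 ?sqr_ge0// ltW.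
have bb : b1 x ^+ 2 + b2 x ^+ 2 <= (1 + t) * d ^+ 2 + (1 + t^-1) * (G1 x ^+ 2 + G2 x ^+ 2).
  have -> : (1 + t) * d ^+ 2 = (1 + t) * (d ^+ 2 * A1 x ^+ 2) + (1 + t) * (d ^+ 2 * A2 x ^+ 2).
    by rewrite -mulrDr -mulrDr Aunit// mulr1.
  by rewrite mulrDr addrACA; apply: lerD; exact: Y.
set p := (4 * _)^-1 * _ in cx *.
have p0 : 0 <= p by rewrite mulr_ge0 ?sqr_ge0// invr_ge0 mulr_ge0// ltW.
apply: (@le_trans _ _ (t ^+ 2 / 2 * ((1 + t) * d ^+ 2 + (1 + t^-1) * (G1 x ^+ 2 + G2 x ^+ 2)) + (1 + t) * p)).
  apply: lerD; last by rewrite ler_peMl// lerDl ltW.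
  by rewrite ler_wpM2l// divr_ge0// ltW.
have -> : t ^+ 2 / 2 * ((1 + t) * d ^+ 2 + (1 + t^-1) * (G1 x ^+ 2 + G2 x ^+ 2)) + (1 + t) * p =
  (1 + t) * (t ^+ 2 / 2 * d ^+ 2 + p) + (t ^+ 2 + t) / 2 * (G1 x ^+ 2 + G2 x ^+ 2).
  by field; rewrite gt_eqF.
by rewrite lerD2r ler_wpM2l.
Qed.

End RecoveryCurve.

(** * Pointwise representatives of a curve with jumps *)

Section Representative.
Context {R : realType}.
Notation mu := (@lebesgue_measure R).
Notation W := (`[(-1 : R), 2]%classic).
Notation I01 := (unit_interval : set R).
Implicit Types (x l r : R) (s : seq R) (A F G H f : R -> R).

(** Imposing the boundary values before [p] and from [q] on moves a jump at an end point of the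
    interval to [p] or [q]. *)
Definition cut p q l r A x : R := if x < p then l else if q <= x then r else A x.

Lemma piecewise_cut s p q A G l r : p < q ->
  (forall x, p <= x -> x < q -> exists c, right_prim A G x c /\ (x \notin s -> c = A x)) ->
  (forall x, p < x -> x <= q -> exists c, left_prim A G x c /\ (x \notin s -> c = A x)) ->
  (p \notin s -> A p = l) -> (q \notin s -> A q = r) ->
  piecewise_prim s (cut p q l r A) (cut p q 0 0 G).
Proof.
move=> pq Hr Hl Ap Aq x; split.
- have [xp|px] := ltP x p.
    exists l; split; last by rewrite /cut xp.
    exists (p - x); first by rewrite subr_gt0.
    exists (fun=> l), (fun=> 0); split; [exact: prim_cst| |by []].
    by move=> y /andP[_]; rewrite addrC subrK /cut => ->.
  have [xq|qx] := ltP x q; last first.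
    exists r; split; last by rewrite /cut ltNge px/= qx.
    exists 1 => //; exists (fun=> r), (fun=> 0); split; [exact: prim_cst| |by []].
    by move=> y /andP[/ltW xy _]; rewrite /cut ltNge (le_trans px xy)/= (le_trans qx).
  have [c [[d d0 [F [H [pF AF Fx]]]] cA]] := Hr x px xq.
  exists c; split; last by rewrite /cut ltNge px/= leNgt xq.
  exists (Num.min d (q - x)); first by rewrite lt_min d0 subr_gt0.
  exists F, H; split=> //.
    by apply: primS pF => //; rewrite lerD2l ge_min lexx.
  move=> y /andP[xy]; rewrite -ltrBlDl lt_min => /andP[yd yq].
  have yq' : y < q by lra.
  rewrite /cut ltNge (le_trans px (ltW xy))/= leNgt yq'/=.
  by apply: AF; rewrite xy/=; lra.
- have [xp|px] := leP x p.
    exists l; split.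
      exists 1 => //; exists (fun=> l), (fun=> 0); split; [exact: prim_cst| |by []].
      by move=> y /andP[_ yx]; rewrite /cut (lt_le_trans yx xp).
    move: xp; rewrite le_eqVlt /cut => /predU1P[->|->]//.
    by rewrite ltxx leNgt pq/= => /Ap.
  have [xq|qx] := leP x q; last first.
    exists r; split; last by rewrite /cut ltNge (ltW px)/= (ltW qx).
    exists (x - q); first by rewrite subr_gt0.
    exists (fun=> r), (fun=> 0); split; [exact: prim_cst| |by []].
    move=> y /andP[]; rewrite subKr => qy _.
    by rewrite /cut ltNge (ltW (lt_trans pq qy))/= (ltW qy).
  have [c [[d d0 [F [H [pF AF Fx]]]] cA]] := Hl x px xq.
  exists c; split; last first.
    rewrite /cut ltNge (ltW px)/=.
    move: xq; rewrite le_eqVlt => /predU1P[xq|xq] xs.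
      by rewrite xq lexx cA// xq Aq// -xq.
    by rewrite leNgt xq/= cA.
  exists (Num.min d (x - p)); first by rewrite lt_min d0 subr_gt0.
  exists F, H; split=> //.
    by apply: primS pF => //; rewrite lerB// ge_min lexx.
  move=> y /andP[+ yx]; rewrite ltrBlDr -ltrBlDl lt_min => /andP[yd yp].
  have [py yq'] : p < y /\ y < q by split; lra.
  rewrite /cut ltNge (ltW py)/= leNgt yq'/=.
  by apply: AF; rewrite yx andbT; lra.
Qed.

Variable J : set R.
Hypothesis fJ : finite_set J.
Let D := I01 `\` J.

Let mI : mset I01. Proof. exact: mset01. Qed.
Let mD : mset D. Proof. by apply: measurableD => //; exact: finite_mset. Qed.
Let oD : open D. Proof. by apply: open_setD_finite => //; exact: itv_open. Qed.

Lemma punctured_gap x : exists2 r, 0 < r & forall y, `|x - y| < r -> y != x -> ~ J y.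
Proof.
have fJx : finite_set (J `\ x) := finite_setD _ fJ.
have [|r r0 H] := @seq_dist_gt0 _ x (finmap.enum_fset (fset_set (J `\ x))).
  by apply/negP; rewrite in_fset_set// inE => -[_]; apply.
exists r => // y xy yx Jy; have : r <= `|x - y|.
  by apply: H; rewrite in_fset_set// inE; split=> // yx'; rewrite yx' eqxx in yx.
by rewrite leNgt xy.
Qed.

Lemma right_gap x : 0 <= x < 1 -> exists2 r, 0 < r & forall y, x < y < x + r -> D y.
Proof.
move=> /andP[x0 x1]; have [r r0 H] := punctured_gap x.
exists (Num.min r (1 - x)); first by rewrite lt_min r0 subr_gt0.
move=> y /andP[xy]; rewrite -ltrBlDl lt_min => /andP[yr y1]; split.
  by rewrite /unit_interval /= in_itv/=; apply/andP; split; lra.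
by apply: H; rewrite ?gt_eqF// distrC gtr0_norm ?subr_gt0.
Qed.

Lemma left_gap x : 0 < x <= 1 -> exists2 r, 0 < r & forall y, x - r < y < x -> D y.
Proof.
move=> /andP[x0 x1]; have [r r0 H] := punctured_gap x.
exists (Num.min r x); first by rewrite lt_min r0 x0.
move=> y /andP[+ yx]; rewrite ltrBlDr -ltrBlDl lt_min => /andP[yr y1]; split.
  by rewrite /unit_interval /= in_itv/=; apply/andP; split; lra.
by apply: H; rewrite ?lt_eqF// gtr0_norm ?subr_gt0.
Qed.

Let rep f a b : H1 D f -> a < b -> (forall y, a < y < b -> D y) -> exists F,
  [/\ prim a b F (wderiv D f), {ae mu, forall y, a < y < b -> f y = F y} &
      forall y, a < y < b -> cval f y = F y].
Proof.
move=> hf ab abD.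
have S : `]a, b[ `<=` D by move=> y; rewrite /= in_itv/=; exact: abD.
have mab : mset `]a, b[ by exact: measurable_itv.
have w := weak_derivS mab mD S (wderivP hf).
have sf : L2 `]a, b[ f by case: hf => /(L2P _ mD) sf _; apply/(L2P _ mab); exact: (sqintS mab mD S sf).
have [F pF ae] := weak_deriv_itv ab sf w.
by exists F; split=> //; exact: cvalE (prim_cnt pF) ae.
Qed.

Let cval_cnt f x : H1 D f -> D x -> exists2 d, 0 < d & cnt (x - d) (x + d) (cval f).
Proof.
move=> hf Dx; have [d d0 Dd] := open_ball_itv oD Dx; exists d => //.
have [_ H] := weak_deriv_cval oD mD (proj1 hf) (wderivP hf).
have le_d : x - d <= x + d by lra.
apply: prim_cnt (H _ _ le_d _) => y.
by rewrite /= in_itv/=; exact: Dd.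
Qed.

(** The primitive extends up to [x] even if [x] is a jump, where its value is the one-sided limit;
    at a point of [D] no jump is possible and the limit is the value of [cval f]. *)
Lemma right_rep f x r : H1 D f -> 0 < r -> (forall y, x < y < x + r -> D y) -> exists F,
  [/\ prim x (x + r) F (wderiv D f), {ae mu, forall y, x < y < x + r -> f y = F y},
      forall y, x < y < x + r -> cval f y = F y & D x -> F x = cval f x].
Proof.
move=> hf r0 rD; have xr : x < x + r by lra.
have [F [pF ae cF]] := rep hf xr rD; exists F; split=> // Dx.
have [d d0 cd] := cval_cnt hf Dx; pose e := Num.min r d.
have e0 : 0 < e by rewrite lt_min r0.
have [er ed] : e <= r /\ e <= d by rewrite !ge_min !lexx orbT.
have xe : x < x + e by lra.
apply: (@cnt_ae_eq _ x (x + e) F (cval f)) => //.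
- by apply: cntS (prim_cnt pF); lra.
- by apply: cntS cd; lra.
- by apply: aeW => y yx; rewrite cF//; lra.
- by lra.
Qed.

Lemma left_rep f x r : H1 D f -> 0 < r -> (forall y, x - r < y < x -> D y) -> exists F,
  [/\ prim (x - r) x F (wderiv D f), {ae mu, forall y, x - r < y < x -> f y = F y},
      forall y, x - r < y < x -> cval f y = F y & D x -> F x = cval f x].
Proof.
move=> hf r0 rD; have xr : x - r < x by lra.
have [F [pF ae cF]] := rep hf xr rD; exists F; split=> // Dx.
have [d d0 cd] := cval_cnt hf Dx; pose e := Num.min r d.
have e0 : 0 < e by rewrite lt_min r0.
have [er ed] : e <= r /\ e <= d by rewrite !ge_min !lexx orbT.
have xe : x - e < x by lra.
apply: (@cnt_ae_eq _ (x - e) x F (cval f)) => //.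
- by apply: cntS (prim_cnt pF); lra.
- by apply: cntS cd; lra.
- by apply: aeW => y yx; rewrite cF//; lra.
- by lra.
Qed.

Lemma cval_unit f g x : H1 D f -> H1 D g ->
  {ae mu, forall y, D y -> f y ^+ 2 + g y ^+ 2 = 1} -> D x -> cval f x ^+ 2 + cval g x ^+ 2 = 1.
Proof.
move=> hf hg fg Dx.
have [d1 d10 c1] := cval_cnt hf Dx; have [d2 d20 c2] := cval_cnt hg Dx.
have [d3 d30 Dd] := open_ball_itv oD Dx.
have [e1 _] := weak_deriv_cval oD mD (proj1 hf) (wderivP hf).
have [e2 _] := weak_deriv_cval oD mD (proj1 hg) (wderivP hg).
pose d := Num.min d1 (Num.min d2 d3).
have d0 : 0 < d by rewrite !lt_min d10 d20.
have [dd1 dd2 dd3] : [/\ d <= d1, d <= d2 & d <= d3] by rewrite /d !ge_min !lexx !orbT.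
have xd : x - d < x + d by lra.
have k1 : cnt (x - d) (x + d) (cval f) by apply: cntS c1; lra.
have k2 : cnt (x - d) (x + d) (cval g) by apply: cntS c2; lra.
apply: (@cnt_ae_eq _ (x - d) (x + d) (fun y => cval f y ^+ 2 + cval g y ^+ 2) (fun=> 1)) => //.
- by apply: cntD; [exact: (cntM k1 k1)|exact: (cntM k2 k2)].
- exact: cnt_cst.
- apply: aeS2 e1 (aeS2 (fun y h h' => conj h h') e2 fg) => y E1 [E2 E] yd.
  have Dy : D y by apply: Dd; lra.
  by rewrite -E1// -E2// E.
- by lra.
Qed.

End Representative.

(** * The recovery curve at a fixed scale *)

Section Recovery.
Context {R : realType}.
Notation mu := (@lebesgue_measure R).
Notation W := (`[(-1 : R), 2]%classic).
Notation I01 := (unit_interval : set R).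
Implicit Types (x : R).

Lemma le_Rintegral_ae (E : set R) (f g : R -> R) : mset E -> itg E f -> itg E g ->
  {ae mu, forall x, E x -> f x <= g x} ->
  \int[mu]_(x in E) f x <= \int[mu]_(x in E) g x.
Proof.
move=> mE fi gi fg; have di := itgB mE gi fi.
rewrite -subr_ge0 -RintegralB//.
rewrite (@Rintegral_ae_eq _ _ _ (fun x => `|g x - f x|))//.
- by apply: Rintegral_ge0.
- exact: itg_measurable di.
- by apply: measurableT_comp => //; exact: itg_measurable di.
- by apply: aeS fg => x H /H gf; rewrite ger0_norm// subr_ge0.
Qed.

Variables (L : R) (N : nat) (alpha : R) (u : R -> R * R) (J : set R).
Hypotheses (L0 : 0 < L) (su : L2vec I01 u) (jJ : is_jump_set alpha u J).

Notation n0 := (2 * pi * N%:R : R).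
Notation D := (I01 `\` J).
Notation Jseq := (finmap.enum_fset (fset_set J)).

Let fJ : finite_set J. Proof. by case: jJ => [[]]. Qed.
Let J01 x : J x -> 0 <= x <= 1.
Proof. by case: jJ => [[_ H] _ _ _ _] /H; rewrite /= in_itv. Qed.
Let h1 : H1 D (fst \o u). Proof. by case: jJ => [_ [[]]]. Qed.
Let h2 : H1 D (snd \o u). Proof. by case: jJ => [_ [[]]]. Qed.
Let uunit : {ae mu, forall x, D x -> (u x).1 ^+ 2 + (u x).2 ^+ 2 = 1}.
Proof. by case: jJ => [_ []]. Qed.

Let mI : mset I01. Proof. exact: mset01. Qed.
Let mD : mset D. Proof. by apply: measurableD => //; exact: finite_mset. Qed.
Let mW : mset W. Proof. exact: measurable_itv. Qed.
Let oD : open D. Proof. by apply: open_setD_finite => //; exact: itv_open. Qed.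
Let DW : D `<=` W.
Proof. by move=> x [+ _]; apply: subset_itv; rewrite bnd_simp; lra. Qed.

Let A1 := extend 1 (cos alpha) (cval (fst \o u)).
Let A2 := extend 0 (sin alpha) (cval (snd \o u)).
Let G1 x := if `[< D x >] then wderiv D (fst \o u) x else 0.
Let G2 x := if `[< D x >] then wderiv D (snd \o u) x else 0.

Let Aleft x : x <= 0 -> A1 x = 1 /\ A2 x = 0.
Proof. by rewrite /A1 /A2 /extend => ->. Qed.
Let Aright x : 1 <= x -> A1 x = cos alpha /\ A2 x = sin alpha.
Proof. by move=> x1; rewrite /A1 /A2 /extend x1 leNgt (lt_le_trans ltr01 x1). Qed.
Let Ain x : 0 < x < 1 -> A1 x = cval (fst \o u) x /\ A2 x = cval (snd \o u) x.
Proof. by move=> /andP[x0 x1]; rewrite /A1 /A2 /extend !leNgt x0 x1. Qed.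
Let D01 x : D x -> 0 < x < 1. Proof. by case; rewrite /unit_interval /= in_itv. Qed.
Let Gin x : D x -> G1 x = wderiv D (fst \o u) x /\ G2 x = wderiv D (snd \o u) x.
Proof. by move=> Dx; rewrite /G1 /G2 asboolT. Qed.
Let Gout x : ~ D x -> G1 x = 0 /\ G2 x = 0.
Proof. by move=> Dx; rewrite /G1 /G2 asboolF. Qed.

Let sG (k : R -> R) : L2 D k -> sqint W (fun x => if `[< D x >] then k x else 0).
Proof.
move=> /(L2P _ mD) sk; apply: (@sqint_sub0 _ D) => //.
  by move=> x _ nD; rewrite asboolF.
by apply: eq_sqint sk => // x Dx; rewrite asboolT.
Qed.
Let sG1 : sqint W G1. Proof. by apply: sG; case: (wderivP h1). Qed.
Let sG2 : sqint W G2. Proof. by apply: sG; case: (wderivP h2). Qed.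

Let Aunit x : ~ J x -> A1 x ^+ 2 + A2 x ^+ 2 = 1.
Proof.
move=> Jx; have [x0|x0] := leP x 0; first by have [-> ->] := Aleft x0; rewrite expr1n expr0n addr0.
have [x1|x1] := leP 1 x; first by have [-> ->] := Aright x1; rewrite cos2Dsin2.
have [|-> ->] := @Ain x; first by rewrite x0.
apply: (cval_unit fJ h1 h2 uunit); split=> //.
by rewrite /unit_interval /= in_itv/= x0.
Qed.

Let uA : {ae mu, forall x, D x -> u x = (A1 x, A2 x)}.
Proof.
have [e1 _] := weak_deriv_cval oD mD (proj1 h1) (wderivP h1).
have [e2 _] := weak_deriv_cval oD mD (proj1 h2) (wderivP h2).
apply: aeS2 e1 e2 => x E1 E2 Dx; have [-> ->] := Ain (D01 Dx).
by rewrite -E1// -E2//=; case: (u x).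
Qed.

Let base_right x : 0 <= x < 1 -> exists c1 c2,
  [/\ right_prim A1 G1 x c1, right_prim A2 G2 x c2 & ~ J x -> c1 = A1 x /\ c2 = A2 x].
Proof.
move=> x01; have [r r0 rD] := right_gap fJ x01.
have [F1 [p1 a1 e1 v1]] := right_rep fJ h1 r0 rD.
have [F2 [p2 a2 e2 v2]] := right_rep fJ h2 r0 rD.
exists (F1 x), (F2 x); split.
- exists r; first exact: r0.
  exists F1, (wderiv D (fst \o u)); split; [exact: p1| |by []] => y yx.
  have [-> _] := Ain (D01 (rD y yx)); have [-> _] := Gin (rD y yx).
  by rewrite e1.
- exists r; first exact: r0.
  exists F2, (wderiv D (snd \o u)); split; [exact: p2| |by []] => y yx.
  have [_ ->] := Ain (D01 (rD y yx)); have [_ ->] := Gin (rD y yx).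
  by rewrite e2.
move=> Jx; have /andP[x0 x1] := x01.
move: x0; rewrite le_eqVlt => /predU1P[x0|x0]; last first.
  have Dx : D x by split=> //; rewrite /unit_interval /= in_itv/= x0.
  have [|-> ->] := @Ain x; first by rewrite x0.
  by rewrite v1// v2.
have [|-> ->] := @Aleft x; first by rewrite -x0.
have xr : x < x + r by lra.
have tr : right_trace u 0 (F1 x, F2 x).
  rewrite [X in right_trace u X]x0.
  apply/(right_traceP xr (prim_cnt p1) (prim_cnt p2)) => //.
  by apply: aeS2 a1 a2 => y E1 E2 yx; rewrite -E1// -E2//=; case: (u y).
(* At 0 the one-sided limit is the trace; if it were not [(1, 0)], then 0 would belong to [J]. *)
have [] : (F1 x, F2 x) = (1, 0).
  apply: contrapT => ne; apply: Jx; rewrite -x0.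
  by case: jJ => [_ _ _ [_ +] _]; apply; exists (F1 x, F2 x).
by [].
Qed.

Let base_left x : 0 < x <= 1 -> exists c1 c2,
  [/\ left_prim A1 G1 x c1, left_prim A2 G2 x c2 & ~ J x -> c1 = A1 x /\ c2 = A2 x].
Proof.
move=> x01; have [r r0 rD] := left_gap fJ x01.
have [F1 [p1 a1 e1 v1]] := left_rep fJ h1 r0 rD.
have [F2 [p2 a2 e2 v2]] := left_rep fJ h2 r0 rD.
exists (F1 x), (F2 x); split.
- exists r; first exact: r0.
  exists F1, (wderiv D (fst \o u)); split; [exact: p1| |by []] => y yx.
  have [-> _] := Ain (D01 (rD y yx)); have [-> _] := Gin (rD y yx).
  by rewrite e1.
- exists r; first exact: r0.
  exists F2, (wderiv D (snd \o u)); split; [exact: p2| |by []] => y yx.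
  have [_ ->] := Ain (D01 (rD y yx)); have [_ ->] := Gin (rD y yx).
  by rewrite e2.
move=> Jx; have /andP[x0 x1] := x01.
move: x1; rewrite le_eqVlt => /predU1P[x1|x1]; last first.
  have Dx : D x by split=> //; rewrite /unit_interval /= in_itv/= x0.
  have [|-> ->] := @Ain x; first by rewrite x0.
  by rewrite v1// v2.
have [|-> ->] := @Aright x; first by rewrite x1.
have xr : x - r < x by lra.
have tr : left_trace u 1 (F1 x, F2 x).
  rewrite -[X in left_trace u X]x1.
  apply/(left_traceP xr (prim_cnt p1) (prim_cnt p2)) => //.
  by apply: aeS2 a1 a2 => y E1 E2 yx; rewrite -E1// -E2//=; case: (u y).
have [] : (F1 x, F2 x) = cis alpha.
  apply: contrapT => ne; apply: Jx; rewrite x1.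
  by case: jJ => [_ _ _ _ [_ +]]; apply; exists (F1 x, F2 x).
by [].
Qed.

(* Jumps at the end points are moved inside by t. *)
Let move_in t c : R := if c == 0 then t else if c == 1 then 1 - t else c.
Let centers t := [seq move_in t c | c <- Jseq].
Let pcut t : R := if `[< J 0 >] then t else 0.
Let qcut t : R := if `[< J 1 >] then 1 - t else 1.
Let B1 t := cut (pcut t) (qcut t) 1 (cos alpha) A1.
Let B2 t := cut (pcut t) (qcut t) 0 (sin alpha) A2.
Let H1 t := cut (pcut t) (qcut t) 0 0 G1.
Let H2 t := cut (pcut t) (qcut t) 0 0 G2.

Let memJ c : c \in Jseq -> J c.
Proof. by rewrite in_fset_set// inE. Qed.

Let Jmem c : J c -> c \in Jseq.
Proof. by move=> Jc; rewrite in_fset_set// inE. Qed.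

Let center_sep : exists2 r, 0 < r & forall t, 0 < t < r ->
  [/\ uniq (centers t), (forall c d, c \in centers t -> d \in centers t -> c != d -> 2 * t < `|c - d|),
      (forall c, c \in centers t -> t <= c <= 1 - t) & 2 * t < 1].
Proof.
(* Adding 0 and 1 keeps interior jumps away from the end points, hence from the centres moved
   inside. Moves by at most [t < r] leave more than [2 * t] of a gap of more than [4 * r]. *)
pose s := undup (0 :: 1 :: Jseq).
have [| |r r0 [_ H]] := @seq_separated _ (-1) 2 s; first exact: undup_uniq.
  move=> x; rewrite mem_undup !inE => /or3P[/eqP->|/eqP->|/memJ/J01]; lra.
have sJ c : c \in Jseq -> c \in s by move=> cJ; rewrite mem_undup !inE cJ !orbT.
have s0 : 0 \in s by rewrite mem_undup !inE eqxx.
have s1 : 1 \in s by rewrite mem_undup !inE eqxx orbT.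
exists r => // t /andP[t0 tr].
have r1 : 4 * r < 1.
  by have := H 0 1 s0 s1; rewrite eq_sym oner_eq0 sub0r normrN normr1; exact.
have near_c c : `|move_in t c - c| <= t.
  rewrite /move_in; case: eqVneq => [->|_]; first by rewrite subr0 ger0_norm// ltW.
  case: eqVneq => [->|_]; last by rewrite subrr normr0 ltW.
  by rewrite addrAC subrr sub0r normrN ger0_norm// ltW.
have sep c d : c \in Jseq -> d \in Jseq -> c != d -> 2 * t < `|move_in t c - move_in t d|.
  move=> cJ dJ cd; have := H _ _ (sJ _ cJ) (sJ _ dJ) cd.
  have -> : c - d = (move_in t c - move_in t d) - (move_in t c - c) + (move_in t d - d) by ring.
  have h3 := near_c c; have h4 := near_c d.
  have h5 := ler_normD ((move_in t c - move_in t d) - (move_in t c - c)) (move_in t d - d).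
  have h6 := ler_normB (move_in t c - move_in t d) (move_in t c - c).
  lra.
split; last by lra.
- rewrite map_inj_in_uniq ?finmap.fset_uniq// => c d cJ dJ cd.
  apply/eqP; rewrite -[_ == _]negbK; apply/negP => ne.
  by have := sep c d cJ dJ ne; rewrite cd subrr normr0; lra.
- move=> _ _ /mapP[c cJ ->] /mapP[d dJ ->] ne; apply: sep => //.
  by apply: contraNneq ne => ->.
- move=> _ /mapP[c cJ ->]; rewrite /move_in.
  case: eqVneq => [_|c0]; first by rewrite lexx/=; lra.
  case: eqVneq => [_|c1]; first by rewrite lexx andbT; lra.
  have /andP[k1 k2] := J01 (memJ cJ).
  have := H _ _ (sJ _ cJ) s0 c0; have := H _ _ (sJ _ cJ) s1 c1.
  rewrite subr0 (ger0_norm k1) distrC ger0_norm ?subr_ge0//; lra.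
Qed.

Let X := \int[mu]_(x in D) ((twist D u x - n0) ^+ 2).

Let twist_sqint : sqint D (fun x => twist D u x - n0).
Proof.
have [/(L2P _ mD)[mu1 _] _] := h1; have [/(L2P _ mD)[mu2 _] _] := h2.
have [/(L2P _ mD)[mw1 iw1] _] := wderivP h1.
have [/(L2P _ mD)[mw2 iw2] _] := wderivP h2.
have mt : mfun_on D (twist D u).
  by apply: measurable_funB; exact: measurable_funM.
have Dy : (mu D < +oo)%E.
  apply: (@le_lt_trans _ _ (mu W)); first by apply: le_measure; rewrite ?inE.
  exact: (@mu_itv_lty _ _ (-1) 2).
apply: sqintB => //; last exact: sqint_cst.
split=> //; apply: (@itg_le_ae _ _ _ (fun x => 2 * (wderiv D (fst \o u) x ^+ 2 + wderiv D (snd \o u) x ^+ 2))) => //.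
- exact: measurable_funX.
- apply: aeS uunit => x + Dx => /(_ Dx) ux.
  rewrite ger0_norm ?sqr_ge0// /twist /wderiv_vec/=.
  set w2 := wderiv _ _ _; set w1 := wderiv _ _ _.
  have := sqr_ge0 ((u x).1 * w1 + (u x).2 * w2).
  (* Lagrange's identity: the squared cross product is the product of the squared lengths minus the
     squared inner product. *)
  have -> : ((u x).1 * w2 - (u x).2 * w1) ^+ 2 =
    ((u x).1 ^+ 2 + (u x).2 ^+ 2) * (w1 ^+ 2 + w2 ^+ 2) - ((u x).1 * w1 + (u x).2 * w2) ^+ 2 by ring.
  rewrite ux mul1r; have := sqr_ge0 w1; have := sqr_ge0 w2; lra.
- by apply: itgZ => //; exact: itgD.
Qed.

Section FixedScale.
Variable t : R.
Hypotheses (t0 : 0 < t) (t12 : 2 * t < 1).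

Let cut_bounds : [/\ 0 <= pcut t, pcut t <= t, 1 - t <= qcut t & qcut t <= 1].
Proof. by have := t0; rewrite /pcut /qcut; do 2!case: asboolP => _; split; lra. Qed.

Let pq : pcut t < qcut t.
Proof. by have := t12; case: cut_bounds; lra. Qed.

Let pcenter : pcut t \notin centers t -> A1 (pcut t) = 1 /\ A2 (pcut t) = 0.
Proof.
rewrite /pcut; case: asboolP => [j0|_ _]; last exact: Aleft.
by case/negP; apply/mapP; exists 0; [exact: Jmem|rewrite /move_in eqxx].
Qed.

Let qcenter : qcut t \notin centers t -> A1 (qcut t) = cos alpha /\ A2 (qcut t) = sin alpha.
Proof.
rewrite /qcut; case: asboolP => [j1|_ _]; last exact: Aright.
by case/negP; apply/mapP; exists 1; [exact: Jmem|rewrite /move_in oner_eq0 eqxx].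
Qed.

Let not_jump x : pcut t <= x -> x <= qcut t -> x \notin centers t -> ~ J x.
Proof.
move=> px xq xs Jx; have [x0|x0] := eqVneq x 0.
  by move: px; rewrite x0 in Jx *; rewrite /pcut asboolT// leNgt t0.
have [x1|x1] := eqVneq x 1.
  by move: xq; rewrite x1 in Jx *; rewrite /qcut asboolT// leNgt ltrBlDr ltrDl t0.
case/negP: xs; apply/mapP; exists x; first exact: Jmem.
by rewrite /move_in (negbTE x0) (negbTE x1).
Qed.

Let pw : piecewise_prim (centers t) (B1 t) (H1 t) /\ piecewise_prim (centers t) (B2 t) (H2 t).
Proof.
have [p0 _ _ q1] := cut_bounds.
split; apply: piecewise_cut => //.
- move=> x px xq; have [|c1 [c2 [r1 r2 H]]] := @base_right x; first lra.
  by exists c1; split=> // xs; have [] := H (not_jump px (ltW xq) xs).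
- move=> x px xq; have [|c1 [c2 [r1 r2 H]]] := @base_left x; first lra.
  by exists c1; split=> // xs; have [] := H (not_jump (ltW px) xq xs).
- by case/pcenter.
- by case/qcenter.
- move=> x px xq; have [|c1 [c2 [r1 r2 H]]] := @base_right x; first lra.
  by exists c2; split=> // xs; have [] := H (not_jump px (ltW xq) xs).
- move=> x px xq; have [|c1 [c2 [r1 r2 H]]] := @base_left x; first lra.
  by exists c2; split=> // xs; have [] := H (not_jump (ltW px) xq xs).
- by case/pcenter.
- by case/qcenter.
Qed.

Hypotheses (us : uniq (centers t))
  (sep : forall c d, c \in centers t -> d \in centers t -> c != d -> 2 * t < `|c - d|)
  (s01 : forall c, c \in centers t -> t <= c <= 1 - t).

Let sH (k : R -> R) : sqint W k -> sqint W (cut (pcut t) (qcut t) 0 0 k).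
Proof.
move=> sk; pose S := `[pcut t, qcut t[%classic.
have [p0 _ _ q1] := cut_bounds.
have mS : mset S by exact: measurable_itv.
have SW : S `<=` W by apply: subset_itv; rewrite bnd_simp; lra.
apply: (@sqint_sub0 _ S) => //.
  move=> x _; rewrite /S /= in_itv/= /cut => nx.
  case: ltP => // px; case: leP => // xq.
  by case: nx; rewrite px xq.
apply: (@eq_sqint _ _ k) => //; last exact: sqintS sk.
by move=> x; rewrite /S /= in_itv/= /cut => /andP[px xq]; rewrite ltNge px/= leNgt xq.
Qed.

Let cut_le (k : R -> R) x : cut (pcut t) (qcut t) 0 0 k x ^+ 2 <= k x ^+ 2.
Proof. by rewrite /cut; case: ifP; [|case: ifP => //]; rewrite expr0n sqr_ge0. Qed.

Let Hout x : ~ (0 < x < 1) -> H1 t x = 0 /\ H2 t x = 0.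
Proof.
move=> nx; have [g1 g2] : G1 x = 0 /\ G2 x = 0 by apply: Gout => /D01.
by rewrite /H1 /H2 /cut g1 g2; case: ifP => //; case: ifP.
Qed.

Let Bunit x : x \notin centers t -> B1 t x ^+ 2 + B2 t x ^+ 2 = 1.
Proof.
move=> xs; rewrite /B1 /B2 /cut; case: ltP => [_|px]; first by rewrite expr1n expr0n addr0.
case: leP => [_|xq]; first exact: cos2Dsin2.
exact: Aunit (not_jump px (ltW xq) xs).
Qed.

Let Bleft x : x <= 0 -> (B1 t x, B2 t x) = (1, 0).
Proof.
move=> x0; have [p0 _ q1 _] := cut_bounds; have := t12; have := t0 => h h'.
rewrite /B1 /B2 /cut; case: ltP => // _.
have -> : (qcut t <= x) = false by apply/negbTE; rewrite -ltNge; lra.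
by have [-> ->] := Aleft x0.
Qed.

Let Bright x : 1 <= x -> (B1 t x, B2 t x) = cis alpha.
Proof.
move=> x1; have [_ p0 _ q1] := cut_bounds; have := t12; have := t0 => h h'.
have qx : qcut t <= x by lra.
rewrite /B1 /B2 /cut.
have -> : (x < pcut t) = false by apply/negbTE; rewrite -leNgt; lra.
by rewrite qx.
Qed.

(** The parts cut off near 0 and 1 lie within [t] of the centres moved inside, so a point far from
    all centres sees the original curve with modulus 1. *)
Let hit x : 0 < x < 1 -> (forall c, c \in centers t -> t <= `|x - c|) /\ pcut t <= x < qcut t
  \/ 1 <= hits t (centers t) x.
Proof.
move=> /andP[x0 x1]; have [H|] := pselect (forall c, c \in centers t -> t <= `|x - c|); last first.
  move=> /existsNP[c /not_implyP[cs /negP]]; rewrite -ltNge => xc; right.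
  rewrite /hits (big_rem c)//= xc lerDl.
  by apply: sumr_ge0 => d _; rewrite ler0n.
left; split=> //; apply/andP; split; rewrite /pcut /qcut; case: asboolP => [j|_] //; try exact: ltW.
  rewrite leNgt; apply/negP => xt.
  have : t <= `|x - t|.
    by apply: H; apply/mapP; exists 0; [exact: Jmem|rewrite /move_in eqxx].
  by rewrite distrC ger0_norm; lra.
rewrite ltNge; apply/negP => xt.
have : t <= `|x - (1 - t)|.
  by apply: H; apply/mapP; exists 1; [exact: Jmem|rewrite /move_in oner_eq0 eqxx].
by rewrite ger0_norm; lra.
Qed.

Let v x := (rho t (centers t) x * B1 t x, rho t (centers t) x * B2 t x).

Let adm : admissible alpha v.
Proof.
have [pw1 pw2] := pw.
exact: (recovery_admissible t0 us sep s01 pw1 pw2 (sH sG1) (sH sG2) Bunit Bleft Bright).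
Qed.

Let ae_good : {ae mu, forall x, I01 x -> [/\ D x, x \notin centers t & u x = (A1 x, A2 x)]}.
Proof.
have a1 := finite_ae_notin fJ.
have a2 : {ae mu, forall x, x \notin centers t}.
  by apply: aeS (finite_ae_notin (finite_seq (centers t))) => x /= /negP.
apply: aeS2 uA (aeS2 (fun x h h' => conj h h') a1 a2) => x E [nJ nc] xI.
by have Dx : D x by []; split=> //; exact: E.
Qed.

Let norm_le1 (a b : R) : a ^+ 2 + b ^+ 2 = 1 -> `|a| <= 1 /\ `|b| <= 1.
Proof.
move=> ab; have [a2 b2] : a ^+ 2 <= 1 /\ b ^+ 2 <= 1.
  by rewrite -ab lerDl lerDr !sqr_ge0.
by split; rewrite -(expr_le1 (n := 2))// sqr_normr.
Qed.

(** The curves agree far from the centres and differ by at most 2 near them; a squared difference of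
    4 on a length [2 * t] per centre gives the constant 8. *)
Let dist_le (k A B : R -> R) : mfun_on I01 k -> mfun_on I01 (fun x => rho t (centers t) x * B x) ->
  {ae mu, forall x, I01 x -> [/\ k x = A x, `|A x| <= 1, `|B x| <= 1 & pcut t <= x < qcut t -> B x = A x]} ->
  nrm I01 (fun x => rho t (centers t) x * B x - k x) ^+ 2 <= (8 * (size Jseq)%:R) * t.
Proof.
move=> mk mB H; rewrite sqr_nrm.
have [hi hb] := hits_ig t0 (centers t) (@ler01 R).
have SI : I01 `<=` `[0, 1] by apply: subset_itv; rewrite bnd_simp.
have hiI : itg I01 (hits t (centers t)) by exact: itgS hi.
have dh : {ae mu, forall x, I01 x ->
    (rho t (centers t) x * B x - k x) ^+ 2 <= 4 * hits t (centers t) x}.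
  apply: aeS H => x Hx xI; have [kA A1' B1' BA] := Hx xI.
  have x01 : 0 < x < 1 by move: xI; rewrite /unit_interval /= in_itv.
  have [[far pxq]|hx] := hit x01.
    have [-> _] := rho_far far.
    by rewrite BA// kA mul1r subrr expr0n mulr_ge0// hits_ge0.
  apply: (@le_trans _ _ (2 ^+ 2)); last by lra.
  rewrite -sqr_normr lerXn2r ?nnegrE//.
  apply: le_trans (ler_normB _ _) _; rewrite kA (_ : 2 = 1 + 1) ?lerD//.
  have /andP[r0 r1] := rho_bound t0 (centers t) x.
  by rewrite normrM mulr_ile1// ger0_norm.
have di : itg I01 (fun x => (rho t (centers t) x * B x - k x) ^+ 2).
  apply: (@itg_le_ae _ _ _ (fun x => 4 * hits t (centers t) x)) => //.
  - by apply: measurable_funX; apply: measurable_funB.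
  - by apply: aeS dh => x K xI; rewrite ger0_norm ?sqr_ge0// K.
  - exact: itgZ.
apply: le_trans (le_Rintegral_ae mI di (itgZ 4 mI hiI) dh) _.
rewrite RintegralZl// /unit_interval ig_oo//.
apply: le_trans (_ : 4 * ((size (centers t))%:R * (2 * t)) <= _); first by rewrite ler_pM2l.
by rewrite size_map; lra.
Qed.

(** Near a centre the torque is that of the limit times some [w] in [[0, 1]]; by convexity of the
    square, its squared deviation from [n0] exceeds that of the limit by at most [n0 ^ 2]. *)
Let torque_le :
  ig 0 1 (fun x => (rho t (centers t) x ^+ 2 * (B1 t x * H2 t x - B2 t x * H1 t x) - n0) ^+ 2)
   <= X + n0 ^+ 2 * ((size Jseq)%:R * (2 * t)).
Proof.
have [pw1 pw2] := pw.
have m01 : mset `[(0 : R), 1] by exact: measurable_itv.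
have y01 : (mu `[0%R : R, 1%R]%classic < +oo)%E by exact: (@mu_itv_lty _ _ 0 1).
have [_ fi] := sqintB m01 (recovery_torque t0 us sep s01 pw1 pw2 (sH sG1) (sH sG2) Bunit)
  (sqint_cst n0 m01 y01).
have [hi hb] := hits_ig t0 (centers t) (@ler01 R).
have [_ ti] := twist_sqint.
rewrite -(Rintegral_setD_finite fJ fi).
have DS : D `<=` `[0, 1] by move=> x [+ _]; apply: subset_itv; rewrite bnd_simp.
have hiD : itg D (hits t (centers t)) by exact: itgS hi.
have fiD := itgS mD m01 DS fi.
have hD := itgZ (n0 ^+ 2) mD hiD.
apply: le_trans (le_Rintegral_ae mD fiD (itgD mD ti hD) _) _; last first.
  rewrite RintegralD// lerD2l RintegralZl// ler_wpM2l ?sqr_ge0//.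
  rewrite (Rintegral_setD_finite fJ hi); apply: le_trans hb _.
  by rewrite size_map.
apply: aeS ae_good => x Hx Dx; have [_ xc ux] : [/\ D x, x \notin centers t & u x = (A1 x, A2 x)].
  by apply: Hx; case: Dx.
have x01 := D01 Dx.
have tE : twist D u x = A1 x * G2 x - A2 x * G1 x.
  by rewrite /twist /wderiv_vec ux/=; have [-> ->] := Gin Dx.
rewrite tE; set tau := A1 x * _ - _.
have hx0 := hits_ge0 t (centers t) x.
have [r0 r1] := andP (rho_bound t0 (centers t) x).
have tauE : pcut t <= x < qcut t -> B1 t x * H2 t x - B2 t x * H1 t x = tau.
  by move=> /andP[px xq]; rewrite /B1 /B2 /H1 /H2 /cut ltNge px/= leNgt xq.
have [[far pxq]|hx] := hit x01.
  have [-> _] := rho_far far.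
  by rewrite tauE// expr1n mul1r lerDl mulr_ge0 ?sqr_ge0.
(* [w] is [rho^2] where the curve is kept, and 0 where it was replaced by a constant. *)
have w01 : exists2 w, 0 <= w <= 1 &
    rho t (centers t) x ^+ 2 * (B1 t x * H2 t x - B2 t x * H1 t x) = w * tau.
  have [/tauE->|npq] := boolP (pcut t <= x < qcut t).
    by exists (rho t (centers t) x ^+ 2) => //; rewrite sqr_ge0 expr_le1.
  exists 0; first by rewrite lexx ler01.
  rewrite /H1 /H2 /cut; move: npq; rewrite negb_and -ltNge -leNgt.
  by case: ltP => /= [_ _|_ ->]; rewrite !mulr0 subrr mulr0 mul0r.
have [w /andP[w0 w1] ->] := w01.
apply: (@le_trans _ _ (w * (tau - n0) ^+ 2 + (1 - w) * n0 ^+ 2)).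
  have -> : w * (tau - n0) ^+ 2 + (1 - w) * n0 ^+ 2 = (w * tau - n0) ^+ 2 + w * (1 - w) * tau ^+ 2.
    by ring.
  by rewrite lerDl mulr_ge0 ?sqr_ge0// mulr_ge0// subr_ge0.
apply: lerD; first by rewrite ler_piMl ?sqr_ge0.
rewrite mulrC ler_wpM2l ?sqr_ge0//; lra.
Qed.

Lemma recovery_fixed_scale : t <= 1 -> let m := (size Jseq)%:R in
  exists v, [/\ admissible alpha v,
    nrm I01 (fun x => (v x).1 - (u x).1) ^+ 2 <= 8 * m * t,
    nrm I01 (fun x => (v x).2 - (u x).2) ^+ 2 <= 8 * m * t &
    (energy L N alpha (t ^+ 2) v <=
      (2 * Num.sqrt 2 / 3 * m + L / 2 * X +
       (17 * m * (2 * Num.sqrt 2 / 3) + ig (-1) 2 (fun x => G1 x ^+ 2 + G2 x ^+ 2)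
         + L * n0 ^+ 2 * m) * t)%:E)%E].
Proof.
move=> t1 m; exists v.
have [/(L2P _ mI)[mu1 _] /(L2P _ mI)[mu2 _]] := su.
have [[/(L2P _ mI)[mv1 _] _] [/(L2P _ mI)[mv2 _] _]] : H1vec I01 v by case: adm.
have BA x : pcut t <= x < qcut t -> B1 t x = A1 x /\ B2 t x = A2 x.
  by move=> /andP[px xq]; rewrite /B1 /B2 /cut ltNge px/= leNgt xq.
split; first exact: adm.
- apply: (@dist_le _ A1) => //.
  apply: aeS ae_good => x Hx xI; have [[_ nJ] xc ux] := Hx xI.
  have [a1 a2] := norm_le1 (Aunit nJ); have [b1 b2] := norm_le1 (Bunit xc).
  by split=> // [|/BA[]//]; rewrite ux.
- apply: (@dist_le _ A2) => //.
  apply: aeS ae_good => x Hx xI; have [[_ nJ] xc ux] := Hx xI.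
  have [a1 a2] := norm_le1 (Aunit nJ); have [b1 b2] := norm_le1 (Bunit xc).
  by split=> // [|/BA[]//]; rewrite ux.
have [pw1 pw2] := pw.
have [Y YH ->] := recovery_energy t0 L N us sep s01 pw1 pw2 (sH sG1) (sH sG2) Hout Bunit Bleft Bright.
rewrite lee_fin.
have tq := torque_le; set T := ig 0 1 _ in tq *.
have m0 : 0 <= m by rewrite ler0n.
have sz : (size (centers t))%:R = m by rewrite size_map.
rewrite sz in YH; set C := 2 * Num.sqrt 2 / 3 in YH *.
have C0 : 0 <= C by rewrite divr_ge0// mulr_ge0.
have [_ i1] := sG1; have [_ i2] := sG2.
set K := ig (-1) 2 (fun x => G1 x ^+ 2 + G2 x ^+ 2).
have KK : ig (-1) 2 (fun x => H1 t x ^+ 2 + H2 t x ^+ 2) <= K.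
  have [_ j1] := sH sG1; have [_ j2] := sH sG2.
  by apply: ig_le; [exact: itgD|exact: itgD|move=> x _; apply: lerD; exact: cut_le].
have K0 : 0 <= K by apply: Rintegral_ge0 => x _; rewrite addr_ge0 ?sqr_ge0.
have /andP[k1 k2] := th_scale_bound t0.
have tt0 := t0.
(* Since [t <= 1], the product [(1 + t) (1 + 2 t)^2 = 1 + 5 t + 8 t^2 + 4 t^3] is at most
   [1 + 17 t]. *)
have kk : (1 + t) * th_scale t ^+ 2 <= 1 + 17 * t.
  apply: (@le_trans _ _ ((1 + t) * (1 + 2 * t) ^+ 2)).
    rewrite ler_pM2l; last by lra.
    by rewrite lerXn2r ?nnegrE; lra.
  have t2 : t * t <= t by rewrite ler_piMl// ltW.
  have t3 : t * t * t <= t.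
    by apply: le_trans t2; rewrite ler_piMr// mulr_ge0// ltW.
  rewrite (_ : (1 + t) * (1 + 2 * t) ^+ 2 = 1 + 5 * t + 8 * (t * t) + 4 * (t * t * t)); last by ring.
  lra.
have E1 : (1 + t) * (m * (th_scale t ^+ 2 * C)) <= (1 + 17 * t) * (m * C).
  rewrite (_ : _ * (m * _) = (1 + t) * th_scale t ^+ 2 * (m * C)); last by ring.
  by rewrite ler_wpM2r// mulr_ge0.
have E2 : (t ^+ 2 + t) / 2 * ig (-1) 2 (fun x => H1 t x ^+ 2 + H2 t x ^+ 2) <= t * K.
  apply: ler_pM => //.
  - by rewrite divr_ge0// addr_ge0 ?sqr_ge0// ltW.
  - by apply: Rintegral_ge0 => x _; rewrite addr_ge0 ?sqr_ge0.
  - rewrite expr2; have : t * t <= t by rewrite ler_piMl// ltW.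
    lra.
have E3 : L / 2 * T <= L / 2 * (X + n0 ^+ 2 * (m * (2 * t))).
  by rewrite ler_wpM2l// divr_ge0// ltW.
apply: le_trans (lerD (le_trans YH (lerD E1 E2)) E3) _.
by rewrite le_eqVlt; apply/orP; left; apply/eqP; field.
Qed.

End FixedScale.

Lemma recovery_scale : exists2 t1, 0 < t1 & exists K, forall t, 0 < t < t1 ->
  exists v, [/\ admissible alpha v,
    nrm I01 (fun x => (v x).1 - (u x).1) ^+ 2 <= K * t,
    nrm I01 (fun x => (v x).2 - (u x).2) ^+ 2 <= K * t &
    (energy L N alpha (t ^+ 2) v <=
      (2 * Num.sqrt 2 / 3 * (size Jseq)%:R +
       L / 2 * \int[mu]_(x in D) ((twist D u x - n0) ^+ 2) + K * t)%:E)%E].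
Proof.
have [r r0 H] := center_sep.
pose m : R := (size Jseq)%:R.
pose K1 : R := 8 * m.
pose K2 := 17 * m * (2 * Num.sqrt 2 / 3) + ig (-1) 2 (fun x => G1 x ^+ 2 + G2 x ^+ 2)
         + L * n0 ^+ 2 * m.
have m0 : 0 <= m by rewrite ler0n.
exists r => //; exists (Num.max K1 K2) => t /[dup] /andP[t0 _] /H[us sep s01 t12].
have t1 : t <= 1 by lra.
have [v [av d1 d2 ev]] := recovery_fixed_scale t0 t12 us sep s01 t1.
have k1 : K1 * t <= Num.max K1 K2 * t by rewrite ler_wpM2r ?(ltW t0)// le_max lexx.
exists v; split=> //; [exact: le_trans d1 k1|exact: le_trans d2 k1|].
apply: le_trans ev _; rewrite lee_fin lerD2l ler_wpM2r ?(ltW t0)//.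
by rewrite le_max lexx orbT.
Qed.

Lemma twist_finite :
  (\int[mu]_(x in D) ((twist D u x - n0) ^+ 2)%:E =
   (\int[mu]_(x in D) ((twist D u x - n0) ^+ 2))%:E)%E.
Proof. by rewrite fineK//; apply: integrable_fin_num => //; case: twist_sqint. Qed.

End Recovery.

(** * From fixed scales to the recovery family *)

Section GammaLimsup.
Context {R : realType}.
Notation mu := (@lebesgue_measure R).
Notation I01 := (unit_interval : set R).

Lemma limf_einf_near (F : set_system R) (f : R -> \bar R) (c : R) : Filter F ->
  (c%:E < limf_einf f F)%E -> \forall x \near F, (c%:E <= f x)%E.
Proof.
move=> FF; rewrite limf_einfE => /ereal_sup_gt[_ [V FV <-]] cV.
apply: filterS FV => x Vx; apply: le_trans (ltW cV) _.
by apply: ereal_inf_lbound; exists x.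
Qed.

(** A recovery family therefore needs only an upper bound on its energies; the matching lower bound
    is the liminf inequality. *)
Lemma cvg_limf_einf_le (F : set_system R) (f : R -> \bar R) (c : R) : ProperFilter F ->
  (c%:E <= limf_einf f F)%E ->
  (forall e : R, 0 < e -> \forall x \near F, (f x <= (c + e)%:E)%E) -> f x @[x --> F] --> c%:E.
Proof.
move=> FF lo up.
have near_c (e : R) : 0 < e -> \forall x \near F, ((c - e)%:E <= f x <= (c + e)%:E)%E.
  move=> e0; near=> x; apply/andP; split; last by near: x; exact: up.
  near: x; apply: limf_einf_near; apply: lt_le_trans lo.
  by rewrite lte_fin ltrBlDr ltrDl.
have fin (e : R) y : ((c - e)%:E <= y <= (c + e)%:E)%E -> y \is a fin_num.
  by move=> /andP[a b]; rewrite fin_real// (lt_le_trans _ a) ?ltNyr// (le_lt_trans b)// ltry.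
apply/fine_cvgP; split.
  by near=> x; apply: (@fin 1); near: x; exact: near_c.
apply/cvgrPdist_le => e e0; near=> x.
have H : ((c - e)%:E <= f x <= (c + e)%:E)%E by near: x; exact: near_c.
have fx := fin _ _ H; move: H; rewrite -(fineK fx) !lee_fin /= => /andP[a b].
by rewrite ler_distlC; apply/andP; split; lra.
Unshelve. all: by end_near. Qed.

Lemma gamma_limsup (L : R) (N : nat) (alpha : R) (u : R -> R * R) : 0 < L -> L2vec I01 u ->
  exists v_ : R -> R -> R * R, [/\ (forall eps : R, 0 < eps -> L2vec I01 (v_ eps)),
    L2_cvg I01 v_ u & energy L N alpha eps (v_ eps) @[eps --> 0^'+] --> limit_energy L N alpha u].
Proof.
move=> L0 su.
have cvg_of_le (v_ : R -> R -> R * R) : (forall eps : R, 0 < eps -> L2vec I01 (v_ eps)) ->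
    L2_cvg I01 v_ u -> (limit_energy L N alpha u <= limf_einf (fun eps => energy L N alpha eps (v_ eps)) (0 : R)^'+)%E.
  by move=> sv cv; exact: gamma_liminf.
(* When the limit energy is infinite the constant family will do: the liminf inequality already
   forces its energies to infinity. *)
have [exJ|nJ] := pselect (exists J, is_jump_set alpha u J); last first.
  have cu : L2_cvg I01 (fun=> u) u.
    apply/(L2_cvgP mset01 su) => [eps _ //|e e0]; near=> eps.
    have z (k : R -> R) : nrm I01 (fun x => k x - k x) = 0.
      rewrite -(@eq_nrm _ _ (fun=> 0)) => [|x _]; last by rewrite subrr.
      by rewrite /nrm expr0n/= Rintegral_cst//; [rewrite mul0r sqrtr0|exact: mset01].
    by rewrite !z ltW.
  exists (fun=> u); split=> //.
  have := cvg_of_le _ (fun _ _ => su) cu.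
  rewrite /limit_energy asboolF// leye_eq => /eqP H.
  apply/cvgeyPge => A; apply: limf_einf_near; by rewrite H ltry.
have jJ := jump_setP exJ; set J := jump_set alpha u in jJ.
have [t1 t10 [K HK]] := recovery_scale N L0 su jJ.
have cE := limit_energyE L (erefl J) jJ (twist_finite N jJ).
set X := \int[mu]_(x in _) _ in cE HK.
have [t|v vH] := @choice _ _ (fun t v => 0 < t < t1 -> [/\ admissible alpha v,
    nrm I01 (fun x => (v x).1 - (u x).1) ^+ 2 <= K * t,
    nrm I01 (fun x => (v x).2 - (u x).2) ^+ 2 <= K * t &
    (energy L N alpha (t ^+ 2) v <= (2 * Num.sqrt 2 / 3 * (size (finmap.enum_fset (fset_set J)))%:R
        + L / 2 * X + K * t)%:E)%E]).
  by have [/HK[v ?]|nt] := boolP (0 < t < t1); [exists v|exists u].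
(* The scale is [t = sqrt eps]; for [eps] out of range [u] is a placeholder, which the limit at 0
   does not see. *)
pose v_ eps := if 0 < Num.sqrt eps < t1 then v (Num.sqrt eps) else u.
have small (e : R) : 0 < e -> \forall eps \near (0 : R)^'+,
    [/\ 0 < eps, 0 < Num.sqrt eps < t1 & K * Num.sqrt eps <= e].
  move=> e0; have K1 : 0 < `|K| + 1 by rewrite ltr_wpDl.
  pose d := Num.min t1 (e / (`|K| + 1)).
  have d0 : 0 < d by rewrite lt_min t10 divr_gt0.
  near=> eps.
  have eps0 : 0 < eps by near: eps; exact: nbhs_right_gt.
  have epsd : eps < d ^+ 2 by near: eps; apply: nbhs_right_lt; exact: exprn_gt0.
  have sd : Num.sqrt eps < d.
    by rewrite -[ltRHS](ger0_norm (ltW d0)) -sqrtr_sqr ltr_sqrt// exprn_gt0.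
  split=> //; first by rewrite sqrtr_gt0 eps0 (lt_le_trans sd)// ge_min lexx.
  apply: (@le_trans _ _ ((`|K| + 1) * Num.sqrt eps)).
    by rewrite ler_wpM2r ?sqrtr_ge0// (le_trans (ler_norm _))// lerDl.
  by rewrite mulrC -ler_pdivlMr// (le_trans (ltW sd))// ge_min lexx orbT.
have sv eps : 0 < eps -> L2vec I01 (v_ eps).
  rewrite /v_ => _; case: ifP => // /vH[[[[h1 _] [h2 _]] _ _] _ _ _].
  by split.
have cv : L2_cvg I01 v_ u.
  apply/(L2_cvgP mset01 su sv) => e e0; near=> eps.
  have [eps0 st Ke] : [/\ 0 < eps, 0 < Num.sqrt eps < t1 & K * Num.sqrt eps <= e ^+ 2].
    by near: eps; apply: small; exact: exprn_gt0.
  have [_ d1 d2 _] := vH _ st.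
  by rewrite /v_ st; split;
    rewrite -(ler_pXn2r (n := 2)) ?nnegrE ?nrm_ge0 ?(ltW e0)//;
    [exact: le_trans d1 Ke|exact: le_trans d2 Ke].
exists v_; split=> //; rewrite cE; apply: cvg_limf_einf_le.
  by rewrite -cE; exact: cvg_of_le.
move=> e e0; near=> eps.
have [eps0 st Ke] : [/\ 0 < eps, 0 < Num.sqrt eps < t1 & K * Num.sqrt eps <= e].
  by near: eps; exact: small.
have [_ _ _ H] := vH _ st.
rewrite /v_ st -{1}(sqr_sqrtr (ltW eps0)); apply: le_trans H _.
by rewrite lee_fin [L / 2 * _ + _]addrC lerD2l.
Unshelve. all: by end_near. Qed.

End GammaLimsup.

Theorem theorem3p1 (R : realType) (L : R) (N : nat) (alpha : R)
    (hL : 0 < L) (hN : (0 < N)%N) (halpha : 0 <= alpha < 2 * pi) :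
  Gamma_cvg_L2 unit_interval (energy L N alpha) (limit_energy L N alpha).
Proof.
by split=> [u_ u|u]; [exact: gamma_liminf|exact: gamma_limsup].
Qed.
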